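(* Let $f:\mathbb T^2\to\mathbb T^2$ be the Katok map, let $\nu_0=\pi_*\mu_1$, and let $0<\epsilon\ll\beta$ be such that there is a neighborhood $U$ of $\nu_0$ in $\mathscr M_{\rm inv}(\mathbb T^2,f)$ with the property that every ergodic $\nu\in U$ belongs to $\mathscr M_{\rm inv}(\widetilde\Lambda(\beta,\beta,\epsilon),f)$, where $\widetilde\Lambda(\beta,\beta,\epsilon)=\bigcup_{k\ge1}\mathrm{supp}(\nu_0|\Lambda_k(\beta,\beta,\epsilon))$. Write $\widetilde\Lambda=\widetilde\Lambda(\beta,\beta,\epsilon)$ and $N(\widetilde\Lambda)=\{x\in\mathbb T^2:V(x)\cap\mathscr M_{\rm inv}(\widetilde\Lambda,f)\ne\emptyset\}$. Let $\varphi\in C^0(\mathbb T^2)$ and put $\widehat{\mathbb T^2}(\varphi|N(\widetilde\Lambda),f)=\widehat{\mathbb T^2}(\varphi,f)\cap N(\widetilde\Lambda)$. Then (at least) one of the following conclusions holds. 1. The function $\mu\mapsto\int\varphi\,d\mu$ is constant for $\mu\in\mathscr M_{\rm inv}(\widetilde\Lambda,f)$. 2. $\widehat{\mathbb T^2}(\varphi|N(\widetilde\Lambda),f)\neq\emptyset$ and $$h_{top}\left(\widehat{\mathbb T^2}(\varphi|N(\widetilde\Lambda),f)\right)=\sup\left\{h_\mu(f):\mu\in\mathscr M_{\rm inv}(\widetilde\Lambda,f)\right\}.$$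
   Context: Katok map. Let $f_0$ be the linear automorphism of $\mathbb T^2$ given by $A=\begin{pmatrix}2&1\\1&1\end{pmatrix}$, with eigenvalues $\lambda^{-1}<1<\lambda$, and let $\mu_1$ be its measure of maximal entropy. Let $D_r$ be the disk of small radius $r$ centered at $(0,0)$, with coordinates $(s_1,s_2)$ along the eigendirections of $A$, so that $A(s_1,s_2)=(\lambda s_1,\lambda^{-1}s_2)$. Let $\psi:[0,1]\to\mathbb R$ satisfy: $\psi$ is $C^\infty$ except at $0$; $\psi(0)=0$ and $\psi(u)=1$ for $u\ge r_0$, where $0<r_0<1$; $\psi'(u)>0$ for $0<u<r_0$; $\int_0^1\frac{du}{\psi(u)}<\infty$. Fix sufficiently small numbers $r_0<r_1$ and let $g$ be the time-1 map of the system in $D_{r_1}$ $$\frac{ds_1}{dt}=s_1\psi(s_1^2+s_2^2)\log\lambda,\qquad \frac{ds_2}{dt}=-s_2\psi(s_1^2+s_2^2)\log\lambda.$$ The map $f$ is $f(x)=g(x)$ for $x\in D_{r_1}$ and $f(x)=A(x)$ otherwise. It is a homeomorphism of the torus that is a $C^\infty$ diffeomorphism away from the origin; $\psi$ is assumed to satisfy in addition the conditions of Katok (the integral $\int_0^1du/\psi$ converges sufficiently slowly near $0$) guaranteeing that $f$ is a $C^{1+\alpha}$ diffeomorphism. There is a homeomorphism $\pi:\mathbb T^2\to\mathbb T^2$ with $\pi\circ f_0=f\circ\pi$; $\nu_0=\pi_*\mu_1$. It is known (Liang–Liao–Sun–Tian) that $\beta,\epsilon,U$ as in the claim exist. Measures.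 $\mathscr M_{\rm inv}(\mathbb T^2,f)$ is the set of $f$-invariant Borel probability measures with the weak-$*$ topology. For an $f$-invariant $Z\subset\mathbb T^2$, $\mathscr M_{\rm inv}(Z,f)$ is the set of those with $\nu(Z)=1$. $h_\mu(f)$ is metric entropy. $C^0(\mathbb T^2)$ is the space of continuous real functions on $\mathbb T^2$. Empirical measures. $V(x)$ is the set of (weak-$*$) subsequential limits of $\mathscr E_n(x)=\frac1n\sum_{i=0}^{n-1}\delta_{f^ix}$. Historic set. $\widehat{\mathbb T^2}(\varphi,f)=\{x\in\mathbb T^2:\lim_{n\to\infty}\frac1n\sum_{i=0}^{n-1}\varphi(f^ix)\text{ does not exist}\}$. Pesin blocks. For $k\in\mathbb Z^+$ and $\beta_1,\beta_2\gg\epsilon>0$ ($\epsilon$ small compared with $\beta_1,\beta_2$, as usual in Pesin theory), $\Lambda_k(\beta_1,\beta_2,\epsilon)$ consists of all $x$ for which there is a decomposition $T_x\mathbb T^2=E^s_x\oplus E^u_x$ with: (i) $Df^t(E^s_x)=E^s_{f^tx}$ and $Df^t(E^u_x)=E^u_{f^tx}$; (ii) $\|Df^n|E^s_{f^tx}\|\le e^{\epsilon k}e^{-(\beta_1-\epsilon)n}e^{\epsilon|t|}$ for all $t\in\mathbb Z$, $n\ge1$; (iii) $\|Df^{-n}|E^u_{f^tx}\|\le e^{\epsilon k}e^{-(\beta_2-\epsilon)n}e^{\epsilon|t|}$ for all $t\in\mathbb Z$, $n\ge1$; (iv) $\tan(\angle(E^s_{f^tx},E^u_{f^tx}))\ge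 e^{-\epsilon k}e^{-\epsilon|t|}$ for all $t\in\mathbb Z$. $\nu_0|\Lambda_k$ is the conditional (normalized restricted) measure of $\nu_0$ on $\Lambda_k$; its support is taken to be empty when $\nu_0(\Lambda_k)=0$. Bowen topological entropy of an arbitrary set $Z\subset \mathbb T^2$. With $d$ the distance, $B_n(x,\varepsilon)=\{y:d(f^ix,f^iy)<\varepsilon,\ 0\le i\le n-1\}$. For $\varepsilon>0$, $N\in\mathbb N$, $s\in\mathbb R$ let $m(Z,s,N,\varepsilon)=\inf_{\mathcal C}\sum_{B_n(x,\varepsilon)\in\mathcal C}e^{-ns}$, the infimum over all finite or countable covers $\mathcal C$ of $Z$ by sets $B_n(x,\varepsilon)$ with $n\ge N$ ($n$ may vary within $\mathcal C$). Let $m(Z,s,\varepsilon)=\lim_{N\to\infty}m(Z,s,N,\varepsilon)$, $h_{top}(Z,\varepsilon)=\inf\{s:m(Z,s,\varepsilon)=0\}=\sup\{s:m(Z,s,\varepsilon)=\infty\}$ and $h_{top}(Z)=\lim_{\varepsilon\to0}h_{top}(Z,\varepsilon)$. *)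

(* Defs.v *)
From HB Require Import structures.
From mathcomp Require Import all_boot all_order all_algebra generic_quotient.
From mathcomp Require Import all_classical all_reals all_analysis.

Set Implicit Arguments.
Unset Strict Implicit.
Unset Printing Implicit Defensive.

Import Order.TTheory GRing.Theory Num.Theory.
Import numFieldTopology.Exports numFieldNormedType.Exports.

Local Open Scope classical_set_scope.
Local Open Scope ring_scope.
Local Open Scope quotient_scope.

(** * The flat torus R^2 / Z^2 *)

Section torus_def.
Variable R : realType.

Definition lattice_rel (z w : 'rV[R]_2) : bool :=
  [forall j, (z 0 j - w 0 j) \is a Num.int].

Lemma lattice_equiv : equiv_class_of lattice_rel.
Proof.
split=> [z|z w|y x z].
- by apply/forallP => j; rewrite subrr rpred0.
- by apply/forallP/forallP => h j; rewrite -rpredN opprB h.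
- move=> /forallP h1 /forallP h2; apply/forallP => j.
  by rewrite -(subrKA (y 0 j)) rpredD.
Qed.

Canonical lattice_equiv_rel := EquivRelPack lattice_equiv.

Definition torus : Type := quotient_topology {eq_quot lattice_equiv_rel}.

HB.instance Definition _ := PointedTopological.on torus.
(* the Borel sigma-algebra *)
HB.instance Definition _ :=
  Measurable.copy torus (g_sigma_algebraType (@open torus)).

Definition tproj (z : 'rV[R]_2) : torus :=
  \pi_(quotient_topology {eq_quot lattice_equiv_rel}) z.

Definition trepr (x : torus) : 'rV[R]_2 :=
  repr (x : quotient_topology {eq_quot lattice_equiv_rel}).

(* The norm carried by 'rV[R]_2 in the library is the sup norm, so the Euclidean
   (Riemannian) one is introduced separately. *)
Definition dot (v w : 'rV[R]_2) : R := \sum_j v 0 j * w 0 j.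
Definition enorm (v : 'rV[R]_2) : R := Num.sqrt (dot v v).

Definition tdist (x y : torus) : R :=
  inf [set r | exists z w, [/\ tproj z = x, tproj w = y & r = enorm (z - w)]].

End torus_def.

Section torus_dynamics.
Variable R : realType.
Local Notation T2 := (torus R).
Implicit Types (f fi : T2 -> T2) (x y : T2).

(** * Invariant measures and the weak-* topology *)

Definition invariant f (mu : probability T2 R) : Prop :=
  forall A, measurable A -> mu (f @^-1` A) = mu A.

Definition Minv f : set (probability T2 R) := [set mu | invariant f mu].

Definition Minv_on (Z : set T2) f : set (probability T2 R) :=
  [set mu | invariant f mu /\ mu Z = 1%E].

Definition ergodic f (mu : probability T2 R) : Prop :=
  invariant f mu /\
  forall A, measurable A -> f @^-1` A = A -> mu A = 0%E \/ mu A = 1%E.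

Definition integration (mu : probability T2 R) :
    {ptws (continuousType T2 R) -> R} := fun phi => (\int[mu]_x phi x)%R.

(* probability measures with the coarsest topology making all the maps
   mu |-> \int phi dmu, for phi continuous, continuous *)
Definition Mweak : Type := initial_topology integration.
HB.instance Definition _ := Topological.on Mweak.

(* U is a neighbourhood of nu in the subspace Minv f *)
Definition Minv_nbhs f (nu : probability T2 R) (U : set (probability T2 R)) :
    Prop :=
  U `<=` Minv f /\ within (Minv f) (nbhs (nu : Mweak)) U.

(** * Empirical measures and Birkhoff averages *)

Section empirical.
Variables (f : T2 -> T2) (x : T2) (n : nat).

(* 1/(n+1) * sum_(i < n+1) delta_(f^i x), that is E_(n+1)(x): the index is
   shifted so that it is a probability measure for every n *)
Definition empirical : set T2 -> \bar R :=
  mscale ((n.+1%:R^-1)%:nng : {nonneg R})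
    (msum (fun i => dirac (iter i f x)) n.+1).

HB.instance Definition _ := Measure.on empirical.

Let empirical_setT : empirical setT = 1%E.
Proof.
have dT i : dirac (iter i f x) [set: T2] = 1%E :> \bar R by exact: diracT.
rewrite /empirical /mscale /= /msum (eq_bigr (fun=> 1%E)) => [|i _]; last exact: dT.
rewrite sumEFin sumr_const card_ord -EFinM mulVf ?pnatr_eq0 //.
Qed.

HB.instance Definition _ :=
  Measure_isProbability.Build _ _ _ empirical empirical_setT.

End empirical.

Definition empirical_limits f x : set (probability T2 R) :=
  [set mu | exists2 u : nat -> nat, {homo u : i j / (i < j)%N} &
    (fun j => (empirical f x (u j) : probability T2 R) : Mweak) @ \oo
      --> (mu : Mweak)].

Definition birkhoff_avg f (phi : T2 -> R) x (n : nat) : R :=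
  n%:R^-1 * \sum_(i < n) phi (iter i f x).

Definition historic f (phi : T2 -> R) : set T2 :=
  [set x | ~ cvg (birkhoff_avg f phi x @ \oo)].

(** * Metric entropy *)

(* A finite measurable partition is the partition into fibres of
   xi : T2 -> 'I_m; the atoms of the join of the f^-i xi, i < n, are indexed by
   words. *)
Definition atom f m (xi : T2 -> 'I_m) n (w : {ffun 'I_n -> 'I_m}) : set T2 :=
  [set x | forall i : 'I_n, xi (iter i f x) = w i].

(* ln 0 = 0 in the library, as needed for the convention 0 log 0 = 0 *)
Definition partition_entropy f (mu : probability T2 R) m (xi : T2 -> 'I_m) n :
    R :=
  - \sum_(w : {ffun 'I_n -> 'I_m})
      fine (mu (atom f xi w)) * ln (fine (mu (atom f xi w))).

Definition metric_entropy f (mu : probability T2 R) : \bar R :=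
  ereal_sup [set h | exists m (xi : T2 -> 'I_m),
    (forall i, measurable (xi @^-1` [set i])) /\
    h = (limn (fun n => n%:R^-1 * partition_entropy f mu xi n))%:E].

Definition max_entropy_measure f (mu : probability T2 R) : Prop :=
  invariant f mu /\
  forall nu, invariant f nu -> (metric_entropy f nu <= metric_entropy f mu)%E.

(** * Bowen topological entropy of an arbitrary set *)

Definition bowen_ball f (n : nat) (x : T2) (e : R) : set T2 :=
  [set y | forall i, (i < n)%N -> tdist (iter i f x) (iter i f y) < e].

(* a cover is a countable set of pairs (centre, length) *)
Definition bowen_cover f (Z : set T2) (N : nat) (e : R) (C : set (T2 * nat)) :
    Prop :=
  [/\ countable C, forall c, C c -> (N <= c.2)%N
    & Z `<=` \bigcup_(c in C) bowen_ball f c.2 c.1 e].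

Definition bowen_mN f (Z : set T2) (s : R) (N : nat) (e : R) : \bar R :=
  ereal_inf [set \esum_(c in C) (expR (- (c.2%:R * s)))%:E |
    C in bowen_cover f Z N e].

Definition bowen_m f (Z : set T2) (s e : R) : \bar R :=
  limn (fun N => bowen_mN f Z s N e).

Definition htop_scale f (Z : set T2) (e : R) : \bar R :=
  ereal_inf [set s%:E | s in [set s | bowen_m f Z s e = 0%E]].

Definition htop f (Z : set T2) : \bar R :=
  lim (htop_scale f Z e @[e --> 0^'+]).

(** * Derivatives of torus maps *)

(* T_x T^2 is identified with R^2 (row vectors) by translations.  M is the
   derivative of f at x when some local lift F of f at a point z above x is
   differentiable at z with Jacobian matrix M, which acts by v |-> v *m M. *)
Definition has_tderiv f x (M : 'M[R]_2) : Prop :=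
  exists (F : 'rV[R]_2 -> 'rV[R]_2) (z : 'rV[R]_2),
    [/\ tproj z = x, (\forall w \near z, f (tproj w) = tproj (F w)),
        differentiable F z & M = jacobian F z].

Definition tderiv f x : 'M[R]_2 := xget 0 [set M | has_tderiv f x M].

Definition C1alpha (alpha : R) f : Prop :=
  (forall x, exists M, has_tderiv f x M) /\
  exists C : R, forall x y,
    `|tderiv f x - tderiv f y| <= C * tdist x y `^ alpha.

Definition C1alpha_diffeo f fi : Prop :=
  [/\ cancel f fi, cancel fi f &
    exists alpha : R, [/\ 0 < alpha, alpha <= 1, C1alpha alpha f
                        & C1alpha alpha fi]].

(** * Pesin blocks *)

(* f^t for t in Z, where fi is the inverse of f *)
Definition iterz f fi (t : int) : T2 -> T2 :=
  match t with Posz n => iter n f | Negz n => iter n.+1 fi end.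

(* Subspaces of R^2 are row spaces of matrices.  This is the norm of the
   restriction of v |-> v *m M to E. *)
Definition norm_on (E M : 'M[R]_2) : R :=
  sup [set enorm (v *m M) | v in [set v | (v <= E)%MS /\ enorm v <= 1]].

Definition subspace_angle (E F : 'M[R]_2) : R :=
  inf [set a | exists v w : 'rV[R]_2,
    [/\ v != 0, w != 0, (v <= E)%MS, (w <= F)%MS
      & a = acos (`|dot v w| / (enorm v * enorm w))]].

(* tangent of an angle in [0, pi/2], infinite at pi/2, where the library's tan
   is 0 *)
Definition etan (a : R) : \bar R :=
  if cos a == 0 then +oo%E else (tan a)%:E.

Definition pesin_block f fi (k : nat) (beta1 beta2 eps : R) : set T2 :=
  [set x | exists Es Eu : T2 -> 'M[R]_2,
    [/\ (Es x + Eu x :=: 1%:M)%MS /\ (Es x :&: Eu x :=: (0 : 'M[R]_2))%MS,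
        (forall t : int,
          (Es x *m tderiv (iterz f fi t) x :=: Es (iterz f fi t x))%MS /\
          (Eu x *m tderiv (iterz f fi t) x :=: Eu (iterz f fi t x))%MS),
        (forall (t : int) (n : nat), (1 <= n)%N ->
          norm_on (Es (iterz f fi t x)) (tderiv (iterz f fi n) (iterz f fi t x))
          <= expR (eps * k%:R) * expR (- (beta1 - eps) * n%:R)
             * expR (eps * `|t|%:~R)),
        (forall (t : int) (n : nat), (1 <= n)%N ->
          norm_on (Eu (iterz f fi t x))
            (tderiv (iterz f fi (- n%:Z)) (iterz f fi t x))
          <= expR (eps * k%:R) * expR (- (beta2 - eps) * n%:R)
             * expR (eps * `|t|%:~R))
      & (forall t : int,
          ((expR (- (eps * k%:R)) * expR (- (eps * `|t|%:~R)))%:E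
           <= etan (subspace_angle (Es (iterz f fi t x))
                                   (Eu (iterz f fi t x))))%E)]].

(* normalized restriction of nu to D; identically 0 when nu D = 0 *)
Definition cond_measure (nu : probability T2 R) (D : set T2) (A : set T2) : R :=
  fine (nu (A `&` D)) / fine (nu D).

Definition measure_support (m : set T2 -> R) : set T2 :=
  [set x | forall O : set T2, open O -> O x -> 0 < m O].

Definition pesin_set (nu : probability T2 R) f fi (beta1 beta2 eps : R) :
    set T2 :=
  \bigcup_(k in [set k | (1 <= k)%N])
    measure_support (cond_measure nu (pesin_block f fi k beta1 beta2 eps)).

Definition Nset f (L : set T2) : set T2 :=
  [set x | empirical_limits f x `&` Minv_on L f !=set0].

(** * The cat map and the Katok map *)

Definition cat_mx : 'M[R]_2 :=
  \matrix_(i, j) (if (i == 0) && (j == 0) then 2 else 1).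

(* cat_mx is symmetric, hence its action on row and column vectors agree *)
Definition cat_map (x : T2) : T2 := tproj (trepr x *m cat_mx).

(* the eigenvalue of cat_mx greater than 1 *)
Definition lam : R := (3 + Num.sqrt 5) / 2.

(* (1, lam - 2) and (2 - lam, 1) are orthogonal eigenvectors of cat_mx for the
   eigenvalues lam and lam^-1; the coordinates (s1, s2) refer to their
   normalizations. *)
Definition eigen_u : 'rV[R]_2 := \row_j (if j == 0 then 1 else lam - 2).
Definition eigen_s : 'rV[R]_2 := \row_j (if j == 0 then 2 - lam else 1).

Definition chart (s1 s2 : R) : 'rV[R]_2 :=
  (s1 / enorm eigen_u) *: eigen_u + (s2 / enorm eigen_s) *: eigen_s.

Definition disk (r : R) : set T2 :=
  [set x | exists s1 s2, s1 ^+ 2 + s2 ^+ 2 <= r ^+ 2 /\ x = tproj (chart s1 s2)].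

(* Only the values of psi on [0, 1] are relevant. *)
Definition slowdown (r0 : R) (psi : R -> R) : Prop :=
  [/\ {within `[0, 1], continuous psi} /\
        (forall n u, 0 < u < 1 -> derivable (derive1n n psi) u 1),
      psi 0 = 0,
      forall u, r0 <= u <= 1 -> psi u = 1,
      forall u, 0 < u < r0 -> 0 < derive1 psi u
    & (\int[lebesgue_measure]_(u in `[0%R, 1%R]) ((psi u)^-1)%:E < +oo)%E].

(* (s1, s2) is carried to (s1', s2') in time 1 by the slowed-down system *)
Definition time_one (psi : R -> R) (s1 s2 s1' s2' : R) : Prop :=
  exists a b : R -> R,
    [/\ {within `[0, 1], continuous a} /\ {within `[0, 1], continuous b},
        a 0 = s1 /\ b 0 = s2,
        a 1 = s1' /\ b 1 = s2'
      & forall t : R, 0 < t < 1 ->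
          is_derive t 1 a (a t * psi (a t ^+ 2 + b t ^+ 2) * ln lam) /\
          is_derive t 1 b (- (b t * psi (a t ^+ 2 + b t ^+ 2) * ln lam))].

(* The condition lam * r1 < 1 is the smallness of r1: it makes the chart
   injective on the disk of radius r1 and keeps s1^2 + s2^2 < 1 along the
   trajectories during the time interval [0, 1].  The smallness of r0 relative
   to r1 is what makes the two formulas match on the boundary of the disk. *)
Definition katok_map (r0 r1 : R) (psi : R -> R) f : Prop :=
  [/\ 0 < r0 < r1 /\ lam * r1 < 1,
      slowdown r0 psi,
      forall s1 s2, s1 ^+ 2 + s2 ^+ 2 <= r1 ^+ 2 ->
        exists s1' s2', time_one psi s1 s2 s1' s2' /\
          f (tproj (chart s1 s2)) = tproj (chart s1' s2')
    & forall x, ~ disk r1 x -> f x = cat_map x].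

End torus_dynamics.

(* Main.v *)
Require Import Defs.
From HB Require Import structures.
From mathcomp Require Import all_boot all_order all_algebra.
From mathcomp Require Import all_classical all_reals all_analysis.
From mathcomp Require Import ring lra zify measurable_realfun.

Import Order.TTheory GRing.Theory Num.Theory.
Import numFieldTopology.Exports numFieldNormedType.Exports.

Local Open Scope classical_set_scope.
Local Open Scope ring_scope.

(** The conjugacy carries f to the cat map A, so invariant measures, entropies,
    averages and (by uniform continuity) Bowen balls can all be studied for A,
    where the proof rests on three facts.

    The first is that Haar measure m is the only measure of maximal entropy of
    A, with entropy ln lam, and that it is ergodic ([mme_unique],
    [haar_ergodic]).  Hence nu0, the image of m, is ergodic for f; it belongs to
    U, thus to Minv_on L f, and the supremum in the second conclusion is ln lam
    ([entropy_sup]).  Uniqueness follows from a large deviation estimate: along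
    an unstable segment the averages of phi over a long block equidistribute to
    its integral over m ([blk_equi]); so the lam^n orbits of length n can be given
    weights exp (s * sum of phi), with phi normalized to have integral 0, whose
    total mass is about lam^n, and Gibbs' inequality against these weights bounds
    the entropy of an invariant mu by ln lam minus a positive multiple of
    int phi dmu - int phi dm ([entropy_upper]).  Ergodicity is a consequence: the
    normalized restriction of m to an invariant set of positive measure again
    has entropy ln lam, so it is m.

    The second is that the whole torus is covered by C lam^n Bowen balls of
    length n, so that no set has entropy more than ln lam ([bowen_m_zero]).

    The third is a construction, for a function phi with
    int phi dmu > int phi dnu0 for some invariant mu (phi or - phi is such when
    the first conclusion fails).  Let s < ln lam and let a family of Bowen balls
    have small total weight, a ball of length n weighing exp (- n s).  Then
    there is a point outside all the balls whose empirical measures converge to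
    nu0 along one sequence of times, while along another one its averages of phi
    stay above int phi dnu0 by a fixed amount ([avoiding_point]).  Such a point
    lies in the historic set and in N(L), and escaping all light families means
    that the entropy is at least s.

    The point is the limit of nested cells [t, t + lam^-n] of the unstable line.
    The balls are thinner than lam^-n in the unstable direction, so the potential
    of a cell, which is the weight of the balls that meet it, is at most doubled
    when summed over the lam^M children of the cell ([Phi_split]).  An average
    over the children therefore shows that one of them can be chosen so as to
    make the potential decrease at the rate exp (- M s2) for each choice, with
    s < s2 < ln lam, and at the same time to keep the exponential moments of the
    deviations of finitely many Birkhoff sums bounded ([free_step]).  After many
    such choices the averages are those of m and the potential is far smaller
    than needed; the excess pays for following an orbit with a high average of
    phi during a fixed proportion of the time ([forced_phase], [stage]). *)

(** * Eigencoordinates on the torus *)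

Section torus_coordinates.
Context {R : realType}.
Local Notation T2 := (torus R).
Local Notation lam := (lam R).

Lemma lamE : lam ^+ 2 = 3 * lam - 1.
Proof.
have h : Num.sqrt 5 ^+ 2 = 5 :> R by rewrite sqr_sqrtr.
rewrite /Defs.lam expr2; move: h; rewrite expr2; nra.
Qed.

Lemma lam_gt52 : 5 / 2 < lam.
Proof.
have h : Num.sqrt 5 ^+ 2 = 5 :> R by rewrite sqr_sqrtr.
have := sqrtr_ge0 (5 : R); move: h; rewrite /Defs.lam expr2; nra.
Qed.

Lemma lam_lt3 : lam < 3.
Proof. by have := lamE; have := lam_gt52; rewrite expr2; nra. Qed.

Lemma lam_gt0 : 0 < lam. Proof. by have := lam_gt52; lra. Qed.
Lemma lam_gt1 : 1 < lam. Proof. by have := lam_gt52; lra. Qed.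

Opaque Defs.lam.

Lemma lamX_norm n (x : R) : `|lam ^+ n * x| = lam ^+ n * `|x|.
Proof.
rewrite normrM; congr (_ * _); apply: gtr0_norm.
by apply: exprn_gt0; exact: lam_gt0.
Qed.

Lemma lamV_norm n (x : R) : `|lam ^- n * x| = lam ^- n * `|x|.
Proof.
rewrite normrM; congr (_ * _); apply: gtr0_norm.
by rewrite invr_gt0; apply: exprn_gt0; exact: lam_gt0.
Qed.

Lemma lamX_ge1 n : 1 <= lam ^+ n.
Proof. by apply: exprn_ege1; apply: ltW; exact: lam_gt1. Qed.

Lemma lamX_gt0 n : 0 < lam ^+ n.
Proof. by apply: exprn_gt0; exact: lam_gt0. Qed.

Lemma lamV_gt0 n : 0 < lam ^- n.
Proof. by rewrite invr_gt0 lamX_gt0. Qed.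

Lemma lamV_le1 n : lam ^- n <= 1.
Proof. by rewrite invf_le1 ?lamX_gt0 ?lamX_ge1. Qed.

Lemma lamXV n : lam ^+ n * lam ^- n = 1.
Proof. by rewrite divff // gt_eqF // lamX_gt0. Qed.

Lemma lamX_unbounded (C : R) : exists n, forall m, (n <= m)%N -> C < lam ^+ m.
Proof.
exists (Num.truncn `|C|).+1 => m hm; apply: le_lt_trans (ler_norm _) _.
have h k : k%:R <= lam ^+ k.
  elim: k => [|k IH]; first by rewrite expr0.
  rewrite exprS -natr1; have := lamX_ge1 k; have := lam_gt52; nra.
apply: lt_le_trans (h m); apply: (@lt_le_trans _ _ (Num.truncn `|C|).+1%:R); last by rewrite ler_nat.
exact: truncnS_gt.
Qed.

Lemma lamV_small (e : R) : 0 < e -> exists n, forall m, (n <= m)%N -> lam ^- m < e.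
Proof.
move=> e0; have [n hn] := lamX_unbounded e^-1; exists n => m /hn.
by rewrite -[X in _ -> _ < X]invrK ltf_pV2 // posrE ?lamX_gt0 ?invr_gt0.
Qed.

(** The point with coordinates a and b along the unstable and the stable
    direction; A multiplies a by lam and divides b by lam. The coordinates are
    those of the eigenvectors eigen_u and eigen_s, which are not normalized. *)
Definition pt (a b : R) : T2 := tproj (a *: eigen_u R + b *: eigen_s R).

Lemma tproj_eq (z w : 'rV[R]_2) :
  tproj z = tproj w <-> forall j, z 0 j - w 0 j \is a Num.int.
Proof.
rewrite /tproj; split.
- by move=> /eqquotP/forallP.
- by move=> h; apply/eqquotP/forallP.
Qed.

Lemma tproj_trepr (x : T2) : tproj (trepr x) = x.
Proof. exact: reprK. Qed.

(** The coordinates of the points of the lattice Z^2. *)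
Definition lat (a b : R) : Prop :=
  (a - (lam - 2) * b \is a Num.int) /\ ((lam - 2) * a + b \is a Num.int).

Lemma eig0 (a b : R) : (a *: eigen_u R + b *: eigen_s R) 0 0 = a - (lam - 2) * b.
Proof. by rewrite !mxE /=; ring. Qed.

Lemma eig1 (a b : R) : (a *: eigen_u R + b *: eigen_s R) 0 1 = (lam - 2) * a + b.
Proof. by rewrite !mxE /=; ring. Qed.

Lemma ord2P (P : 'I_2 -> Prop) : P 0 -> P 1 -> forall j, P j.
Proof.
move=> P0 P1 [[|[|//]] i].
  by rewrite (_ : Ordinal i = 0) //; exact: val_inj.
by rewrite (_ : Ordinal i = 1) //; exact: val_inj.
Qed.

Lemma pt_eq a b a' b' : pt a b = pt a' b' <-> lat (a - a') (b - b').
Proof.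
rewrite /pt tproj_eq; split.
  move=> h; split.
    by have := h 0; rewrite !eig0; congr (_ \is a Num.int); ring.
  by have := h 1; rewrite !eig1; congr (_ \is a Num.int); ring.
move=> [h0 h1]; apply: ord2P.
  by rewrite !eig0; move: h0; congr (_ \is a Num.int); ring.
by rewrite !eig1; move: h1; congr (_ \is a Num.int); ring.
Qed.

Lemma pt_surj_z (z : 'rV[R]_2) : exists a b, [/\ z = a *: eigen_u R + b *: eigen_s R,
  a = (z 0 0 + (lam - 2) * z 0 1) / (1 + (lam - 2) ^+ 2) &
  b = (z 0 1 - (lam - 2) * z 0 0) / (1 + (lam - 2) ^+ 2)].
Proof.
have h : 1 + (lam - 2) ^+ 2 != 0.
  by rewrite gt_eqF // (lt_le_trans ltr01) // lerDl sqr_ge0.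
eexists; eexists; split; [|reflexivity|reflexivity].
apply/rowP; apply: ord2P; rewrite ?eig0 ?eig1; by field.
Qed.

Lemma al_bounds : 1 / 2 < lam - 2 < 1.
Proof. by have := lam_gt52; have := lam_lt3; lra. Qed.

Lemma int_lt1 (x : R) : x \is a Num.int -> `|x| < 1 -> x = 0.
Proof.
move=> /intrP[n ->]; rewrite -intr_norm -[1]/(1%:~R) ltr_int => h.
suff -> : n = 0 by [].
by move: h; case: n => [[|n]|n].
Qed.

(** Z^2 is discrete: this is what makes lifts unique at small scale. *)
Lemma lat0 a b : lat a b -> `|a| < 1 / 2 -> `|b| < 1 / 2 -> a = 0 /\ b = 0.
Proof.
have := al_bounds; set al := lam - 2 => /andP[al1 al2] [h0 h1] ha hb.
have e0 : a - al * b = 0.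
  apply: int_lt1 => //; rewrite (le_lt_trans (ler_normB _ _)) // normrM.
  rewrite (gtr0_norm (_ : 0 < al)); last lra.
  have : al * `|b| <= 1 * `|b| by rewrite ler_wpM2r // ltW.
  lra.
have e1 : al * a + b = 0.
  apply: int_lt1 => //; rewrite (le_lt_trans (ler_normD _ _)) // normrM.
  rewrite (gtr0_norm (_ : 0 < al)); last lra.
  have : al * `|a| <= 1 * `|a| by rewrite ler_wpM2r // ltW.
  lra.
have b0 : b * (1 + al ^+ 2) = 0 by rewrite -[RHS]e1; move/eqP: e0; rewrite subr_eq0 => /eqP ->; ring.
have {b0}b0 : b = 0.
  move/eqP: b0; rewrite mulf_eq0 => /orP[/eqP //|].
  by rewrite gt_eqF // (lt_le_trans ltr01) // lerDl sqr_ge0.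
by split=> //; move: e0; rewrite b0 mulr0 subr0.
Qed.

Lemma ptD a b a' b' c d : pt a b = pt a' b' -> pt (a + c) (b + d) = pt (a' + c) (b' + d).
Proof.
move=> /pt_eq h; apply/pt_eq.
by rewrite !(_ : forall x y z : R, x + z - (y + z) = x - y) // => x y z; ring.
Qed.

(** A bounded part of the plane projects onto the torus; it serves as a compact
    fundamental domain. *)
Lemma pt_bounded (x : T2) : exists a b, [/\ x = pt a b, 0 <= a <= 2 & `|b| <= 2].
Proof.
set z := trepr x.
pose w : 'rV[R]_2 := \row_j (z 0 j - (Num.floor (z 0 j))%:~R).
have hw j : 0 <= w 0 j < 1.
  by rewrite mxE subr_ge0 floor_le_tmp /= ltrBlDl -intrD1 floorD1_gt.
have [a [b [ew ea eb]]] := pt_surj_z w.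
have xw : x = tproj w.
  rewrite -[x]tproj_trepr; apply/tproj_eq => j.
  by rewrite mxE opprB addrC subrK intr_int.
have := al_bounds; move: ea eb; set al := lam - 2 => ea eb /andP[al1 al2].
have al3 : 1 <= 1 + al ^+ 2 by rewrite lerDl sqr_ge0.
have := hw 0; have := hw 1 => /andP[w11 w12] /andP[w01 w02].
exists a, b; split.
- by rewrite xw ew.
- apply/andP; split; rewrite ea ?divr_ge0 ?addr_ge0 ?mulr_ge0 //; try lra.
  by rewrite ler_pdivrMr; [nra|lra].
- rewrite ler_norml eb; apply/andP; split; rewrite ?ler_pdivrMr ?ler_pdivlMr; nra.
Qed.

Lemma cat_tproj (z : 'rV[R]_2) : cat_map (tproj z) = tproj (z *m cat_mx R).
Proof.
rewrite /cat_map; apply/tproj_eq => j.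
have h : forall i, trepr (tproj z) 0 i - z 0 i \is a Num.int.
  by apply/tproj_eq; rewrite tproj_trepr.
rewrite !mxE -sumrB rpred_sum // => i _.
rewrite -mulrBl mxE; case: ifP => _; first by rewrite rpredM // rpred_nat.
by rewrite mulr1.
Qed.

Lemma cat_pt a b : cat_map (pt a b) = pt (lam * a) (lam^-1 * b).
Proof.
rewrite /pt cat_tproj; congr tproj.
have l0 : lam != 0 by rewrite gt_eqF // lam_gt0.
have hl : lam^-1 = 3 - lam by apply: (mulfI l0); rewrite divff // mulrBr -expr2 lamE; ring.
apply/rowP; apply: ord2P; rewrite ?eig0 ?eig1 !mxE !big_ord_recl big_ord0 !mxE /= ?hl.
  have := lamE; rewrite expr2 => h.
  transitivity (lam * a - (5 * lam - 6 - lam * lam) * b); last by ring.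
  rewrite h; ring.
transitivity ((lam * lam - 2 * lam) * a + (3 - lam) * b); last by ring.
rewrite (_ : lam * lam = 3 * lam - 1); first by ring.
by rewrite -expr2 lamE.
Qed.

Lemma iter_cat_pt n a b : iter n (@cat_map R) (pt a b) = pt (lam ^+ n * a) (lam ^- n * b).
Proof.
elim: n => [|n IHn] /=; first by rewrite expr0 invr1 !mul1r.
by rewrite IHn cat_pt !mulrA -exprS -invfM -exprS.
Qed.

(** Translation of the torus by the vector with eigencoordinates (c, d). *)
Definition tshift (c d : R) (x : T2) : T2 :=
  tproj (trepr x + (c *: eigen_u R + d *: eigen_s R)).

Lemma tshift_tproj c d z : tshift c d (tproj z) = tproj (z + (c *: eigen_u R + d *: eigen_s R)).
Proof.
apply/tproj_eq => j; rewrite !mxE.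
have h : forall i, trepr (tproj z) 0 i - z 0 i \is a Num.int.
  by apply/tproj_eq; rewrite tproj_trepr.
by have := h j; congr (_ \is a Num.int); ring.
Qed.

Lemma tshift_pt c d a b : tshift c d (pt a b) = pt (a + c) (b + d).
Proof. by rewrite tshift_tproj /pt; congr tproj; rewrite !scalerDl addrACA. Qed.

Lemma tshift_cat (v w : R) (x : T2) :
  tshift v w (cat_map x) = cat_map (tshift (lam^-1 * v) (lam * w) x).
Proof.
have [a [b [-> _ _]]] := pt_bounded x.
rewrite cat_pt !tshift_pt cat_pt !mulrDr; congr (pt (_ + _) (_ + _)).
  by rewrite mulrA divff ?mul1r // gt_eqF // lam_gt0.
by rewrite mulrA mulVf ?mul1r // gt_eqF // lam_gt0.
Qed.

(** Quantitative density of the unstable line. Applying the n-th power of A to a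
    bounded representative of the n-th preimage stretches the unstable
    coordinate and shrinks the stable one. *)
Lemma unstable_dense n (a b : R) : exists t b', [/\ pt a b = pt t b',
   0 <= t <= 2 * lam ^+ n & `|b'| <= 2 * lam ^- n].
Proof.
have l0 : 0 < lam ^+ n by rewrite exprn_gt0 // lam_gt0.
have [t [b' [e ht hb]]] := pt_bounded (pt (lam ^- n * a) (lam ^+ n * b)).
exists (lam ^+ n * t), (lam ^- n * b'); split.
- rewrite -iter_cat_pt -e iter_cat_pt !mulrA divff ?mulVf ?mul1r ?gt_eqF //.
- move/andP: ht => [h1 h2]; rewrite mulr_ge0 ?(ltW l0) //=.
  by rewrite mulrC ler_wpM2r // ltW.
- by rewrite normrM gtr0_norm ?invr_gt0 // mulrC ler_wpM2r // invr_ge0 ltW.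
Qed.

End torus_coordinates.

Opaque Defs.lam.

(** * A distance adapted to the eigencoordinates *)

Section torus_metric.
Context {R : realType}.
Local Notation T2 := (torus R).
Local Notation lam := (lam R).

Definition td_set (x y : T2) : set R := [set r | exists a b a' b',
  [/\ x = pt a b, y = pt a' b' & r = `|a - a'| + `|b - b'|]].

(** The l1 distance in eigencoordinates, minimized over the lifts. It is
    within a factor 2 of tdist, and A acts diagonally in its coordinates. *)
Definition td (x y : T2) : R := inf (td_set x y).

Lemma td_has_inf x y : has_inf (td_set x y).
Proof.
split.
  have [a [b [e _ _]]] := pt_bounded x; have [a' [b' [e' _ _]]] := pt_bounded y.
  by exists (`|a - a'| + `|b - b'|), a, b, a', b'.
by exists 0 => r [a [b [a' [b' [_ _ ->]]]]]; rewrite addr_ge0.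
Qed.

Lemma td_ge0 x y : 0 <= td x y.
Proof.
by apply: lb_le_inf; [exact: (td_has_inf x y).1|move=> r [a [b [a' [b' [_ _ ->]]]]]; rewrite addr_ge0].
Qed.

Lemma td_pt a b a' b' : td (pt a b) (pt a' b') <= `|a - a'| + `|b - b'|.
Proof. by apply: ge_inf; [exact: (td_has_inf _ _).2|exists a, b, a', b']. Qed.

Lemma td_lt_lift {a b y e} : td (pt a b) y < e ->
  exists a' b', y = pt a' b' /\ `|a - a'| + `|b - b'| < e.
Proof.
move=> /(inf_lt (td_has_inf _ _).1) [r [a1 [b1 [a2 [b2 [e1 -> ->]]]]] lte].
exists (a2 + (a - a1)), (b2 + (b - b1)); split.
  have := ptD _ _ _ _ (a2 - a1) (b2 - b1) e1.
  rewrite (_ : a1 + (a2 - a1) = a2); last by ring.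
  rewrite (_ : b1 + (b2 - b1) = b2); last by ring.
  by move=> <-; congr pt; ring.
by rewrite (_ : a - _ = a1 - a2) 1?(_ : b - _ = b1 - b2) //; ring.
Qed.

Lemma td_sym x y : td x y = td y x.
Proof.
rewrite /td; congr inf; rewrite /td_set; apply/seteqP; split=> r [a [b [a' [b' [? ? ->]]]]];
  by exists a', b', a, b; split=> //; rewrite distrC (distrC b).
Qed.

Lemma tdxx x : td x x = 0.
Proof.
have [a [b [-> _ _]]] := pt_bounded x.
by apply/eqP; rewrite eq_le td_ge0 andbT (le_trans (td_pt _ _ _ _)) // !subrr normr0 addr0.
Qed.

Lemma td_triangle y x z : td x z <= td x y + td y z.
Proof.
apply/ler_addgt0Pl => e e0.
have [a [b [xE _ _]]] := pt_bounded x; rewrite {1 2}xE {xE}.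
have h1 : td (pt a b) y < td (pt a b) y + e / 2 by rewrite ltrDl divr_gt0.
have [a' [b' [yE h1']]] := td_lt_lift h1; rewrite yE {h1} in h1' *.
have h2 : td (pt a' b') z < td (pt a' b') z + e / 2 by rewrite ltrDl divr_gt0.
have [a2 [b2 [zE h2']]] := td_lt_lift h2; rewrite zE {h2} in h2' *.
apply: le_trans (td_pt _ _ _ _) _.
have := ler_distD a' a a2; have := ler_distD b' b b2; lra.
Qed.

Lemma enorm_eig (a b : R) : enorm (a *: eigen_u R + b *: eigen_s R) ^+ 2
   = (a ^+ 2 + b ^+ 2) * (1 + (lam - 2) ^+ 2).
Proof.
rewrite /enorm sqr_sqrtr; last by rewrite /dot sumr_ge0 // => i _; rewrite -expr2 sqr_ge0.
by rewrite /dot !big_ord_recl big_ord0 (_ : lift ord0 ord0 = 1) ?eig0 ?eig1; [ring|exact: val_inj].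
Qed.

Lemma tdist_td x y (e : R) : tdist x y < e -> td x y < 2 * e.
Proof.
move=> h.
have : has_inf [set r | exists z w, [/\ tproj z = x, tproj w = y & r = enorm (z - w)]].
  split; first by exists (enorm (trepr x - trepr y)), (trepr x), (trepr y); rewrite !tproj_trepr.
  by exists 0 => r [z [w [_ _ ->]]]; rewrite sqrtr_ge0.
move=> hi; have [r [z [w [<- <- ->]]] lte] := inf_lt hi.1 h.
have [a [b [ez _ _]]] := pt_surj_z z; have [a' [b' [ew _ _]]] := pt_surj_z w.
rewrite {}ez {}ew in lte *.
rewrite -/(pt a b) -/(pt a' b'); apply: le_lt_trans (td_pt _ _ _ _) _.
move: lte; rewrite opprD addrACA -!scalerBl; set v := _ + _ => lte.
have ge0 : 0 <= enorm v by rewrite sqrtr_ge0.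
have := enorm_eig (a - a') (b - b'); rewrite -/v => ev.
suff H (c d : R) : enorm v ^+ 2 = (c ^+ 2 + d ^+ 2) * (1 + (lam - 2) ^+ 2) -> `|c| <= enorm v.
  have := H _ _ ev; rewrite addrC in ev *; have := H _ _ ev; lra.
move=> {}ev; rewrite -(ger0_norm ge0) -ler_sqr ?nnegrE // !real_normK ?num_real //  ev.
have := sqr_ge0 c; have := sqr_ge0 d; have := sqr_ge0 (lam - 2); nra.
Qed.

Lemma td_tdist x y (e : R) : td x y < e -> tdist x y < 2 * e.
Proof.
have [a [b [-> _ _]]] := pt_bounded x => /td_lt_lift[a' [b' [-> h]]].
apply: (@le_lt_trans _ _ (enorm ((a *: eigen_u R + b *: eigen_s R) - (a' *: eigen_u R + b' *: eigen_s R)))).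
  apply: ge_inf; first by exists 0 => r [z [w [_ _ ->]]]; rewrite sqrtr_ge0.
  by eexists; eexists; split; [reflexivity|reflexivity|reflexivity].
rewrite opprD addrACA -!scalerBl; set v := _ + _.
have e0 : 0 < e by rewrite (le_lt_trans _ h) // addr_ge0.
have ge0 : 0 <= enorm v by rewrite sqrtr_ge0.
rewrite -[X in X < _](ger0_norm ge0) -[X in _ < X](gtr0_norm (_ : 0 < 2 * e)); last by rewrite mulr_gt0.
rewrite -ltr_sqr ?nnegrE // !real_normK ?num_real // enorm_eig.
have := al_bounds (R := R); set al := lam - 2 => /andP[al1 al2].
rewrite -(real_normK (num_real (a - a'))) -(real_normK (num_real (b - b'))).
have := normr_ge0 (a - a'); have := normr_ge0 (b - b').
move: (`|a - a'|) (`|b - b'|) h => p r h r0 p0.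
have h1 : p ^+ 2 + r ^+ 2 <= (p + r) ^+ 2 by have := mulr_ge0 p0 r0; rewrite !expr2; lra.
have h2 : (p + r) ^+ 2 < e ^+ 2 by rewrite ltr_sqr ?nnegrE ?addr_ge0 // ltW.
have h3 : al ^+ 2 <= 1 by rewrite expr2; nra.
have h4 : 0 <= p ^+ 2 + r ^+ 2 by rewrite addr_ge0 ?sqr_ge0.
have h5 := sqr_ge0 al.
have : (p ^+ 2 + r ^+ 2) * (1 + al ^+ 2) <= (p ^+ 2 + r ^+ 2) * 2 by rewrite ler_wpM2l //; lra.
rewrite exprMn; lra.
Qed.

Lemma ptcont : continuous (fun z : R * R => pt z.1 z.2).
Proof.
have h : continuous (fun z : R * R => z.1 *: eigen_u R + z.2 *: eigen_s R).
  by move=> z; apply: cvgD; apply: cvgZr_tmp; [exact: cvg_fst|exact: cvg_snd].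
move=> z; apply: (@continuous_comp _ _ _ (fun z : R * R => z.1 *: eigen_u R + z.2 *: eigen_s R)
   (@tproj R)); first exact: h.
exact: pi_continuous.
Qed.

Lemma open_tdP (U : set T2) : open U <-> forall x, U x -> exists2 e : R, 0 < e & forall y, td x y < e -> U y.
Proof.
split.
- move=> oU x Ux; have [a [b [xE _ _]]] := pt_bounded x; subst x.
  have : nbhs (pt a b) U by exact: open_nbhs_nbhs.
  move=> /(ptcont (a, b)) /nbhs_ballP[e /= e0 he]; exists e => // y /td_lt_lift[a' [b' [-> h]]].
  apply: (he (a', b')); split => /=.
    by rewrite /ball /= (le_lt_trans _ h) // lerDl.
  by rewrite /ball /= (le_lt_trans _ h) // lerDr.
- move=> h; change (open (@tproj R @^-1` U)); rewrite openE => z /= Uz.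
  have [e e0 he] := h _ Uz.
  apply/nbhs_ballP; exists (e / 8) => /=; first by rewrite divr_gt0.
  move=> w zw /=; apply: he.
  have [a [b [ez ea eb]]] := pt_surj_z z; have [a' [b' [ew ea' eb']]] := pt_surj_z w.
  rewrite ez ew -/(pt a b) -/(pt a' b'); apply: le_lt_trans (td_pt _ _ _ _) _.
  have {}zw i j : ball (z i j) (e / 8) (w i j) by move: zw => -[_ /(_ i j)].
  have h0 : `|z 0 0 - w 0 0| < e / 8 by apply: zw.
  have h1 : `|z 0 1 - w 0 1| < e / 8 by apply: zw.
  have := al_bounds (R := R); move: ea eb ea' eb'; set al := lam - 2 => ea eb ea' eb' /andP[al1 al2].
  have al3 : 1 <= 1 + al ^+ 2 by rewrite lerDl sqr_ge0.
  have ha : `|a - a'| < e / 3.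
    rewrite ea ea' -mulrBl normrM (gtr0_norm (_ : 0 < (1 + al ^+ 2)^-1)) ?invr_gt0; try lra.
    rewrite ltr_pdivrMr; last lra.
    move: h0 h1; rewrite !ltr_norml; nra.
  have hb : `|b - b'| < e / 3.
    rewrite eb eb' -mulrBl normrM (gtr0_norm (_ : 0 < (1 + al ^+ 2)^-1)) ?invr_gt0; try lra.
    rewrite ltr_pdivrMr; last lra.
    move: h0 h1; rewrite !ltr_norml; nra.
  lra.
Qed.

Lemma open_tball x e : open [set y | td x y < e].
Proof.
apply/open_tdP => y /= h; exists (e - td x y); first by rewrite subr_gt0.
by move=> z h'; rewrite (le_lt_trans (td_triangle y x z)) //; lra.
Qed.

Lemma nbhs_tdP x (U : set T2) : nbhs x U <-> exists2 e : R, 0 < e & forall y, td x y < e -> U y.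
Proof.
split.
- rewrite nbhsE => -[V [oV Vx] VU]; have [e e0 he] := (open_tdP V).1 oV x Vx.
  by exists e => // y /he /VU.
- move=> [e e0 he]; rewrite nbhsE; exists [set y | td x y < e]; last by move=> y; exact: he.
  by split; [exact: open_tball|rewrite /= tdxx].
Qed.

(** Uniform continuity by compactness. The kernel K is |phi x - phi y| or
    td (g x) (g y), which treats real functions and torus maps at once. *)
Lemma td_unif (K : T2 -> T2 -> R) :
  (forall x y z, K x z <= K x y + K y z) -> (forall x y, K x y = K y x) ->
  (forall x (e : R), 0 < e -> exists2 d : R, 0 < d & forall y, td x y < d -> K x y < e) ->
  forall e : R, 0 < e -> exists2 d : R, 0 < d & forall x y, td x y < d -> K x y < e.
Proof.
move=> Ktri Ksym Kc e e0.
have cpt : compact (`[0, 2]%classic `*` `[(-2), 2]%classic : set (R * R)).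
  by apply: compact_setX; exact: segment_compact.
pose P (d : R) (z : R * R) := forall y, td (pt z.1 z.2) y < d -> K (pt z.1 z.2) y < e.
have := (compact_near_coveringP _).1 cpt R (0 : R)^'+ P _.
case=> [[a b] _|d0 /= d00 hd].
  have e20 : 0 < e / 2 by rewrite divr_gt0.
  have [d d0 hd] := Kc (pt a b) _ e20.
  have d20 : 0 < d / 4 by rewrite divr_gt0.
  exists (ball ((a, b) : R * R) (d / 4), [set d' : R | d' < d / 2]) => /=.
    split; first exact: nbhsx_ballx.
    by apply: nbhs_right_lt; rewrite divr_gt0.
  move=> [[a' b'] d'] /= [[h1 h2] h3] y hy; rewrite /ball /= in h1 h2.
  have hp : td (pt a b) (pt a' b') < d / 2 by apply: le_lt_trans (td_pt _ _ _ _) _; lra.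
  have k1 : K (pt a b) (pt a' b') < e / 2 by apply: hd; lra.
  have k2 : K (pt a b) y < e / 2 by apply: hd; have := td_triangle (pt a' b') (pt a b) y; rewrite /= in hy *; lra.
  by have := Ktri (pt a' b') (pt a b) y; move: k1 k2; rewrite (Ksym (pt a' b') (pt a b)) /=; lra.
exists (d0 / 2); first by rewrite divr_gt0.
move=> x y h; have [a [b [xE ha hb]]] := pt_bounded x; rewrite xE in h *.
apply: (hd (d0 / 2) _ _ (a, b)) => //=.
- rewrite /ball_ /= sub0r normrN gtr0_norm ?divr_gt0 //; rewrite /= in d00; lra.
- by rewrite divr_gt0.
- split; rewrite /= in_itv /= //; by rewrite -ler_norml.
Qed.

Lemma cts_unif (phi : T2 -> R) : continuous phi ->
  forall e : R, 0 < e -> exists2 d : R, 0 < d & forall x y, td x y < d -> `|phi x - phi y| < e.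
Proof.
move=> cphi; apply: td_unif.
- by move=> x y z; exact: ler_distD.
- by move=> x y; exact: distrC.
- move=> x e e0; have := cphi x _ (nbhsx_ballx (phi x) e e0).
  by move=> /nbhs_tdP[d d0 hd]; exists d.
Qed.

Lemma ctst_unif (g : T2 -> T2) : continuous g ->
  forall e : R, 0 < e -> exists2 d : R, 0 < d & forall x y, td x y < d -> td (g x) (g y) < e.
Proof.
move=> cg; apply: td_unif.
- by move=> x y z; exact: td_triangle.
- by move=> x y; exact: td_sym.
- move=> x e e0.
  have : nbhs (g x) [set y | td (g x) y < e] by apply/nbhs_tdP; exists e.
  by move=> /(cg x) /nbhs_tdP[d d0 hd]; exists d.
Qed.

Lemma cts_td (phi : T2 -> R) : 
  (forall x (e : R), 0 < e -> exists2 d : R, 0 < d & forall y, td x y < d -> `|phi x - phi y| < e) ->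
  continuous phi.
Proof.
move=> h x; apply/(@cvgrPdist_lt _ _ _ (nbhs x) (nbhs_filter x)) => e e0; have [d d0 hd] := h x e e0.
by apply/nbhs_tdP; exists d.
Qed.

Lemma ctst_td (g : T2 -> T2) :
  (forall x (e : R), 0 < e -> exists2 d : R, 0 < d & forall y, td x y < d -> td (g x) (g y) < e) ->
  continuous g.
Proof.
move=> h x U /nbhs_tdP[e e0 he]; have [d d0 hd] := h x e e0.
by apply/nbhs_tdP; exists d => // y /hd /he.
Qed.

Lemma cat_cts : continuous (@cat_map R).
Proof.
apply: ctst_td => x e e0; exists (e / 3) => [|y]; first by rewrite divr_gt0.
have [a [b [-> _ _]]] := pt_bounded x => /td_lt_lift[a' [b' [-> h]]].
rewrite !cat_pt; apply: le_lt_trans (td_pt _ _ _ _) _.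
have := lamX_norm 1 (a - a'); have := lamV_norm 1 (b - b'); rewrite expr1 !mulrBr => -> ->.
have h1 : lam * `|a - a'| <= 3 * `|a - a'| by rewrite ler_wpM2r // ltW // lam_lt3.
have h2 : lam^-1 * `|b - b'| <= 3 * `|b - b'|.
  by rewrite ler_wpM2r // (@le_trans _ _ 1) ?ler1n //; exact: (lamV_le1 1).
apply: le_lt_trans (lerD h1 h2) _; rewrite -mulrDr; lra.
Qed.

Lemma tshift_td (v w : R) x y : td (tshift v w x) (tshift v w y) <= td x y.
Proof.
apply/ler_addgt0Pr => e e0.
have [a [b [-> _ _]]] := pt_bounded x.
have /td_lt_lift[a' [b' [-> h]]] : td (pt a b) y < td (pt a b) y + e by rewrite ltrDl.
rewrite !tshift_pt; apply: le_trans (td_pt _ _ _ _) _.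
by rewrite !(_ : forall p q r : R, p + r - (q + r) = p - q) ?(ltW h) // => *; ring.
Qed.

Lemma tshift_cts (v w : R) : continuous (tshift v w).
Proof.
by apply: ctst_td => x e e0; exists e => // y; apply: le_lt_trans; exact: tshift_td.
Qed.

Lemma cts_bounded (phi : T2 -> R) : continuous phi -> exists2 C : R, 0 < C & forall x, `|phi x| <= C.
Proof.
move=> cphi.
have cpt : compact (`[0, 2]%classic `*` `[(-2), 2]%classic : set (R * R)).
  by apply: compact_setX; exact: segment_compact.
pose P (C : R) (z : R * R) := `|phi (pt z.1 z.2)| < C.
have := (compact_near_coveringP _).1 cpt R (+oo%R) P _.
case=> [[a b] _|M /= [_ hM]].
  have : nbhs (pt a b) (phi @^-1` (ball (phi (pt a b)) 1)) by apply: cphi; exact: nbhsx_ballx.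
  move=> /(ptcont (a, b)) /= h.
  exists ([set z : R * R | ball (phi (pt a b)) 1 (phi (pt z.1 z.2))], [set C : R | `|phi (pt a b)| + 1 < C]) => /=.
    by split => //; apply: nbhs_pinfty_gt; rewrite num_real.
  move=> [[a' b'] C] /= [h1 h2]; rewrite /P /=; rewrite /ball /= distrC in h1.
  rewrite -(subrK (phi (pt a b)) (phi (pt a' b'))) (le_lt_trans (ler_normD _ _)) //; lra.
exists (`|M| + 1) => [|x]; first by rewrite ltr_wpDl.
have [a [b [xE ha hb]]] := pt_bounded x; rewrite xE.
apply/ltW/(hM (`|M| + 1) _ (a, b)).
- by rewrite (le_lt_trans (ler_norm M)) // ltrDl.
- split; rewrite /= in_itv /= //; by rewrite -ler_norml.
Qed.

End torus_metric.

(** * Integrals of bounded functions and uniqueness of measures *)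

Section bounded_integration.
Context {R : realType} {d : measure_display} {T : measurableType d}.
Implicit Types (mu : probability T R) (f g : T -> R).

(** Bounded measurable functions: integrable for every probability measure and
    stable under the operations used below. *)
Definition bmf f := measurable_fun setT f /\ exists C : R, forall x, `|f x| <= C.

Lemma bmf_int mu f : bmf f -> mu.-integrable setT (EFin \o f).
Proof.
move=> [mf [C hC]]; apply: measurable_bounded_integrable => //.
  by rewrite (le_lt_trans (probability_le1 mu measurableT)) // ltry.
by exists C; split; [exact: num_real|move=> M CM x _; apply: le_trans (hC x) _; exact: ltW].
Qed.

Lemma bmfD f g : bmf f -> bmf g -> bmf (fun x => f x + g x).
Proof.
move=> [mf [C hC]] [mg [C' hC']]; split; first exact: measurable_funD.
by exists (C + C') => x; rewrite (le_trans (ler_normD _ _)) // lerD.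
Qed.

Lemma bmfZ r f : bmf f -> bmf (fun x => r * f x).
Proof.
move=> [mf [C hC]]; split; first exact: measurable_funM.
by exists (`|r| * C) => x; rewrite normrM ler_wpM2l.
Qed.

Lemma bmf_cst r : bmf (fun=> r).
Proof. by split; [exact: measurable_cst|exists `|r|]. Qed.

Lemma bmf_sum (I : Type) (s : seq I) (F : I -> T -> R) :
  (forall i, bmf (F i)) -> bmf (fun x => \sum_(i <- s) F i x).
Proof.
move=> h; elim: s => [|i s IHs].
  rewrite (_ : (fun _ => _) = fun=> 0); first exact: bmf_cst.
  by apply/funext => x; rewrite big_nil.
rewrite (_ : (fun _ => _) = fun x => F i x + \sum_(i <- s) F i x); first exact: bmfD.
by apply/funext => x; rewrite big_cons.
Qed.

Lemma bmf_comp d' (T' : measurableType d') (g : T' -> T) f :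
  measurable_fun setT g -> bmf f ->
  measurable_fun setT (f \o g) /\ exists C, forall x, `|(f \o g) x| <= C.
Proof.
move=> mg [mf [C hC]]; split; first exact: measurableT_comp.
by exists C => x /=.
Qed.

Lemma Int_sum mu (I : Type) (s : seq I) (F : I -> T -> R) :
  (forall i, bmf (F i)) ->
  \int[mu]_x (\sum_(i <- s) F i x) = \sum_(i <- s) \int[mu]_x F i x.
Proof.
move=> h; elim: s => [|i s IHs].
  rewrite big_nil (_ : (fun _ => _) = fun=> 0) ?Rintegral_cst ?mul0r //.
  by apply/funext => x; rewrite big_nil.
rewrite big_cons -IHs -RintegralD //; try exact: bmf_int; last by apply/bmf_int/bmf_sum.
by apply: eq_Rintegral => x _; rewrite big_cons.
Qed.

Lemma Int_cst mu r : \int[mu]_x (fun=> r) x = r.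
Proof.
rewrite Rintegral_cst // [X in fine X](_ : _ = 1%E) ?mulr1 //.
exact: probability_setT.
Qed.

Lemma IntD mu f g : bmf f -> bmf g ->
  \int[mu]_x (f x + g x) = \int[mu]_x f x + \int[mu]_x g x.
Proof. by move=> hf hg; rewrite RintegralD //; exact: bmf_int. Qed.

Lemma IntZ mu f r : bmf f -> \int[mu]_x (r * f x) = r * \int[mu]_x f x.
Proof. by move=> hf; rewrite RintegralZl //; exact: bmf_int. Qed.

Lemma Int_le mu f g : bmf f -> bmf g -> (forall x, f x <= g x) ->
  \int[mu]_x f x <= \int[mu]_x g x.
Proof. by move=> hf hg h; apply: le_Rintegral => //; exact: bmf_int. Qed.

Lemma Int_le_cst mu f r : bmf f -> (forall x, f x <= r) -> \int[mu]_x f x <= r.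
Proof. by move=> hf h; rewrite -[leRHS](Int_cst mu r) Int_le //; exact: bmf_cst. Qed.

Lemma Int_ge_cst mu f r : bmf f -> (forall x, r <= f x) -> r <= \int[mu]_x f x.
Proof. by move=> hf h; rewrite -[leLHS](Int_cst mu r) Int_le //; exact: bmf_cst. Qed.

Lemma Int_indic mu A : measurable A -> \int[mu]_x \1_A x = fine (mu A).
Proof. by move=> mA; rewrite /Rintegral integral_indic // setIT. Qed.

Lemma bmf_indic A : measurable A -> bmf \1_A.
Proof.
move=> mA; split; first exact: measurable_indic.
by exists 1 => x; rewrite indicE; case: (_ \in _); rewrite ?normr0 ?normr1.
Qed.

Lemma prob_fin mu (A : set T) : measurable A -> mu A = (fine (mu A))%:E.
Proof. by move=> mA; rewrite fineK // fin_num_measure. Qed.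

End bounded_integration.

Lemma Int_comp {R : realType} {d d' : measure_display} (T : measurableType d)
    (T' : measurableType d') (mu : probability T R) (mu' : probability T' R)
    (g : T -> T') (f : T' -> R) :
  measurable_fun setT g -> bmf f ->
  (forall A, measurable A -> mu (g @^-1` A) = mu' A) ->
  \int[mu]_x f (g x) = \int[mu']_x f x.
Proof.
move=> mg hf h; rewrite /Rintegral; congr fine.
rewrite -[LHS](@integral_pushforward _ _ _ _ R g mg mu setT (EFin \o f)) //.
- by apply: eq_measure_integral => A mA _; exact: h.
- by apply/measurable_EFinP; exact: hf.1.
- by apply: (@bmf_int R _ T mu (f \o g)); exact: bmf_comp.
Qed.

Section torus_measure.
Context {R : realType}.
Local Notation T2 := (torus R).
Implicit Types mu : probability T2 R.

Lemma open_meas (U : set T2) : open U -> measurable U.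
Proof. by move=> oU; apply: sub_sigma_algebra. Qed.

Lemma cts_meas (phi : T2 -> R) : continuous phi -> measurable_fun setT phi.
Proof.
move=> /continuousP cphi; apply: (measurability _ (RGenOpens.measurableE R)).
move=> _ [_ [a [b ->]] <-]; rewrite setTI; apply: open_meas.
exact/cphi/interval_open.
Qed.

Lemma ctst_meas (g : T2 -> T2) : continuous g -> measurable_fun setT g.
Proof.
move=> /continuousP cg; apply: (measurability (open : set (set T2))) => //.
by move=> _ [U oU <-]; rewrite setTI; apply: open_meas; exact: cg.
Qed.

Lemma cts_bmf (phi : T2 -> R) : continuous phi -> bmf phi.
Proof.
move=> cphi; split; first exact: cts_meas.
by have [C _ hC] := cts_bounded _ cphi; exists C.
Qed.

Definition compl_dist_set (O : set T2) (x : T2) : set R :=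
  [set r | r = 1 \/ exists2 y, ~ O y & r = td x y].

(** Distance to the complement of O, truncated at 1 so that it is finite when O
    is the whole torus. *)
Definition compl_dist (O : set T2) (x : T2) : R := inf (compl_dist_set O x).

Lemma compl_dist_has_inf O x : has_inf (compl_dist_set O x).
Proof.
split; first by exists 1; left.
by exists 0 => r [->|[y _ ->]]; rewrite ?td_ge0.
Qed.

Lemma compl_dist_ge0 O x : 0 <= compl_dist O x.
Proof. by apply: lb_le_inf; [exact: (compl_dist_has_inf O x).1|move=> r [->|[y _ ->]]; rewrite ?td_ge0]. Qed.

Lemma compl_dist_le1 O x : compl_dist O x <= 1.
Proof. by apply: ge_inf; [exact: (compl_dist_has_inf O x).2|left]. Qed.

Lemma compl_dist_out O x : ~ O x -> compl_dist O x = 0.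
Proof.
move=> nOx; apply/eqP; rewrite eq_le compl_dist_ge0 andbT.
by apply: ge_inf; [exact: (compl_dist_has_inf O x).2|right; exists x => //; rewrite tdxx].
Qed.

Lemma compl_dist_gt0 O x : open O -> O x -> 0 < compl_dist O x.
Proof.
move=> /open_tdP oO /oO[e e0 he]; apply: (@lt_le_trans _ _ (Num.min e 1)); first by rewrite lt_min e0 ltr01.
rewrite /compl_dist; apply: lb_le_inf; first exact: (compl_dist_has_inf O x).1.
move=> r [->|[y nOy ->]]; first by rewrite ge_min lexx orbT.
by rewrite ge_min leNgt; case: ltP => //= /he.
Qed.

Lemma compl_dist_le O x y : compl_dist O x <= compl_dist O y + td x y.
Proof.
rewrite -lerBlDr; apply: lb_le_inf; first exact: (compl_dist_has_inf O y).1.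
move=> r [->|[z nOz ->]].
  by rewrite lerBlDr (le_trans (compl_dist_le1 _ _)) // lerDl td_ge0.
rewrite lerBlDr; apply: (@le_trans _ _ (td x z)).
  by apply: ge_inf; [exact: (compl_dist_has_inf O x).2|right; exists z].
by rewrite addrC td_triangle.
Qed.

Lemma compl_dist_cts O : continuous (compl_dist O).
Proof.
apply: cts_td => x e e0; exists e => // y h.
by have := compl_dist_le O x y; have := compl_dist_le O y x; rewrite (td_sym y) ltr_norml; lra.
Qed.

Lemma min1_lip (p q r e : R) : r < e -> p <= q + r -> q <= p + r ->
  `|Num.min 1 p - Num.min 1 q| < e.
Proof.
move=> hr h1 h2; rewrite ltr_norml.
by case: (lerP 1 p) => hp; case: (lerP 1 q) => hq; lra.
Qed.

(** An open set is exhausted by the sets F n where the distance to its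
    complement exceeds 1 / (n + 1), and a continuous function separates F n
    from the complement of O. *)
Lemma le_open_of_int mu mu' :
  (forall phi : T2 -> R, continuous phi -> \int[mu]_x phi x = \int[mu']_x phi x) ->
  forall O, open O -> (mu O <= mu' O)%E.
Proof.
move=> h O oO.
pose F n := [set x | n.+1%:R^-1 < compl_dist O x].
have oF n : open (F n).
  by apply: (@open_comp _ _ (compl_dist O) [set r : R | n.+1%:R^-1 < r]); [move=> x _; exact: compl_dist_cts|exact: open_gt].
have FO : \bigcup_n F n = O.
  apply/seteqP; split=> [x [n _ /=]|x Ox].
    by move=> lt; apply: contrapT => /compl_dist_out e; move: lt; rewrite /F /= e invr_lt0 ltrn0.
  have /ltr_add_invr[n] : 0 < compl_dist O x by exact: compl_dist_gt0.
  by rewrite add0r => hn; exists n.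
have -> : mu O = lim (mu (F n) @[n --> \oo]).
  apply/esym/cvg_lim => //; rewrite -{1}FO; apply: nondecreasing_cvg_mu.
  - by move=> n; apply: open_meas.
  - by rewrite FO; apply: open_meas.
  - move=> n m nm; apply/subsetPset => x /=; apply: le_lt_trans.
    by rewrite lef_pV2 ?posrE // ler_nat.
apply: lime_le.
  apply: ereal_nondecreasing_is_cvgn => n m nm; apply: le_measure; rewrite ?inE; try exact: open_meas.
  move=> x /=; apply: le_lt_trans.
  by rewrite lef_pV2 ?posrE // ler_nat.
apply: nearW => n; pose phi x := Num.min 1 (n.+1%:R * compl_dist O x).
have cphi : continuous phi.
  apply: cts_td => x e e0.
  exists (e / n.+1%:R); first by rewrite divr_gt0.
  move=> y; rewrite ltr_pdivlMr // mulrC => hy.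
  have h1 := compl_dist_le O x y; have h2 := compl_dist_le O y x; rewrite (td_sym y) in h2.
  have n0 : 0 < n.+1%:R :> R by [].
  have {}h1 : n.+1%:R * compl_dist O x <= n.+1%:R * compl_dist O y + n.+1%:R * td x y by rewrite -mulrDr ler_wpM2l.
  have {}h2 : n.+1%:R * compl_dist O y <= n.+1%:R * compl_dist O x + n.+1%:R * td x y by rewrite -mulrDr ler_wpM2l.
  rewrite /phi; move: (n.+1%:R * compl_dist O x) (n.+1%:R * compl_dist O y) (n.+1%:R * td x y) hy h1 h2 => p q r hy h1 h2.
  exact: (@min1_lip p q r e).
have b := cts_bmf _ cphi; have mF := open_meas _ (oF n); have mO := open_meas _ oO.
rewrite (prob_fin mu _ mF) (prob_fin mu' _ mO) lee_fin -!Int_indic //.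
apply: (@le_trans _ _ (\int[mu]_x phi x)).
  apply: Int_le => //; first exact: bmf_indic.
  move=> x; rewrite indicE; case: (boolP (x \in F n)) => [/[!inE] Fx|_].
    by rewrite le_min lexx /= -ler_pdivrMl // mulr1 ltW.
  by rewrite le_min ler01 mulr_ge0 ?compl_dist_ge0.
rewrite h //; apply: Int_le => //; first exact: bmf_indic.
move=> x; rewrite indicE; case: (boolP (x \in O)) => [_|]; first by rewrite ge_min lexx.
by rewrite notin_setE => /compl_dist_out e; rewrite /phi e mulr0 ge_min lexx orbT.
Qed.

(** The open sets form a pi-system generating the Borel sets. *)
Lemma prob_eq_of_int mu mu' :
  (forall phi : T2 -> R, continuous phi -> \int[mu]_x phi x = \int[mu']_x phi x) ->
  forall A, measurable A -> mu A = mu' A.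
Proof.
move=> h A mA; apply: (measure_unique (open : set (set T2)) (fun=> setT)) => //.
- exact: openI.
- by move=> _; exact: openT.
- by apply/seteqP; split=> // x _; exists 0%N.
- by move=> O oO; apply/eqP; rewrite eq_le !le_open_of_int // => phi cphi; rewrite h.
- by move=> _; rewrite (le_lt_trans (probability_le1 mu measurableT)) // ltry.
Qed.

End torus_measure.

(** * Haar measure *)

Section haar.
Context {R : realType}.
Local Notation T2 := (torus R).
Local Notation mR := (measurableTypeR R).
Local Notation leb := (@lebesgue_measure R).

(** An open subset of the plane is a countable union of rational boxes; this
    reconciles the Borel sets of the plane with the product sigma-algebra. *)
Lemma open_meas2 (U : set (mR * mR)) : open (U : set (R * R)) -> measurable U.
Proof.
move=> oU.
pose box (i : rat * rat * nat) : set (mR * mR) :=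
  `]ratr i.1.1 - i.2.+1%:R^-1, ratr i.1.1 + i.2.+1%:R^-1[%classic `*`
  `]ratr i.1.2 - i.2.+1%:R^-1, ratr i.1.2 + i.2.+1%:R^-1[%classic.
have -> : U = \bigcup_(i : rat * rat * nat) (if `[< box i `<=` U >] then box i else set0).
  apply/seteqP; split=> [[x y] Uxy|z [i _]]; last first.
    by case: asboolP => [h /h|//].
  have /nbhs_ballP[e /= e0 he] : nbhs ((x, y) : R * R) U by exact: open_nbhs_nbhs.
  have /ltr_add_invr[n] : 0 < e / 2 by rewrite divr_gt0.
  rewrite add0r => hn; have n0 : 0 < n.+1%:R^-1 :> R by rewrite invr_gt0.
  have lt t : t - n.+1%:R^-1 < t + n.+1%:R^-1 :> R by rewrite ltrD2l gtrN.
  have [p] := rat_in_itvoo (lt x); have [q] := rat_in_itvoo (lt y).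
  rewrite !in_itv /= => /andP[q1 q2] /andP[p1 p2].
  exists (p, q, n) => //; case: asboolP => [_|].
    have key (t s i : R) : t - i < s -> s < t + i -> s - i < t < s + i by move=> *; apply/andP; split; lra.
    by split; rewrite /= in_itv /=; exact: key.
  case=> -[x' y'] [/=]; rewrite !in_itv /= => /andP[h1 h2] /andP[h3 h4].
  have key (t s i r : R) : t - i < s -> s < t + i -> s - i < r -> r < s + i -> i < e / 2 -> - e < t - r < e.
    by move=> *; apply/andP; split; lra.
  by apply: he; split; rewrite /ball /= ltr_norml; [exact: (key _ (ratr p) n.+1%:R^-1)|exact: (key _ (ratr q) n.+1%:R^-1)].
apply: countable_bigcupT_measurable => // i; case: asboolP => _; last exact: measurable0.
by apply: measurableX; exact: measurable_itv.
Qed.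

Lemma leb_shift (v : R) (A : set mR) : measurable A ->
  leb ((fun x => x + v) @^-1` A) = leb A.
Proof.
move=> mA; apply/esym.
have mf : measurable_fun setT ((fun x : mR => x + v) : mR -> mR).
  by apply: measurable_funD => //; exact: measurable_cst.
have := @lebesgue_measure_unique R (pushforward leb (fun x : mR => (x + v : mR))).
apply => // X [[a b] _ <-]; rewrite /pushforward /=.
transitivity (leb `]a - v, b - v]%classic); last first.
  by congr (leb _); apply/seteqP; split=> x /=; rewrite !in_itv /= ltrBlDr lerBrDr.
rewrite !lebesgue_measure_itv /= !lte_fin ltrD2r; case: ifP => // _.
by rewrite -!EFinB; congr EFin; ring.
Qed.

Let P01 := uniform_prob (@ltr01 R).

Lemma P01E (A : set mR) : measurable A -> P01 A = leb (A `&` `[0, 1[%classic).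
Proof.
move=> mA; rewrite /P01 /uniform_prob integral_uniform_pdf.
rewrite (eq_integral (fun=> 1%:E)); last first.
  by move=> x; rewrite inE => -[_] /=; rewrite in_itv /= /uniform_pdf => ->; rewrite subr0 invr1.
rewrite integral_cst ?mul1e; last by apply: measurableI => //; exact: measurable_itv.
have e1 : `[0, 1]%classic = `[0, 1[%classic `|` [set (1 : R)].
  apply/seteqP; split=> x /=; rewrite !in_itv /=.
    by move=> /andP[h1]; rewrite le_eqVlt => /orP[/eqP->|->]; [right|left; rewrite h1].
  by move=> [/andP[-> /ltW ->]//|->]; rewrite ler01 lexx.
rewrite e1 setIUr; apply/eqP; rewrite eq_le; apply/andP; split.
  apply: (le_trans (measureU2 _ _ _)).
  - by apply: measurableI => //; exact: measurable_itv.
  - by apply: measurableI => //; exact: measurable_set1.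
  rewrite [X in (_ + X)%E](_ : _ = 0%E) ?adde0 //; apply/eqP; rewrite eq_le measure_ge0 andbT.
  rewrite -(lebesgue_measure_set1 (1 : R)); apply: le_measure; rewrite ?inE.
  - by apply: measurableI => //; exact: measurable_set1.
  - exact: measurable_set1.
  - by move=> x [].
apply: le_measure; rewrite ?inE.
- by apply: measurableI => //; exact: measurable_itv.
- by apply: measurableU; apply: measurableI => //; exact: measurable_set1.
- by move=> x ?; left.
Qed.

Lemma per_int (C : set mR) : (forall x : R, C (x + 1) <-> C x) ->
  forall (n : int) (x : R), C (x + n%:~R) <-> C x.
Proof.
move=> h; have hn (n : nat) (x : R) : C (x + n%:R) <-> C x.
  elim: n => [|n IHn]; first by rewrite addr0.
  by rewrite -natr1 addrA h.
move=> [n|n] x; first exact: hn.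
by rewrite NegzE -[X in _ <-> C X](subrK (n.+1%:R)) hn mulrNz.
Qed.

(** A 1-periodic set cut along v reduces translation invariance on the circle to
    that of Lebesgue measure on the line. *)
Lemma P01_shift (v : R) (C : set mR) : measurable C -> (forall x : R, C (x + 1) <-> C x) ->
  P01 ((fun x => x + v) @^-1` C) = P01 C.
Proof.
wlog : v / 0 <= v < 1.
  move=> H mC hC.
  have := H (v - (Num.floor v)%:~R); rewrite subr_ge0 floor_le_tmp /= ltrBlDl -intrD1 floorD1_gt.
  move=> /(_ isT mC hC) <-; congr (P01 _); apply/seteqP; split=> x /=.
    by rewrite -(per_int _ hC (- Num.floor v)) mulrNz addrA.
  by rewrite addrA -mulrNz (per_int _ hC).
move=> /andP[v0 v1] mC hC.
have mf (w : R) : measurable_fun setT ((fun x : mR => x + w) : mR -> mR).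
  by apply: measurable_funD => //; exact: measurable_cst.
have mfC (w : R) (D : set mR) : measurable D -> measurable ((fun x : mR => (x + w : mR)) @^-1` D).
  by move=> mD; rewrite -[X in measurable X]setTI; exact: mf.
rewrite !P01E //; last exact: mfC.
have -> : ((fun x : R => x + v) @^-1` C) `&` `[0, 1[ =
    ((fun x : R => x + v) @^-1` (C `&` `[v, 1[)) `|` ((fun x : R => x + (v - 1)) @^-1` (C `&` `[0, v[)).
  apply/seteqP; split=> x /=; rewrite !in_itv /=.
    move=> [Cx /andP[x0 x1]]; have [lt|ge] := ltP (x + v) 1; [left|right].
      by split=> //; apply/andP; split; lra.
    split; last by apply/andP; split; lra.
    by apply/hC; rewrite addrA subrK.
  move=> [[Cx /andP[x0 x1]]|[Cx /andP[x0 x1]]]; split => //; try by apply/andP; split; lra.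
  by move/hC : Cx; rewrite addrA subrK.
have mi a b : measurable (`[a, b[%classic : set mR) by exact: measurable_itv.
rewrite measureU; first last.
- apply/seteqP; split=> x //=; rewrite !in_itv /= => -[[_ /andP[h1 h2]] [_ /andP[h3 h4]]]; lra.
- by apply: mfC; exact: measurableI.
- by apply: mfC; exact: measurableI.
pose C1 := C `&` `[v, 1[%classic; pose C2 := C `&` `[0, v[%classic.
transitivity (leb C1 + leb C2)%E.
  by congr (_ + _)%E; apply: leb_shift; exact: measurableI.
have -> : C `&` `[0, 1[ = (C `&` `[v, 1[) `|` (C `&` `[0, v[).
  rewrite -setIUr; congr (C `&` _); apply/seteqP; split=> x /=; rewrite !in_itv /=.
    by move=> /andP[x0 x1]; case: (ltP x v) => h; [right|left]; apply/andP; split; lra.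
  by move=> [/andP[x0 x1]|/andP[x0 x1]]; apply/andP; split; lra.
rewrite measureU //; try exact: measurableI.
by apply/seteqP; split=> x //=; rewrite !in_itv /= => -[[_ /andP[h1 h2]] [_ /andP[h3 h4]]]; lra.
Qed.

Definition leb2 : set (mR * mR) -> \bar R := (P01 \x P01)%E.

HB.instance Definition _ := Measure.on leb2.

Let leb2_setT : leb2 setT = 1%E.
Proof.
rewrite /leb2 -setXTT product_measure1E // [X in (X * X)%E](_ : _ = 1%E) ?mule1 //.
exact: probability_setT.
Qed.

HB.instance Definition _ := Measure_isProbability.Build _ _ _ leb2 leb2_setT.

Lemma leb2_swap (X : set (mR * mR)) : measurable X -> leb2 X = (P01 \x^ P01)%E X.
Proof.
by move=> mX; apply: product_measure_unique => // A B mA mB; rewrite [LHS]product_measure2E.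
Qed.

Definition std (z : mR * mR) : 'rV[R]_2 := \row_j (if j == 0 then z.1 else z.2).

Lemma stdE z : std z = z.1 *: std (1, 0) + z.2 *: std (0, 1).
Proof. by apply/rowP; apply: ord2P; rewrite !mxE /=; ring. Qed.

Definition hstd (z : mR * mR) : T2 := tproj (std z).

Lemma hstd_meas : measurable_fun setT hstd.
Proof.
apply: (measurability (open : set (set T2))) => // _ [U oU <-]; rewrite setTI.
apply: open_meas2.
have h : continuous (std : R * R -> 'rV[R]_2).
  rewrite (_ : std = fun z => z.1 *: std (1, 0) + z.2 *: std (0, 1)); last by apply/funext => z; exact: stdE.
  by move=> z; apply: cvgD; apply: cvgZr_tmp; [exact: cvg_fst|exact: cvg_snd].
have oU' : open (@tproj R @^-1` U) by [].
apply: (@open_comp _ _ (std : R * R -> 'rV[R]_2) (@tproj R @^-1` U)) => // x _; exact: h.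
Qed.

Lemma hstd_fst1 x y : hstd (x + 1, y) = hstd (x, y).
Proof.
by apply/tproj_eq; apply: ord2P; rewrite !mxE /= ?subrr ?rpred0 // addrAC subrr add0r rpred1.
Qed.

Lemma hstd_snd1 x y : hstd (x, y + 1) = hstd (x, y).
Proof.
by apply/tproj_eq; apply: ord2P; rewrite !mxE /= ?subrr ?rpred0 // addrAC subrr add0r rpred1.
Qed.

(** The image of Lebesgue measure on the unit square. *)
Definition haar : probability T2 R := distribution leb2 (mfun_Sub (mem_set hstd_meas)).

Lemma hstd_tshift (v w : R) x y a b :
  v *: eigen_u R + w *: eigen_s R = std (a, b) -> 
  tshift v w (hstd (x, y)) = hstd (x + a, y + b).
Proof.
move=> e; rewrite /hstd tshift_tproj e; congr tproj.
by apply/rowP; apply: ord2P; rewrite !mxE.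
Qed.

Lemma std_surj (z : 'rV[R]_2) : z = std (z 0 0, z 0 1).
Proof. by apply/rowP; apply: ord2P; rewrite !mxE. Qed.

Lemma leb2_shift_snd (b : R) (X : set (mR * mR)) : measurable X ->
  (forall x y : R, X (x, y + 1) <-> X (x, y)) ->
  leb2 [set z | X (z.1, z.2 + b)] = leb2 X.
Proof.
move=> mX hX; rewrite /leb2 /product_measure1; apply: eq_integral => x _ /=.
have -> : xsection [set z : mR * mR | X (z.1, z.2 + b)] x = (fun y => y + b) @^-1` (xsection X x).
  by apply/seteqP; split=> y /=; rewrite /xsection /= !inE.
apply: P01_shift; first exact: measurable_xsection.
by move=> y; rewrite /xsection /= !inE; exact: hX.
Qed.

Lemma leb2_shift_fst (a : R) (X : set (mR * mR)) : measurable X ->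
  measurable [set z : mR * mR | X (z.1 + a, z.2)] ->
  (forall x y : R, X (x + 1, y) <-> X (x, y)) ->
  leb2 [set z | X (z.1 + a, z.2)] = leb2 X.
Proof.
move=> mX mX' hX; transitivity ((P01 \x^ P01)%E X); last by rewrite leb2_swap.
transitivity ((P01 \x^ P01)%E [set z : mR * mR | X (z.1 + a, z.2)]); first by rewrite leb2_swap.
rewrite /product_measure2; apply: eq_integral => y _ /=.
have -> : ysection [set z : mR * mR | X (z.1 + a, z.2)] y = (fun x => x + a) @^-1` (ysection X y).
  by apply/seteqP; split=> x /=; rewrite /ysection /= !inE.
apply: P01_shift; first exact: measurable_ysection.
by move=> x; rewrite /ysection /= !inE; exact: hX.
Qed.

Lemma haar_tshift (v w : R) (A : set T2) : measurable A -> haar (tshift v w @^-1` A) = haar A.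
Proof.
move=> mA; change (leb2 (hstd @^-1` (tshift v w @^-1` A)) = leb2 (hstd @^-1` A)).
have [a [b e]] : exists a b, v *: eigen_u R + w *: eigen_s R = std (a, b).
  by eexists; eexists; exact: std_surj.
have msh (p : R) : measurable_fun setT (fun z : mR * mR => (z.1 + p, z.2) : mR * mR).
  by apply: measurable_fun_pair => //; apply: measurable_funD => //; exact: measurable_cst.
have mX : measurable (hstd @^-1` A).
  by rewrite -[X in measurable X]setTI; exact: hstd_meas.
have mX1 : measurable [set z : mR * mR | A (hstd (z.1 + a, z.2))].
  by rewrite -[X in measurable X]setTI; apply: (msh a measurableT (hstd @^-1` A)).
transitivity (leb2 [set z : mR * mR | A (hstd (z.1 + a, z.2))]); last first.
  by apply: (@leb2_shift_fst a (hstd @^-1` A)) => // x y /=; rewrite hstd_fst1.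
transitivity (leb2 [set z : mR * mR | [set z : mR * mR | A (hstd (z.1 + a, z.2))] (z.1, z.2 + b)]).
  by congr (leb2 _); apply/seteqP; split=> -[x y] /=; rewrite (hstd_tshift _ _ _ _ _ _ e).
apply: (@leb2_shift_snd b) => [|x y /=]; first exact: mX1.
by rewrite hstd_snd1.
Qed.

End haar.

(** * Equidistribution of unstable segments *)

Section equidistribution.
Context {R : realType}.
Local Notation T2 := (torus R).
Local Notation lam := (lam R).

Lemma avg_const (x : R) q : q%:R != 0 :> R -> q%:R^-1 * (x *+ q) = x.
Proof. by move=> q0; rewrite -(mulr_natl x) mulrA mulVf ?mul1r. Qed.

Lemma sum_shift (F : nat -> R) (C : R) q r : (forall i, `|F i| <= C) ->
  `|\sum_(d < q) F (d + r)%N - \sum_(d < q) F d| <= 2 * C * r%:R.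
Proof.
move=> hF; elim: r => [|r IHr].
  by rewrite mulr0; under eq_bigr do rewrite addn0; rewrite subrr normr0.
have e : \sum_(d < q) F (d + r.+1)%N - \sum_(d < q) F (d + r)%N = F (q + r)%N - F r.
  rewrite -sumrB -(big_mkord xpredT (fun d => F (d + r.+1)%N - F (d + r)%N)).
  by under eq_bigr do rewrite addnS -addSn; rewrite telescope_sumr.
rewrite -(subrKA (\sum_(d < q) F (d + r)%N)) e -(natr1 r) mulrDr mulr1.
rewrite addrC (le_trans (ler_normD _ _)) // lerD // (le_trans (ler_normB _ _)) //.
by rewrite mulr_natl mulr2n lerD.
Qed.

Lemma sum_ltn M K : (\sum_(i < M) (i < K)%N <= K)%N.
Proof.
elim: M => [|M IH]; first by rewrite big_ord0.
rewrite big_ord_recr /=; case: (ltnP M K) => h; last by rewrite addn0.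
rewrite addn1 (leq_trans _ h) // ltnS -[X in (_ <= X)%N]card_ord -sum1_card.
by apply: leq_sum => i _; case: (_ < _)%N.
Qed.

Lemma sum_ends (F : nat -> R) (B e : R) M K1 K2 : 0 <= B -> 0 <= e ->
  (forall i, (i < M)%N -> `|F i| <= B) ->
  (forall i, (K1 <= i)%N -> (i + K2 <= M)%N -> `|F i| <= e) ->
  `|\sum_(i < M) F i| <= M%:R * e + (K1 + K2)%:R * B.
Proof.
move=> B0 e0 hB he; rewrite (le_trans (ler_norm_sum _ _ _)) //.
apply: (@le_trans _ _ (\sum_(i < M) (e + (i < K1)%N%:R * B + (M < i + K2)%N%:R * B))).
  apply: ler_sum => i _.
  have [hi|hi] := ltnP i K1.
    by rewrite mul1r (le_trans (hB i _)) // -addrA addrCA lerDl addr_ge0 // mulr_ge0.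
  have [hj|hj] := ltnP M (i + K2); last by rewrite !mul0r !addr0 he.
  by rewrite mul0r addr0 mul1r (le_trans (hB i _)) // lerDr.
rewrite !big_split /= sumr_const card_ord -[_ *+ M]mulr_natl -!mulr_suml -addrA lerD2l natrD mulrDl.
have h1 : \sum_(i < M) (i < K1)%N%:R <= K1%:R :> R.
  by rewrite -natr_sum ler_nat sum_ltn.
have h2 : \sum_(i < M) (M < i + K2)%N%:R <= K2%:R :> R.
  rewrite -natr_sum ler_nat (reindex_inj rev_ord_inj) /= (leq_trans _ (sum_ltn M K2)) //.
  apply: leq_sum => i _; have := ltn_ord i; case: (ltnP i K2) => //=; last by lia.
  by rewrite leq_b1.
by rewrite lerD // ler_wpM2r.
Qed.

Definition transl_inv (m : probability T2 R) :=
  forall v w A, measurable A -> m (tshift v w @^-1` A) = m A.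

Lemma transl_inv_int m phi v w : transl_inv m -> continuous phi ->
  \int[m]_x phi (tshift v w x) = \int[m]_x phi x.
Proof.
move=> hm cphi; apply: (Int_comp _ _ m m (tshift v w) phi).
- by apply: ctst_meas; exact: tshift_cts.
- exact: cts_bmf.
- by move=> A mA; rewrite hm.
Qed.

Lemma int_near (m : probability T2 R) (H : T2 -> R) (e : R) :
  bmf H -> (forall x y, `|H x - H y| <= e) -> forall x, `|H x - \int[m]_y H y| <= e.
Proof.
move=> bH h x; rewrite ler_distlC; apply/andP; split.
  by apply: Int_ge_cst => // y; have := h x y; rewrite ler_distlC => /andP[].
by apply: Int_le_cst => // y; have := h x y; rewrite ler_distlC => /andP[].
Qed.

(** The average H of phi over a long arithmetic progression on an unstable line
    hardly changes when its starting point moves by a bounded amount along that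
    line (shift of the progression) or by a small amount across it (uniform
    continuity). By density of the line these motions reach every point, so H is
    nearly constant, equal to its integral, which is that of phi. The bounds
    depend on phi and e only. *)
Lemma unstable_equi (phi : T2 -> R) (e : R) : continuous phi -> 0 < e ->
  exists s0 l0 : R, [/\ 0 < s0, 0 < l0 & forall m, transl_inv m -> forall (s : R) (q : nat), 0 < s <= s0 -> l0 <= q%:R * s ->
   forall a b, `|q%:R^-1 * (\sum_(d < q) phi (pt (a + d%:R * s) b)) - \int[m]_x phi x| <= e].
Proof.
move=> cphi e0; have [C C0 hC] := cts_bounded _ cphi.
have [d0 d00 hd0] := cts_unif _ cphi _ (divr_gt0 e0 (ltr0n _ 2)).
have [n /(_ n (leqnn n)) hn] := lamV_small _ (divr_gt0 d00 (ltr0n _ 4)).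
(* every point is reached from another one by a motion of at most T along the
   unstable line and less than d0 / 2 across it *)
set T := 2 * lam ^+ n.
have T0 : 0 < T by rewrite mulr_gt0 // exprn_gt0 // lam_gt0.
have T1 : 0 < 4 * C * (T + 1) by apply: mulr_gt0; [apply: mulr_gt0|apply: addr_gt0].
exists (d0 / 2), (4 * C * (T + 1) / e + 1); split.
- by rewrite divr_gt0.
- by apply: addr_gt0 => //; exact: divr_gt0.
move=> m hm s q /andP[s0 sd0] hq a b.
have q0 : 0 < q%:R :> R.
  by rewrite -(pmulr_lgt0 _ s0); apply: lt_le_trans hq; apply: addr_gt0 => //; exact: divr_gt0.
pose H x := q%:R^-1 * (\sum_(d < q) phi (tshift (d%:R * s) 0 x)).
have csh i : continuous (fun x => phi (tshift (i%:R * s) 0 x)).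
  by move=> x; apply: continuous_comp; [exact: tshift_cts|exact: cphi].
have HE x y : H (pt x y) = q%:R^-1 * (\sum_(d < q) phi (pt (x + d%:R * s) y)).
  by congr (_ * _); apply: eq_bigr => d _; rewrite tshift_pt addr0.
have bH : bmf H by apply: bmfZ; apply: bmf_sum => i; apply: cts_bmf; exact: csh.
have eI : \int[m]_x phi x = \int[m]_x H x.
  rewrite IntZ; last by apply: bmf_sum => i; apply: cts_bmf; exact: csh.
  rewrite Int_sum; last by move=> i; apply: cts_bmf; exact: csh.
  rewrite (eq_bigr (fun=> \int[m]_x phi x)); last by move=> i _; exact: transl_inv_int.
  by rewrite sumr_const card_ord avg_const // gt_eqF.
rewrite -HE [X in _ - X]eI; apply: int_near => // x y.
have [x1 [x2 [-> _ _]]] := pt_bounded x; have [y1 [y2 [-> _ _]]] := pt_bounded y.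
have [t [w [etw /andP[t0 tT] hw]]] := unstable_dense n (y1 - x1) (y2 - x2).
have -> : pt y1 y2 = pt (x1 + t) (x2 + w).
  have := ptD _ _ _ _ x1 x2 etw; rewrite !subrK => ->; by rewrite !(addrC _ t) !(addrC _ w).
set r := Num.truncn (t / s).
have /andP[r1 r2] : r%:R <= t / s < r.+1%:R by apply: truncn_itv; rewrite divr_ge0 // ltW.
rewrite ler_pdivlMr // in r1; rewrite ltr_pdivrMr // -natr1 mulrDl mul1r in r2.
rewrite !HE -mulrBr normrM gtr0_norm ?invr_gt0 // ler_pdivrMl //.
pose F (i : nat) := phi (pt (x1 + i%:R * s) x2).
rewrite -(subrKA (\sum_(d < q) F (d + r)%N)).
apply: (le_trans (ler_normD _ _)).
have h1 : `|\sum_(d < q) F d - \sum_(d < q) F (d + r)%N| <= 2 * C * r%:R.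
  by rewrite distrC; apply: sum_shift => i; exact: hC.
have h2 : `|\sum_(d < q) F (d + r)%N - \sum_(d < q) phi (pt (x1 + t + d%:R * s) (x2 + w))| <= q%:R * (e / 2).
  rewrite -sumrB (le_trans (ler_norm_sum _ _ _)) // mulr_natl -[X in _ <= _ *+ X](card_ord q) -sumr_const.
  apply: ler_sum => d _; apply/ltW/hd0; apply: le_lt_trans (td_pt _ _ _ _) _.
  have -> : x1 + (d + r)%:R * s - (x1 + t + d%:R * s) = - (t - r%:R * s) by rewrite natrD; ring.
  have -> : x2 - (x2 + w) = - w by ring.
  rewrite !normrN ger0_norm; last by rewrite subr_ge0.
  by have := hw; have := hn; lra.
have h3 : 2 * C * r%:R <= q%:R * (e / 2).
  rewrite -(ler_pM2r s0) -(mulrA (2 * C)); have : r%:R * s <= T + 1 by rewrite (le_trans r1) // (le_trans tT) // lerDl.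
  move=> h3; apply: (@le_trans _ _ (2 * C * (T + 1))); first by rewrite ler_wpM2l // mulr_ge0 // ltW.
  have : 4 * C * (T + 1) / e <= q%:R * s by apply: le_trans hq; rewrite lerDl.
  rewrite ler_pdivrMr // => h4.
  rewrite -[X in X <= _](mulfK (_ : 4 != 0)) // ler_pdivrMr // (_ : 2 * C * (T + 1) * 4 = 2 * (4 * C * (T + 1))); last by ring.
  rewrite (_ : q%:R * (e / 2) * s * 4 = 2 * (q%:R * s * e)); last by field.
  by rewrite ler_pM2l.
have := h1; have := h2; lra.
Qed.

(** [unstable_equi] computes both integrals as the limit of the same averages. *)
Lemma transl_inv_unique (m m' : probability T2 R) phi : transl_inv m -> transl_inv m' -> continuous phi ->
  \int[m]_x phi x = \int[m']_x phi x.
Proof.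
move=> hm hm' cphi; apply/eqP; rewrite -subr_eq0 -normr_le0; apply/ler_addgt0Pl => e e0; rewrite addr0.
have [s0 [l0 [s00 l00 H]]] := unstable_equi _ _ cphi (divr_gt0 e0 (ltr0n _ 2)).
have hs : 0 < s0 <= s0 by rewrite s00 lexx.
have hq : l0 <= (Num.truncn (l0 / s0)).+1%:R * s0.
  by rewrite -ler_pdivrMr // ltW // truncnS_gt.
have := H m hm s0 _ hs hq 0 0; have := H m' hm' s0 _ hs hq 0 0.
move: (_ * _) => z h1 h2; rewrite (le_trans (ler_distD z _ _)) // (distrC _ z).
by move: h1 h2; lra.
Qed.

Lemma exists_haar : exists m, transl_inv m.
Proof. by exists haar => v w A mA; exact: haar_tshift. Qed.

(** The image of a translation invariant measure under an automorphism is
    translation invariant. *)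
Lemma transl_inv_cat (m : probability T2 R) (A : set T2) : transl_inv m -> measurable A ->
  m (@cat_map R @^-1` A) = m A.
Proof.
move=> hm mA.
have mc : measurable_fun setT (@cat_map R : T2 -> T2) by apply: ctst_meas; exact: cat_cts.
pose m' : probability T2 R := distribution m (mfun_Sub (mem_set mc)).
have hm' : transl_inv m'.
  move=> v w B mB.
  change (m (@cat_map R @^-1` (tshift v w @^-1` B)) = m (@cat_map R @^-1` B)).
  rewrite -[RHS](hm (lam^-1 * v) (lam * w)); last first.
    by rewrite -[X in measurable X]setTI; exact: (mc measurableT).
  by congr (m _); apply/seteqP; split=> x /=; rewrite tshift_cat.
transitivity (m' A); first by [].
apply: prob_eq_of_int; last by [].
by move=> phi cphi; apply: transl_inv_unique.
Qed.

Definition blk (g : T2 -> R) (M : nat) (a b : R) : R :=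
  M%:R^-1 * \sum_(i < M) g (pt (lam ^+ i * a) (lam ^- i * b)).

(** Points at distance lam^-M along the unstable direction, and bounded distance
    along the stable one, stay close except near the two ends of the block. *)
Lemma blk_shadow (phi : T2 -> R) (e : R) : continuous phi -> 0 < e ->
  exists M0, forall M, (M0 <= M)%N -> forall a b a' b', `|a - a'| <= 4 / lam ^+ M -> `|b - b'| <= 4 ->
  `|blk phi M a b - blk phi M a' b'| <= e.
Proof.
move=> cphi e0; have [C C0 hC] := cts_bounded _ cphi.
have [d d0 hd] := cts_unif _ cphi _ (divr_gt0 e0 (ltr0n _ 2)).
have [K hK] := lamV_small _ (divr_gt0 d0 (ltr0n _ 8)).
exists (Num.truncn ((K + K)%:R * (2 * C) / (e / 2))).+1 => M hM a b a' b' ha hb.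
have M0 : 0 < M%:R :> R by rewrite ltr0n (leq_trans _ hM).
rewrite -mulrBr -sumrB normrM gtr0_norm ?invr_gt0 // ler_pdivrMl //.
apply: le_trans (sum_ends (fun i => phi (pt (lam ^+ i * a) (lam ^- i * b)) - phi (pt (lam ^+ i * a') (lam ^- i * b')))
  (2 * C) (e / 2) M K K _ _ _ _) _.
- by rewrite mulr_ge0 // ltW.
- by rewrite ltW // divr_gt0.
- by move=> i _; rewrite (le_trans (ler_normB _ _)) // mulr_natl mulr2n lerD.
- move=> i hi1 hi2; apply/ltW/hd; apply: le_lt_trans (td_pt _ _ _ _) _.
  rewrite -!mulrBr lamX_norm lamV_norm.
  have h1 := hK i hi1; have h2 := hK (M - i)%N (ltac:(lia)).
  have {}ha : lam ^+ i * `|a - a'| <= 4 * lam ^- (M - i).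
    rewrite (_ : lam ^- (M - i) = lam ^+ i / lam ^+ M).
      by rewrite [X in _ <= X]mulrCA ler_pM2l // lamX_gt0.
    by rewrite -[X in _ = _ / lam ^+ X](@subnKC i M) ?exprD ?invfM ?mulrA ?lamXV ?mul1r //; lia.
  have {}hb : lam ^- i * `|b - b'| <= 4 * lam ^- i by rewrite mulrC ler_pM2r // lamV_gt0.
  by move: ha hb h1 h2; lra.
- suff : (K + K)%:R * (2 * C) <= M%:R * (e / 2) by lra.
  rewrite -ler_pdivrMr ?divr_gt0 //; apply/ltW/(lt_le_trans (truncnS_gt _)); by rewrite ler_nat.
Qed.

(** At the i-th step the progression has become one of step lam^(i - M) and of
    length lam^i: except near the two ends of the block the step is small and
    the length large, so that [unstable_equi] applies. *)
Lemma blk_equi (phi : T2 -> R) (e : R) : continuous phi -> 0 < e ->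
  exists M0, forall M, (M0 <= M)%N -> forall q : nat, lam ^+ M - 1 <= q%:R <= lam ^+ M + 1 ->
  forall m, transl_inv m -> forall a b,
  `|q%:R^-1 * (\sum_(d < q) blk phi M (a + d%:R / lam ^+ M) b) - \int[m]_x phi x| <= e.
Proof.
move=> cphi e0; have [C C0 hC] := cts_bounded _ cphi.
have [s0 [l0 [s00 l00 H]]] := unstable_equi _ _ cphi (divr_gt0 e0 (ltr0n _ 2)).
have [K2 hK2] := lamV_small _ s00.
have [K1 hK1] := lamX_unbounded (2 * l0).
exists (Num.truncn ((K1 + K2)%:R * (2 * C) / (e / 2))).+1 => M hM q /andP[q1 q2] m hm a b.
have M0 : 0 < M%:R :> R by rewrite ltr0n (leq_trans _ hM).
have lM : 2 < lam ^+ M.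
  rewrite (lt_le_trans (_ : 2 < lam)) //; first by have := @lam_gt52 R; lra.
  by rewrite ler_eXnr ?(leq_trans _ hM) // ltW // lam_gt1.
have q0 : 0 < q%:R :> R by move: lM q1; lra.
pose F i := q%:R^-1 * (\sum_(d < q) phi (pt (lam ^+ i * a + d%:R * (lam ^+ i / lam ^+ M)) (lam ^- i * b))) - \int[m]_x phi x.
have -> : q%:R^-1 * (\sum_(d < q) blk phi M (a + d%:R / lam ^+ M) b) - \int[m]_x phi x = M%:R^-1 * \sum_(i < M) F i.
  rewrite sumrB sumr_const card_ord mulrBr avg_const ?gt_eqF //; congr (_ - _).
  rewrite -!mulr_sumr mulrCA exchange_big /=; congr (_ * (_ * _)).
  apply: eq_bigr => i _; apply: eq_bigr => d _; congr (phi (pt _ _)).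
  by rewrite mulrDr; congr (_ + _); rewrite mulrCA.
have hc : `|\int[m]_x phi x| <= C.
  rewrite ler_norml; apply/andP; split.
    by apply: Int_ge_cst; [exact: cts_bmf|move=> x; have := hC x; rewrite ler_norml => /andP[]].
  by apply: Int_le_cst; [exact: cts_bmf|move=> x; have := hC x; rewrite ler_norml => /andP[]].
rewrite normrM gtr0_norm ?invr_gt0 // ler_pdivrMl //.
apply: le_trans (sum_ends F (2 * C) (e / 2) M K1 K2 _ _ _ _) _.
- by rewrite mulr_ge0 // ltW.
- by rewrite ltW // divr_gt0.
- move=> i _; rewrite (le_trans (ler_normB _ _)) // mulr_natl mulr2n lerD //.
  rewrite normrM gtr0_norm ?invr_gt0 // ler_pdivrMl // (le_trans (ler_norm_sum _ _ _)) //.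
  rewrite mulr_natl -[X in _ <= _ *+ X](card_ord q) -sumr_const; apply: ler_sum => d _; exact: hC.
- move=> i hi1 hi2; apply: H => //.
    rewrite divr_gt0 ?lamX_gt0 //= ltW //; apply: le_lt_trans (hK2 K2 (leqnn _)).
    rewrite ler_pdivrMr ?lamX_gt0 // mulrC ler_pdivlMr ?lamX_gt0 // -exprD ler_eXn2l ?lam_gt1 //.
  have h1 := hK1 i hi1; apply: (@le_trans _ _ (lam ^+ i / 2)); first by rewrite ler_pdivlMr // mulrC ltW.
  rewrite [leRHS]mulrCA ler_pM2l ?lamX_gt0 // ler_pdivlMr ?lamX_gt0 //; move: q1 lM; lra.
- suff : (K1 + K2)%:R * (2 * C) <= M%:R * (e / 2) by lra.
  rewrite -ler_pdivrMr ?divr_gt0 //; apply/ltW/(lt_le_trans (truncnS_gt _)); by rewrite ler_nat.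
Qed.

End equidistribution.

(** * Entropy of finite-valued functions *)

Section subadditive.
Context {R : realType}.

Lemma subadd_mul (a : nat -> R) : (forall m n, a (m + n)%N <= a m + a n) ->
  forall k q r, a (q * k + r)%N <= q%:R * a k + a r.
Proof.
move=> h k; elim=> [|q IH] r; first by rewrite mul0n add0n mul0r add0r.
by rewrite mulSn -addnA (le_trans (h _ _)) // -natr1 mulrDl mul1r addrAC addrC lerD2l IH.
Qed.

Lemma fekete (a : nat -> R) : (forall n, 0 <= a n) -> (forall m n, a (m + n)%N <= a m + a n) ->
  cvgn (fun n => n%:R^-1 * a n) /\
  forall n, (0 < n)%N -> limn (fun n => n%:R^-1 * a n) <= n%:R^-1 * a n.
Proof.
move=> a0 sub.
pose S := [set n%:R^-1 * a n | n in [set n | (0 < n)%N]].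
have hS : has_inf S.
  split; first by exists (1%:R^-1 * a 1%N), 1%N.
  by exists 0 => _ [n _ <-]; rewrite mulr_ge0.
have lb n : (0 < n)%N -> inf S <= n%:R^-1 * a n by move=> n0; apply: ge_inf; [exact: hS.2|exists n].
suff cv : (fun n => n%:R^-1 * a n) @ \oo --> inf S.
  split; first by apply/cvg_ex; exists (inf S).
  by move=> n n0; rewrite (cvg_lim _ cv) //; exact: lb.
apply/cvgrPdist_le => e e0.
have [_ [k /= k0 <-] hk] := inf_adherent (divr_gt0 e0 (ltr0n _ 2)) hS.
have k0' : 0 < k%:R :> R by rewrite ltr0n.
pose B := k%:R * a 1%N + a 0%N.
have hr r : (r < k)%N -> a r <= B.
  move=> rk; have := subadd_mul a sub 1 r 0; rewrite muln1 addn0 => /le_trans; apply.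
  by rewrite lerD2r ler_wpM2r // ler_nat ltnW.
exists (Num.truncn (B / (e / 2))).+1 => //= n hn.
have n0 : (0 < n)%N by rewrite (leq_trans _ hn).
have n0' : 0 < n%:R :> R by rewrite ltr0n.
rewrite ler_distlC; apply/andP; split; first by rewrite lerBlDr (le_trans (lb n n0)) // lerDl ltW.
have h1 : n%:R^-1 * a n <= k%:R^-1 * a k + n%:R^-1 * B.
  rewrite ler_pdivrMl // mulrDr mulVKf ?gt_eqF // [X in a X <= _](divn_eq n k).
  apply: le_trans (subadd_mul a sub k _ _) _; rewrite lerD ?hr ?ltn_mod // mulrA ler_wpM2r //.
  by rewrite ler_pdivlMr // -natrM ler_nat leq_divM.
have h2 : n%:R^-1 * B <= e / 2.
  rewrite ler_pdivrMl // -ler_pdivrMr ?divr_gt0 //.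
  by apply/ltW/(lt_le_trans (truncnS_gt _)); rewrite ler_nat.
by move: h1 h2 hk; lra.
Qed.
End subadditive.

Section entropy.
Context {R : realType} {d : measure_display} {T : measurableType d}.
Implicit Types mu : probability T R.

(** Measurability of a function with finitely many values. *)
Definition mfin (I : finType) (X : T -> I) := forall i, measurable (X @^-1` [set i]).

Definition pr mu (I : finType) (X : T -> I) i : R := fine (mu (X @^-1` [set i])).

Arguments mfin {I} X.
Arguments pr mu {I} X i.

Definition ent mu (I : finType) (X : T -> I) : R := - \sum_i pr mu X i * ln (pr mu X i).

Arguments ent mu {I} X.

Lemma pr_ge0 mu (I : finType) (X : T -> I) i : 0 <= pr mu X i.
Proof. by rewrite /pr fine_ge0. Qed.

Lemma mfin_comp (I J : finType) (X : T -> I) (g : I -> J) : mfin X -> mfin (g \o X).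
Proof.
move=> mX j.
have -> : (g \o X) @^-1` [set j] = \bigcup_(i in [set i | g i = j]) X @^-1` [set i].
  by apply/seteqP; split=> [x /= h|x [i /= h e]]; [by exists (X x)|by rewrite /= e].
by apply: fin_bigcup_measurable => [|i _]; [exact: finite_finset|exact: mX].
Qed.

Lemma mfin_pair (I J : finType) (X : T -> I) (Y : T -> J) : mfin X -> mfin Y ->
  mfin (fun x => (X x, Y x)).
Proof.
move=> mX mY [i j].
have -> : (fun x => (X x, Y x)) @^-1` [set (i, j)] = (X @^-1` [set i]) `&` (Y @^-1` [set j]).
  by apply/seteqP; split=> [x /= [-> ->]|x /= [-> ->]].
exact: measurableI.
Qed.

Lemma mfin_ffun (I J : finType) (X : I -> T -> J) : (forall i, mfin (X i)) ->
  mfin (fun x => [ffun i => X i x]).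
Proof.
move=> mX w.
have -> : (fun x => [ffun i => X i x]) @^-1` [set w] = \bigcap_(i in [set: I]) (X i @^-1` [set w i]).
  apply/seteqP; split=> [x /= <- i _ /=|x h /=]; first by rewrite ffunE.
  by apply/ffunP => i; rewrite ffunE; exact: h.
by apply: fin_bigcap_measurable => [|i _]; [exact: finite_finset|exact: mX].
Qed.

Lemma mfin_bmf (I : finType) (X : T -> I) (F : I -> R) : mfin X -> bmf (fun x => F (X x)).
Proof.
move=> mX; rewrite (_ : (fun x => F (X x)) = fun x => \sum_i F i * \1_(X @^-1` [set i]) x).
  by apply: bmf_sum => i; apply: bmfZ; exact: bmf_indic.
apply/funext => x; rewrite (bigD1 (X x)) //= big1 => [|i ine].
  by rewrite addr0 indicE mem_set // mulr1.
by rewrite indicE memNset ?mulr0 // => /= h; rewrite h eqxx in ine.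
Qed.

Lemma Int_mfin mu (I : finType) (X : T -> I) (F : I -> R) : mfin X ->
  \int[mu]_x F (X x) = \sum_i pr mu X i * F i.
Proof.
move=> mX; rewrite (_ : (fun x => F (X x)) = fun x => \sum_i F i * \1_(X @^-1` [set i]) x); last first.
  apply/funext => x; rewrite (bigD1 (X x)) //= big1 => [|i ine].
    by rewrite addr0 indicE mem_set // mulr1.
  by rewrite indicE memNset ?mulr0 // => /= h; rewrite h eqxx in ine.
rewrite Int_sum; last by move=> i; apply: bmfZ; exact: bmf_indic.
by apply: eq_bigr => i _; rewrite IntZ ?Int_indic 1?mulrC //; exact: bmf_indic.
Qed.

Lemma sum_pr mu (I : finType) (X : T -> I) : mfin X -> \sum_i pr mu X i = 1.
Proof.
by move=> mX; rewrite -(Int_cst mu 1) (Int_mfin mu _ X (fun=> 1)) //; apply: eq_bigr => i _; rewrite mulr1.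
Qed.

Lemma pr_le1 mu (I : finType) (X : T -> I) i : mfin X -> pr mu X i <= 1.
Proof.
move=> mX; rewrite -(sum_pr mu _ X) // (bigD1 i) //= lerDl sumr_ge0 // => j _; exact: pr_ge0.
Qed.

Lemma pr_comp mu (I J : finType) (X : T -> I) (g : I -> J) j : mfin X ->
  pr mu (g \o X) j = \sum_i pr mu X i * (g i == j)%:R.
Proof.
move=> mX; rewrite -(Int_mfin mu _ X (fun i => (g i == j)%:R)) //.
rewrite /pr -Int_indic; last exact: mfin_comp.
apply: eq_Rintegral => x _; rewrite indicE; case: eqP => h; first by rewrite mem_set.
by rewrite memNset.
Qed.

Lemma ent_ge0 mu (I : finType) (X : T -> I) : mfin X -> 0 <= ent mu X.
Proof.
move=> mX; rewrite /ent -sumrN sumr_ge0 // => i _.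
by rewrite oppr_ge0 mulr_ge0_le0 ?pr_ge0 // ln_le0 // pr_le1.
Qed.

(** Gibbs' inequality, from ln x <= x - 1. *)
Lemma gibbs mu (I : finType) (X : T -> I) (r : I -> R) : mfin X ->
  (forall i, 0 <= r i) -> (forall i, pr mu X i != 0 -> 0 < r i) -> \sum_i r i <= 1 ->
  ent mu X <= - \sum_i pr mu X i * ln (r i).
Proof.
move=> mX r0 rp r1; rewrite /ent lerN2 -subr_ge0 -sumrB.
apply: (@le_trans _ _ (\sum_i (pr mu X i - r i))); first by rewrite sumrB sum_pr // subr_ge0.
apply: ler_sum => i _; have [p0|p0] := eqVneq (pr mu X i) 0.
  by rewrite p0 !mul0r subrr sub0r oppr_le0.
have pp : 0 < pr mu X i by rewrite lt_def p0 pr_ge0.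
have ri := rp i p0.
have e : pr mu X i * (r i / pr mu X i) = r i by rewrite mulrCA divff // mulr1.
have : ln (1 + (r i / pr mu X i - 1)) <= r i / pr mu X i - 1.
  by apply: le_ln1Dx; rewrite ltrBrDl subrr divr_gt0.
rewrite (_ : 1 + _ = r i / pr mu X i); last by ring.
rewrite ln_div ?posrE // => h.
have : pr mu X i * (ln (r i) - ln (pr mu X i)) <= pr mu X i * (r i / pr mu X i - 1) by rewrite ler_wpM2l // ltW.
by rewrite [X in _ <= X]mulrBr e; lra.
Qed.

Lemma ent_comp mu (I J : finType) (X : T -> I) (g : I -> J) : mfin X ->
  ent mu (g \o X) <= ent mu X.
Proof.
move=> mX; rewrite /ent lerN2.
rewrite [leRHS](eq_bigr (fun j => \sum_i pr mu X i * (g i == j)%:R * ln (pr mu (g \o X) j))); last first.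
  by move=> j _; rewrite -mulr_suml -pr_comp.
rewrite exchange_big /=; apply: ler_sum => i _.
rewrite (bigD1 (g i)) //= big1 => [|j jne]; last by rewrite eq_sym (negbTE jne) mulr0 mul0r.
rewrite eqxx mulr1 addr0; have [->|p0] := eqVneq (pr mu X i) 0; first by rewrite !mul0r.
have pp : 0 < pr mu X i by rewrite lt_def p0 pr_ge0.
rewrite ler_wpM2l ?pr_ge0 // ler_ln ?posrE //.
  rewrite pr_comp // (bigD1 i) //= eqxx mulr1 lerDl sumr_ge0 // => k _.
  by rewrite mulr_ge0 // pr_ge0.
rewrite (lt_le_trans pp) // pr_comp // (bigD1 i) //= eqxx mulr1 lerDl sumr_ge0 // => k _.
by rewrite mulr_ge0 // pr_ge0.
Qed.

Lemma sum_pair (I J : finType) (F : I * J -> R) : \sum_z F z = \sum_i \sum_j F (i, j).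
Proof. by rewrite pair_bigA /=; apply: eq_bigr => -[]. Qed.

(** [gibbs] against the product distribution. *)
Lemma ent_pair mu (I J : finType) (X : T -> I) (Y : T -> J) : mfin X -> mfin Y ->
  ent mu (fun x => (X x, Y x)) <= ent mu X + ent mu Y.
Proof.
move=> mX mY; have mXY := mfin_pair _ _ X Y mX mY.
set Z := fun x => (X x, Y x).
have p1 i : pr mu X i = \sum_j pr mu Z (i, j).
  rewrite (_ : pr mu X i = pr mu (fst \o Z) i) // pr_comp // sum_pair /=.
  rewrite (bigD1 i) //= [X in _ + X]big1 => [|k kne]; last by rewrite big1 // => j _; rewrite (negbTE kne) mulr0.
  by rewrite addr0; apply: eq_bigr => j _; rewrite eqxx mulr1.
have p2 j : pr mu Y j = \sum_i pr mu Z (i, j).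
  rewrite (_ : pr mu Y j = pr mu (snd \o Z) j) // pr_comp // sum_pair /=.
  apply: eq_bigr => i _; rewrite (bigD1 j) //= [X in _ + X]big1 => [|k kne]; last by rewrite (negbTE kne) mulr0.
  by rewrite eqxx mulr1 addr0.
have le1 i j : pr mu Z (i, j) <= pr mu X i.
  by rewrite p1 (bigD1 j) //= lerDl sumr_ge0 // => k _; exact: pr_ge0.
have le2 i j : pr mu Z (i, j) <= pr mu Y j.
  by rewrite p2 (bigD1 i) //= lerDl sumr_ge0 // => k _; exact: pr_ge0.
apply: le_trans (gibbs mu _ Z (fun z => pr mu X z.1 * pr mu Y z.2) mXY _ _ _) _.
- by move=> z; rewrite mulr_ge0 ?pr_ge0.
- move=> [i j] p0; have pp : 0 < pr mu Z (i, j) by rewrite lt_def p0 pr_ge0.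
  by rewrite mulr_gt0 // (lt_le_trans pp).
- rewrite sum_pair /=.
  by under eq_bigr do rewrite -mulr_sumr sum_pr // mulr1; rewrite sum_pr.
- rewrite /ent -opprD lerN2 sum_pair /=.
  rewrite (eq_bigr (fun i => \sum_j pr mu Z (i, j) * ln (pr mu X i))); last by move=> i _; rewrite -mulr_suml -p1.
  rewrite [X in _ + X](eq_bigr (fun j => \sum_i pr mu Z (i, j) * ln (pr mu Y j))); last by move=> i _; rewrite -mulr_suml -p2.
  rewrite [X in _ + X]exchange_big /= -big_split /=; apply: ler_sum => i _.
  rewrite -big_split /=; apply: ler_sum => j _.
  have [->|p0] := eqVneq (pr mu Z (i, j)) 0; first by rewrite !mul0r addr0.
  have pp : 0 < pr mu Z (i, j) by rewrite lt_def p0 pr_ge0.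
  by rewrite lnM ?mulrDr // posrE (lt_le_trans pp).
Qed.

Lemma pr_inv mu (I : finType) (X : T -> I) (g : T -> T) i : mfin X ->
  (forall A, measurable A -> mu (g @^-1` A) = mu A) -> pr mu (X \o g) i = pr mu X i.
Proof. by move=> mX hg; rewrite /pr comp_preimage hg. Qed.

Lemma ent_inv mu (I : finType) (X : T -> I) (g : T -> T) : mfin X ->
  (forall A, measurable A -> mu (g @^-1` A) = mu A) -> ent mu (X \o g) = ent mu X.
Proof.
by move=> mX hg; rewrite /ent; congr (- _); apply: eq_bigr => i _; rewrite pr_inv.
Qed.

(** Subadditivity of entropy, applied coordinate by coordinate. *)
Lemma ent_ffun mu (J : finType) n (X : 'I_n -> T -> J) (B : R) : (forall i, mfin (X i)) ->
  (forall i, ent mu (X i) <= B) -> ent mu (fun x => [ffun i => X i x]) <= n%:R * B.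
Proof.
elim: n X => [|n IH] X mX hB.
  rewrite mul0r /ent oppr_le0 sumr_ge0 // => w _.
  have -> : pr mu (fun x => [ffun i => X i x]) w = 1.
    have := sum_pr mu _ _ (mfin_ffun _ _ X mX); rewrite (bigD1 w) //= big1 ?addr0 // => v /eqP[].
    by apply/ffunP => -[].
  by rewrite ln1 mulr0.
pose Y x := ([ffun i : 'I_n => X (widen_ord (leqnSn n) i) x], X ord_max x).
pose g (z : {ffun 'I_n -> J} * J) : {ffun 'I_n.+1 -> J} :=
  [ffun i => if unlift ord_max i is Some j then z.1 j else z.2].
have -> : (fun x => [ffun i => X i x]) = g \o Y.
  apply/funext => x; apply/ffunP => i; rewrite !ffunE /=.
  case: unliftP => [j ->|-> //]; rewrite ffunE; congr (X _ x); apply: val_inj => /=.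
  by rewrite /bump leqNgt ltn_ord add0n.
have m1 : mfin (fun x => [ffun i : 'I_n => X (widen_ord (leqnSn n) i) x]) by apply: mfin_ffun.
apply: le_trans (ent_comp _ _ _ _ _ _) _; first exact: mfin_pair.
apply: le_trans (ent_pair _ _ _ _ _ _ _) _ => //.
by rewrite -natr1 mulrDl mul1r lerD // IH.
Qed.

End entropy.

Arguments mfin {d T I} X.
Arguments pr {R d T} mu {I} X i.
Arguments ent {R d T} mu {I} X.

(** * Itineraries and metric entropy *)

Section itineraries.
Context {R : realType}.
Local Notation T2 := (torus R).
Implicit Types mu nu : probability T2 R.

Definition word (I : finType) (f : T2 -> T2) (xi : T2 -> I) n (x : T2) : {ffun 'I_n -> I} :=
  [ffun i : 'I_n => xi (iter i f x)].
Arguments word {I} f xi n x.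

Lemma iter_meas (f : T2 -> T2) n : measurable_fun setT f -> measurable_fun setT (iter n f).
Proof.
move=> mf; elim: n => [|n IH] /=; first exact: measurable_id.
exact: (measurableT_comp mf IH).
Qed.

Lemma mfin_iter (I : finType) (f : T2 -> T2) (xi : T2 -> I) n : measurable_fun setT f -> mfin xi ->
  mfin (fun x => xi (iter n f x)).
Proof.
move=> mf mx i; rewrite -[X in measurable X]setTI.
exact: (iter_meas f n mf measurableT (xi @^-1` [set i]) (mx i)).
Qed.

Lemma mfin_word (I : finType) (f : T2 -> T2) (xi : T2 -> I) n : measurable_fun setT f -> mfin xi ->
  mfin (word f xi n).
Proof. by move=> mf mx; apply: mfin_ffun => i; exact: mfin_iter. Qed.

Lemma iter_inv (f : T2 -> T2) mu n A : measurable_fun setT f -> Defs.invariant f mu -> measurable A ->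
  mu (iter n f @^-1` A) = mu A.
Proof.
move=> mf hf; elim: n A => [|n IH] A mA //.
have -> : iter n.+1 f @^-1` A = iter n f @^-1` (f @^-1` A) by apply/seteqP; split.
by rewrite IH ?hf // -[X in measurable X]setTI; exact: (mf measurableT).
Qed.

Lemma partition_entropyE f mu m (xi : T2 -> 'I_m) n :
  partition_entropy f mu xi n = ent mu (word f xi n).
Proof.
rewrite /partition_entropy /ent; congr (- _); apply: eq_bigr => w _.
have -> : fine (mu (atom f xi w)) = pr mu (word f xi n) w; last by [].
congr (fine (mu _)); apply/seteqP; split=> [x h|x /= <- i] /=; last by rewrite ffunE.
by apply/ffunP => i; rewrite ffunE; exact: h.
Qed.

Lemma ent_word_sub f mu (I : finType) (xi : T2 -> I) a b : measurable_fun setT f -> Defs.invariant f mu -> mfin xi ->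
  ent mu (word f xi (a + b)) <= ent mu (word f xi a) + ent mu (word f xi b).
Proof.
move=> mf hf mx.
pose Y x := (word f xi a x, word f xi b (iter a f x)).
pose g (z : {ffun 'I_a -> I} * {ffun 'I_b -> I}) : {ffun 'I_(a + b) -> I} :=
  [ffun i => match fintype.split i with inl j => z.1 j | inr j => z.2 j end].
have -> : word f xi (a + b) = g \o Y.
  apply/funext => x; apply/ffunP => i; rewrite !ffunE /=.
  by case: splitP => j ->; rewrite ffunE // addnC iterD.
have mb : mfin (fun x => word f xi b (iter a f x)) by apply: mfin_iter => //; exact: mfin_word.
have ma := mfin_word _ f xi a mf mx.
apply: le_trans (ent_comp _ _ _ _ _ _) _; first exact: mfin_pair.
apply: le_trans (ent_pair _ _ _ _ _ _ _) _ => //.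
rewrite lerD2l (ent_inv mu _ (word f xi b) (iter a f)) //; first exact: mfin_word.
by move=> A mA; apply: iter_inv.
Qed.

Lemma entropy_rate f mu m (xi : T2 -> 'I_m) : measurable_fun setT f -> Defs.invariant f mu -> mfin xi ->
  cvgn (fun n => n%:R^-1 * partition_entropy f mu xi n) /\
  forall n, (0 < n)%N -> limn (fun n => n%:R^-1 * partition_entropy f mu xi n) <= n%:R^-1 * ent mu (word f xi n).
Proof.
move=> mf hf mx.
have [h1 h2] := @fekete R (partition_entropy f mu xi)
  (ltac:(by move=> n; rewrite partition_entropyE; apply: ent_ge0; exact: mfin_word))
  (ltac:(by move=> a b; rewrite !partition_entropyE; exact: ent_word_sub)).
by split=> // n n0; rewrite -partition_entropyE; exact: h2.
Qed.

(** By subadditivity a single n bounds the entropy of each partition. *)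
Lemma metric_entropy_le f mu (c : R) : measurable_fun setT f -> Defs.invariant f mu ->
  (forall m (xi : T2 -> 'I_m) (e : R), mfin xi -> 0 < e ->
     exists2 n, (0 < n)%N & n%:R^-1 * ent mu (word f xi n) <= c + e) ->
  (metric_entropy f mu <= c%:E)%E.
Proof.
move=> mf hf h; apply: ge_ereal_sup => _ [m [xi [mx ->]]]; rewrite lee_fin.
apply/ler_addgt0Pr => e e0; have [n n0 hn] := h m xi e mx e0.
exact: le_trans ((entropy_rate f mu m xi mf hf mx).2 n n0) hn.
Qed.

Lemma metric_entropy_ge f mu m (xi : T2 -> 'I_m) (c C : R) : measurable_fun setT f -> Defs.invariant f mu ->
  mfin xi -> (forall n, n%:R * c - C <= ent mu (word f xi n)) -> (c%:E <= metric_entropy f mu)%E.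
Proof.
move=> mf hf mx h; apply: (@le_trans _ _ (limn (fun n => n%:R^-1 * partition_entropy f mu xi n))%:E); last first.
  by apply: ereal_sup_ubound; exists m, xi.
have [cv _] := entropy_rate f mu m xi mf hf mx.
rewrite lee_fin; apply/ler_addgt0Pl => e e0; rewrite addrC -lerBlDr.
apply: limr_ge => //; exists (Num.truncn (`|C| / e)).+1 => //= n hn.
have n0 : 0 < n%:R :> R by rewrite ltr0n (leq_trans _ hn).
rewrite partition_entropyE ler_pdivlMl //; apply: le_trans (h n); rewrite mulrBr lerD2l lerN2.
rewrite (le_trans (ler_norm _)) // -ler_pdivrMr //.
by apply/ltW/(lt_le_trans (truncnS_gt _)); rewrite ler_nat.
Qed.

(** A partition for f pulls back by the semiconjugacy p to one for g with the
    same distribution of itineraries. *)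
Lemma metric_entropy_conj f g mu nu (p : T2 -> T2) : measurable_fun setT p -> measurable_fun setT f ->
  (forall x, p (g x) = f (p x)) -> (forall A, measurable A -> nu A = mu (p @^-1` A)) ->
  (metric_entropy f nu <= metric_entropy g mu)%E.
Proof.
move=> mp mf hp hnu; apply: ge_ereal_sup => _ [m [xi [mx ->]]].
apply: ereal_sup_ubound; exists m, (xi \o p); split.
  move=> i; rewrite -[X in measurable X]setTI; exact: (mp measurableT (xi @^-1` [set i]) (mx i)).
congr (limn _)%:E; apply/funext => n; congr (_ * _).
rewrite !partition_entropyE /ent; congr (- _); apply: eq_bigr => w _.
have hi i x : p (iter i g x) = iter i f (p x) by elim: i => [//|i IH] /=; rewrite hp IH.
have -> : pr nu (word f xi n) w = pr mu (word g (xi \o p) n) w; last by [].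
rewrite /pr hnu.
  congr (fine (mu _)); apply/seteqP; split=> x /= <-; apply/ffunP => i;
    by rewrite !ffunE /= hi.
exact: mfin_word.
Qed.

End itineraries.

Arguments word {R I} f xi n x.

(** * Grid partitions *)

Section grid_partition.
Context {R : realType}.
Local Notation T2 := (torus R).
Local Notation lam := (lam R).
Implicit Types mu nu : probability T2 R.

Lemma td_std (z : 'rV[R]_2) y e : td (tproj z) y < e ->
  exists w, y = tproj w /\ forall j, `|z 0 j - w 0 j| < e.
Proof.
have [a [b [ez _ _]]] := pt_surj_z z; rewrite ez -/(pt a b) => /td_lt_lift[a' [b' [-> h]]].
exists (a' *: eigen_u R + b' *: eigen_s R); split=> //.
have := @al_bounds R; set al := lam - 2 => /andP[al1 al2].
have h1 (t : R) : `|al * t| <= `|t| by rewrite normrM (gtr0_norm (_ : 0 < al)) ?ler_piMl //; lra.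
apply: ord2P; rewrite ?eig0 ?eig1.
  rewrite (_ : _ - _ = (a - a') - al * (b - b')); last by rewrite /al; ring.
  by rewrite (le_lt_trans (ler_normB _ _)) // (le_lt_trans _ h) // lerD2l h1.
rewrite (_ : _ - _ = al * (a - a') + (b - b')); last by rewrite /al; ring.
by rewrite (le_lt_trans (ler_normD _ _)) // (le_lt_trans _ h) // lerD2r h1.
Qed.

Lemma std_td (z w : 'rV[R]_2) e : (forall j, `|z 0 j - w 0 j| < e) -> td (tproj z) (tproj w) < 4 * e.
Proof.
move=> zw; have [a [b [ez ea eb]]] := pt_surj_z z; have [a' [b' [ew ea' eb']]] := pt_surj_z w.
have h0 := zw 0; have h1 := zw 1.
have := @al_bounds R; move: ea eb ea' eb'; set al := lam - 2 => ea eb ea' eb' /andP[al1 al2].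
rewrite ez ew -/(pt a b) -/(pt a' b'); apply: le_lt_trans (td_pt _ _ _ _) _.
have al3 : 1 <= 1 + al ^+ 2 by rewrite lerDl sqr_ge0.
have ha : `|a - a'| < 2 * e.
  rewrite ea ea' -mulrBl normrM (gtr0_norm (_ : 0 < (1 + al ^+ 2)^-1)) ?invr_gt0; try lra.
  rewrite ltr_pdivrMr; last lra.
  move: h0 h1; rewrite !ltr_norml; nra.
have hb : `|b - b'| < 2 * e.
  rewrite eb eb' -mulrBl normrM (gtr0_norm (_ : 0 < (1 + al ^+ 2)^-1)) ?invr_gt0; try lra.
  rewrite ltr_pdivrMr; last lra.
  move: h0 h1; rewrite !ltr_norml; nra.
lra.
Qed.

(** Open squares of side 2 / (l + 1) about the points of the grid of mesh
    1 / (l + 1); they overlap and cover the torus. *)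
Definition gcell l (p : 'I_l.+1 * 'I_l.+1) : set T2 :=
  [set x | exists z, [/\ tproj z = x, `|z 0 0 - p.1%:R / l.+1%:R| < l.+1%:R^-1 &
                          `|z 0 1 - p.2%:R / l.+1%:R| < l.+1%:R^-1]].

Lemma gcell_open l p : open (gcell l p).
Proof.
apply/open_tdP => x [z [<- h0 h1]].
exists (Num.min (l.+1%:R^-1 - `|z 0 0 - p.1%:R / l.+1%:R|) (l.+1%:R^-1 - `|z 0 1 - p.2%:R / l.+1%:R|)).
  by rewrite lt_min !subr_gt0 h0 h1.
move=> y /td_std[w [-> hw]]; exists w; split => //.
  have := hw 0; rewrite lt_min ltrBrDr => /andP[h _]; apply: le_lt_trans h.
  by apply: le_trans (ler_distD (z 0 0) _ _) _; rewrite (distrC (w 0 0)).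
have := hw 1; rewrite lt_min => /andP[_]; rewrite ltrBrDr => h; apply: le_lt_trans h.
by apply: le_trans (ler_distD (z 0 1) _ _) _; rewrite (distrC (w 0 1)).
Qed.

Lemma frac_grid l (t : R) : exists (k : 'I_l.+1) (n : int), 0 <= t - n%:~R - k%:R / l.+1%:R < l.+1%:R^-1.
Proof.
have l0 : 0 < l.+1%:R :> R by [].
set N := Num.floor (l.+1%:R * t).
have hN : N = (N %/ l.+1)%Z * l.+1 + (N %% l.+1)%Z by exact: divz_eq.
have r0 : 0 <= (N %% l.+1)%Z by exact: modz_ge0.
have r1 : (N %% l.+1)%Z < l.+1 by exact: ltz_pmod.
exists (inord `|(N %% l.+1)%Z|%N), (N %/ l.+1)%Z.
have -> : ((inord `|(N %% l.+1)%Z|%N : 'I_l.+1) : nat)%:R = ((N %% l.+1)%Z)%:~R :> R.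
  rewrite inordK; last by lia.
  by rewrite -[in RHS](gez0_abs r0).
have /andP[h1 h2] : N%:~R <= l.+1%:R * t < (N + 1)%:~R by rewrite floor_le_tmp floorD1_gt.
have e : l.+1%:R * (t - (N %/ l.+1)%Z%:~R - (N %% l.+1)%Z%:~R / l.+1%:R) = l.+1%:R * t - N%:~R.
  have hNR : N%:~R = (N %/ l.+1)%Z%:~R * l.+1%:R + (N %% l.+1)%Z%:~R :> R by rewrite {1}hN intrD intrM.
  rewrite hNR; field; by rewrite gt_eqF.
rewrite -(pmulr_rge0 _ l0) e subr_ge0 h1 /= -(ltr_pM2l l0) e divff ?gt_eqF //.
by rewrite ltrBlDl -[X in _ + X]/(1%:~R) -intrD.
Qed.

Lemma gcell_cover l x : exists p, gcell l p x.
Proof.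
set z := trepr x.
have [k0 [n0 h0]] := frac_grid l (z 0 0); have [k1 [n1 h1]] := frac_grid l (z 0 1).
exists (k0, k1), (\row_j (z 0 j - (if j == 0 then n0 else n1)%:~R)); split.
- rewrite -[RHS]tproj_trepr; apply/tproj_eq => j; rewrite mxE addrAC subrr sub0r rpredN.
  exact: intr_int.
- by rewrite mxE /= ger0_norm; case/andP: h0.
- by rewrite mxE /= ger0_norm; case/andP: h1.
Qed.

(** A partition subordinate to the cover by the squares gcell. *)
Definition gpart l (x : T2) : 'I_l.+1 * 'I_l.+1 :=
  odflt (ord0, ord0) [pick p | `[< gcell l p x >]].

Lemma gpartP l x : gcell l (gpart l x) x.
Proof.
rewrite /gpart; case: pickP => [p /asboolP //|h].
by have [p hp] := gcell_cover l x; have := h p; rewrite asboolT.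
Qed.

Lemma gpart_mfin l : mfin (gpart l).
Proof.
pose B x := [ffun p => `[< gcell l p x >]].
have -> : gpart l = (fun b : {ffun 'I_l.+1 * 'I_l.+1 -> bool} => odflt (ord0, ord0) [pick p | b p]) \o B.
  by apply/funext => x; rewrite /gpart /=; congr odflt; apply: eq_pick => p; rewrite ffunE.
apply: mfin_comp; apply: mfin_ffun => p.
have mc : measurable (gcell l p) by apply: open_meas; exact: gcell_open.
case.
  have -> : (fun x => `[< gcell l p x >]) @^-1` [set true] = gcell l p; last exact: mc.
  by apply/seteqP; split=> x /= /asboolP.
have -> : (fun x => `[< gcell l p x >]) @^-1` [set false] = ~` gcell l p; last exact: measurableC.
apply/seteqP; split=> x /= => [h|/asboolPn/negbTE //]; by apply/asboolPn; rewrite h.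
Qed.

Lemma dist2 (x c y i : R) : `|x - c| < i -> `|y - c| < i -> `|x - y| < 2 * i.
Proof. by rewrite !ltr_norml; lra. Qed.

Lemma addlt2 (x y i : R) : `|x| < i -> `|y| < i -> `|x + y| < 2 * i.
Proof. by rewrite !ltr_norml; lra. Qed.

Lemma gcell_diam l p x y : gcell l p x -> gcell l p y -> td x y < 8 * l.+1%:R^-1.
Proof.
move=> [z [<- z0 z1]] [w [<- w0 w1]].
rewrite (_ : 8 * _ = 4 * (2 * l.+1%:R^-1)); last by ring.
apply: std_td; apply: ord2P.
  exact: dist2 _ _ _ _ z0 w0.
exact: dist2 _ _ _ _ z1 w1.
Qed.

Lemma grid_near l (t : R) : exists s : 'I_4 -> 'I_l.+1, forall (k : 'I_l.+1) (n : int),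
  `|t - n%:~R - k%:R / l.+1%:R| < 2 * l.+1%:R^-1 -> exists c, k = s c.
Proof.
have l0 : 0 < l.+1%:R :> R by [].
set N := Num.floor (l.+1%:R * t).
have /andP[f1 f2] : N%:~R <= l.+1%:R * t < (N + 1)%:~R by rewrite floor_le_tmp floorD1_gt.
exists (fun c => inord `|((N - 1 + c%:Z) %% l.+1)%Z|%N) => k n h.
pose K : int := k%:Z + n * l.+1.
have hK : `|l.+1%:R * t - K%:~R| < 2.
  have -> : l.+1%:R * t - K%:~R = l.+1%:R * (t - n%:~R - k%:R / l.+1%:R).
    by rewrite /K intrD intrM !mulrBr [l.+1%:R * (_ / _)]mulrCA divff ?gt_eqF // mulr1 /=; ring.
  by rewrite normrM gtr0_norm // -ltr_pdivlMl // [X in _ < X]mulrC.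
have [k1 k2] : N - 2 < K /\ K < N + 3.
  move: hK; rewrite ltr_norml => /andP[h1 h2]; split.
    by rewrite -(ltr_int R) intrB; move: f1 h2 => /=; lra.
  by rewrite -(ltr_int R) intrD; move: f2 h1 => /=; rewrite intrD /=; lra.
have c4 : (`|(K - N + 1)%R|%N < 4)%N by lia.
exists (Ordinal c4); apply: val_inj => /=.
have -> : N - 1 + (`|(K - N + 1)%R|%N)%:Z = K by lia.
rewrite /K addrC modzMDl modz_small ?inordK //=; by rewrite ltz_nat ltn_ord.
Qed.

(** Only boundedly many squares come near a given point, whatever l; this is
    what makes ball counts independent of the mesh. *)
Lemma gpart_near l x : exists S : {set 'I_l.+1 * 'I_l.+1}, (#|S| <= 16)%N /\
  forall y, td x y < l.+1%:R^-1 -> gpart l y \in S.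
Proof.
set z := trepr x.
have [s0 h0] := grid_near l (z 0 0); have [s1 h1] := grid_near l (z 0 1).
exists [set (s0 c.1, s1 c.2) | c : 'I_4 * 'I_4]; split.
  by rewrite (leq_trans (leq_imset_card _ _)) // card_prod !card_ord.
move=> y; rewrite -[x]tproj_trepr => /td_std[w [ew hw]].
have := gpartP l y; set p := gpart l y => -[w' [ew' w0 w1]].
have /tproj_eq hi : tproj w = tproj w' by rewrite ew' -ew.
have hj j (k : 'I_l.+1) : `|w' 0 j - k%:R / l.+1%:R| < l.+1%:R^-1 -> exists n : int,
    `|z 0 j - n%:~R - k%:R / l.+1%:R| < 2 * l.+1%:R^-1.
  move=> h; have /intrP[n en] := hi j; exists n; rewrite -en.
  rewrite (_ : _ - _ - _ = (z 0 j - w 0 j) + (w' 0 j - k%:R / l.+1%:R)); last by ring.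
  exact: addlt2 _ _ _ (hw j) h.
have [n0 hn0] := hj 0 p.1 w0; have [n1 hn1] := hj 1 p.2 w1.
have [c0 ec0] := h0 _ _ hn0; have [c1 ec1] := h1 _ _ hn1.
by apply/imsetP; exists (c0, c1) => //=; rewrite -ec0 -ec1; case: (p).
Qed.

Lemma bmf_abs d (T : measurableType d) (f : T -> R) : bmf f -> bmf (fun x => `|f x|).
Proof.
move=> [mf [C hC]]; split; last by exists C => x; rewrite normr_id.
exact: measurableT_comp.
Qed.

(** Measure of the symmetric difference of B and a union of cells of the grid
    partition. *)
Definition err mu (B : set T2) l (S : pred ('I_l.+1 * 'I_l.+1)) : R :=
  \int[mu]_x `|\1_B x - (S (gpart l x))%:R|.

Lemma err_bmf B l (S : pred ('I_l.+1 * 'I_l.+1)) : measurable B ->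
  bmf (fun x => `|\1_B x - (S (gpart l x))%:R| : R).
Proof.
move=> mB; apply: bmf_abs; apply: bmfD; first exact: bmf_indic.
exact: (mfin_bmf _ (gpart l) (fun p => - (S p)%:R) (gpart_mfin l)).
Qed.

Definition approximable mu (B : set T2) := measurable B /\ forall e : R, 0 < e ->
  exists l0, forall l, (l0 <= l)%N -> exists S, err mu B l S <= e.

Lemma compl_dist_approx mu O (e : R) : open O -> 0 < e ->
  exists n, fine (mu O) <= fine (mu [set x | n.+1%:R^-1 < compl_dist O x]) + e.
Proof.
move=> oO e0; pose F n := [set x | n.+1%:R^-1 < compl_dist O x].
have oF n : open (F n).
  by apply: (@open_comp _ _ (compl_dist O) [set r : R | n.+1%:R^-1 < r]); [move=> x _; exact: compl_dist_cts|exact: open_gt].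
have FO : \bigcup_n F n = O.
  apply/seteqP; split=> [x [n _ /=]|x Ox].
    by move=> lt; apply: contrapT => /compl_dist_out ex; move: lt; rewrite /F /= ex invr_lt0 ltrn0.
  have /ltr_add_invr[n] : 0 < compl_dist O x by exact: compl_dist_gt0.
  by rewrite add0r => hn; exists n.
have cv : mu (F n) @[n --> \oo] --> mu O.
  rewrite -[in X in _ --> X]FO; apply: nondecreasing_cvg_mu.
  - by move=> n; apply: open_meas.
  - by rewrite FO; apply: open_meas.
  - move=> n m nm; apply/subsetPset => x /=; apply: le_lt_trans.
    by rewrite lef_pV2 ?posrE // ler_nat.
have {}cv : fine (mu (F n)) @[n --> \oo] --> fine (mu O).
  by apply: fine_cvg; rewrite fineK // fin_num_measure //; exact: open_meas.
move/cvgrPdist_le : cv => /(_ e e0) [n _ hn]; exists n.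
by have := hn n (leqnn n); rewrite ler_norml /F; lra.
Qed.

(** Cells that are inside O contain all points at distance more than
    8 / (l + 1) from the complement of O. *)
Lemma approximable_open mu O : open O -> approximable mu O.
Proof.
move=> oO; have mO := open_meas _ oO; split=> // e e0.
have [n hn] := compl_dist_approx mu O e oO e0.
exists (8 * n.+1)%N => l hl.
pose S := fun p => `[< forall y, gpart l y = p -> O y >]; exists S.
set F := [set x | n.+1%:R^-1 < compl_dist O x] in hn.
have oF : open F.
  by apply: (@open_comp _ _ (compl_dist O) [set r : R | n.+1%:R^-1 < r]); [move=> x _; exact: compl_dist_cts|exact: open_gt].
have mF := open_meas _ oF.
apply: (@le_trans _ _ (\int[mu]_x (\1_O x + (-1) * \1_F x))).
  apply: Int_le; [exact: err_bmf|by apply: bmfD; [exact: bmf_indic|apply: bmfZ; exact: bmf_indic]|].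
  move=> x; have [Fx|Fx] := pselect (F x).
    have Ox : O x.
      by apply: contrapT => /compl_dist_out ex; move: Fx; rewrite /F /= ex invr_lt0 ltrn0.
    rewrite !indicE !mem_set // mulr1 subrr /S asboolT ?subrr ?normr0 // => y ey.
    apply: contrapT => nOy; move: Fx; rewrite /F /= ltNge => /negP; apply.
    have hd : td x y < 8 * l.+1%:R^-1.
      by apply: (gcell_diam l (gpart l x)); [exact: gpartP|rewrite -ey; exact: gpartP].
    apply: (@le_trans _ _ (td x y)); first by apply: ge_inf; [exact: (compl_dist_has_inf O x).2|right; exists y].
    apply/ltW/(lt_le_trans hd); rewrite ler_pdivrMr // mulrC ler_pdivlMr // -natrM ler_nat.
    by rewrite (leq_trans hl) // leqnSn.
  have -> : \1_F x = 0 :> R by rewrite indicE memNset.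
  rewrite mulr0 addr0.
  have [Ox|Ox] := pselect (O x).
    rewrite !indicE mem_set //; case: (S _) => /=; rewrite ?subrr ?normr0 // subr0 normr1 //.
  rewrite !indicE memNset // /S asboolF ?subrr ?normr0 // => /(_ x erefl) //.
rewrite IntD; [|exact: bmf_indic|by apply: bmfZ; exact: bmf_indic].
by rewrite IntZ ?Int_indic //; [move: hn; lra|exact: bmf_indic].
Qed.

Lemma approximable_setC mu B : approximable mu B -> approximable mu (~` B).
Proof.
move=> [mB h]; split; first exact: measurableC.
move=> e e0; have [l0 hl] := h e e0; exists l0 => l /hl[S hS].
exists (fun p => ~~ S p); rewrite (_ : err _ _ _ _ = err mu B l S) //.
apply: eq_Rintegral => x _; rewrite !indicE in_setC.
by case: (x \in B) => /=; case: (S _) => /=; rewrite ?subr0 ?sub0r ?normrN ?subrr // normr1.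
Qed.

Lemma approximable_setU mu B C : approximable mu B -> approximable mu C -> approximable mu (B `|` C).
Proof.
move=> [mB hB] [mC hC]; split; first exact: measurableU.
move=> e e0; have e20 : 0 < e / 2 by rewrite divr_gt0.
have [l0 hl0] := hB _ e20; have [l1 hl1] := hC _ e20.
exists (maxn l0 l1) => l; rewrite geq_max => /andP[/hl0[S hS] /hl1[S' hS']].
pose SS p := S p || S' p; exists SS.
apply: (@le_trans _ _ (err mu B l S + err mu C l S')); last by move: hS hS'; lra.
rewrite /err -IntD; [|exact: err_bmf|exact: err_bmf].
apply: Int_le; [by apply: err_bmf; exact: measurableU|by apply: bmfD; exact: err_bmf|].
move=> x; rewrite !indicE in_setU /SS.
by case: (x \in B); case: (x \in C); case: (S _); case: (S' _) => /=;
  rewrite ?subr0 ?sub0r ?normrN ?subrr ?normr0 ?normr1 ?addr0 ?add0r // lerDl.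
Qed.

Lemma approximable_bigcup mu (F : nat -> set T2) : (forall n, approximable mu (F n)) -> approximable mu (\bigcup_n F n).
Proof.
move=> hF; have mF n : measurable (F n) by have [] := hF n.
have mU : measurable (\bigcup_n F n) by exact: bigcupT_measurable.
split=> // e e0; have e20 : 0 < e / 2 by rewrite divr_gt0.
pose U n := \bigcup_(i < n) F i.
have apU n : approximable mu (U n).
  elim: n => [|n IH].
    by rewrite /U bigcup_mkord big_ord0 -setCT; apply: approximable_setC; apply: approximable_open; exact: openT.
  by rewrite /U bigcup_mkord big_ord_recr /= -bigcup_mkord; apply: approximable_setU => //; exact: hF.
have mUn n : measurable (U n) by have [] := apU n.
have UF : \bigcup_n U n = \bigcup_n F n.
  apply/seteqP; split=> [x [n _ [i /= _ h]]|x [n _ h]]; first by exists i.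
  by exists n.+1 => //; exists n => /=.
have cv : mu (U n) @[n --> \oo] --> mu (\bigcup_n F n).
  rewrite -UF; apply: nondecreasing_cvg_mu => //; first by rewrite UF.
  move=> n m nm; apply/subsetPset => x [i /= hi h]; exists i => //=; exact: leq_trans hi nm.
have {}cv : fine (mu (U n)) @[n --> \oo] --> fine (mu (\bigcup_n F n)).
  by apply: fine_cvg; rewrite fineK // fin_num_measure.
move/cvgrPdist_le : cv => /(_ _ e20) [n _ /(_ n (leqnn n)) hn].
have [l0 hl0] := (apU n).2 _ e20; exists l0 => l /hl0[S hS]; exists S.
apply: (@le_trans _ _ (err mu (U n) l S + (fine (mu (\bigcup_n F n)) - fine (mu (U n))))); last first.
  by move: hS hn; rewrite ler_norml; lra.
rewrite /err -!Int_indic // -mulN1r -IntZ; last exact: bmf_indic.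
have b1 : bmf (fun x => -1 * \1_(U n) x : R) by apply: bmfZ; exact: bmf_indic.
have b2 := bmf_indic _ mU (R := R).
rewrite -IntD // -IntD; [|exact: err_bmf|exact: bmfD].
apply: Int_le; [exact: err_bmf|by apply: bmfD; [exact: err_bmf|exact: bmfD]|].
move=> x; rewrite !indicE; have [Ux|Ux] := pselect (U n x).
  rewrite (mem_set Ux) mem_set; last by rewrite -UF; exists n.
  by rewrite mulr1 subrr addr0.
by rewrite (memNset Ux) mulr0 addr0 sub0r normrN; case: (x \in _); case: (S _);
  rewrite ?subr0 ?sub0r ?normrN ?subrr ?normr0 ?normr1 ?addr0 ?add0r // lerDl.
Qed.

(** The sets that can be approximated form a sigma-algebra. *)
Lemma approximable_measurable mu B : measurable B -> approximable mu B.
Proof.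
move=> mB; suff : @measurable _ T2 `<=` approximable mu by exact.
apply: smallest_sub; last by move=> O; exact: approximable_open.
split=> [|A hA|F hF]; last exact: approximable_bigcup.
  by apply: approximable_open; exact: open0.
by rewrite setTD; exact: approximable_setC.
Qed.

Lemma appr_partition mu (I : finType) (xi : T2 -> I) (e : R) : mfin xi -> 0 < e ->
  exists l g, \int[mu]_x (xi x != g (gpart l x))%:R <= e.
Proof.
move=> mx e0; set i0 := xi point.
have K0 : 0 < #|I|%:R :> R by rewrite ltr0n; apply/card_gt0P; exists i0.
have /choice[l0 hl0] i : exists l0, forall l, (l0 <= l)%N -> exists S, err mu (xi @^-1` [set i]) l S <= e / #|I|%:R.
  by apply: (approximable_measurable mu _ (mx i)).2; rewrite divr_gt0.
pose l := (\max_i l0 i)%N.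
have /choice[S hS] i : exists S, err mu (xi @^-1` [set i]) l S <= e / #|I|%:R.
  by apply: hl0; exact: leq_bigmax.
pose g p := odflt i0 [pick i | S i p]; exists l, g.
apply: (@le_trans _ _ (\sum_i err mu (xi @^-1` [set i]) l (S i))); last first.
  apply: (@le_trans _ _ (\sum_(i : I) e / #|I|%:R)); first by apply: ler_sum => i _; exact: hS.
  by rewrite sumr_const -(mulr_natl (e / #|I|%:R)) mulrCA divff ?mulr1 // gt_eqF.
rewrite -Int_sum; last by move=> i; exact: err_bmf.
apply: Int_le.
- have := mfin_bmf _ (fun x => (xi x, gpart l x)) (fun z => (z.1 != g z.2)%:R : R); apply.
  by apply: mfin_pair => //; exact: gpart_mfin.
- by apply: bmf_sum => i; exact: err_bmf.
move=> x; case: eqP => [_|ne]; first by rewrite sumr_ge0.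
suff [j hj] : exists j, `|\1_(xi @^-1` [set j]) x - (S j (gpart l x))%:R| = 1 :> R.
  by rewrite (bigD1 j) //= hj lerDl sumr_ge0.
have [Sx|Sx] := boolP (S (xi x) (gpart l x)); last first.
  by exists (xi x); rewrite indicE mem_set // (negbTE Sx) subr0 normr1.
move: ne; rewrite /g; case: pickP => [j Sj|/(_ (xi x))] /=; last by rewrite Sx.
by move=> ne; exists j; rewrite indicE memNset // Sj sub0r normrN normr1.
Qed.

(** The itinerary for xi is determined by the one for the grid partition and by
    the record E of the errors and their values; as errors are rare enough, E
    has entropy at most 2, whatever the number of atoms of xi. *)
Lemma ent_word_grid (f : T2 -> T2) mu (I : finType) (xi : T2 -> I) : measurable_fun setT f ->
  Defs.invariant f mu -> mfin xi ->
  exists l, forall n, ent mu (word f xi n) <= ent mu (word f (gpart l) n) + n%:R * 2.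
Proof.
move=> mf hf mx; set K := #|I|.
have K0 : 0 < K%:R :> R by rewrite ltr0n; apply/card_gt0P; exists (xi point).
have K1 : 0 <= ln K%:R :> R by rewrite ln_ge0 // ler1n -(ltr0n R).
have e0 : 0 < (ln K%:R + 1)^-1 :> R by rewrite invr_gt0; lra.
have [l [g hg]] := appr_partition mu I xi _ mx e0; exists l => n.
pose E x := if xi x == g (gpart l x) then None else Some (xi x).
have mp : mfin (fun x => (xi x, gpart l x)) by apply: mfin_pair => //; exact: gpart_mfin.
have mE : mfin E by exact: (mfin_comp _ _ _ (fun z => if z.1 == g z.2 then None else Some z.1) mp).
have hE : ent mu E <= 2.
  pose r (o : option I) : R := if o is Some _ then (2 * K%:R)^-1 else 2^-1.
  have r0 o : 0 < r o by rewrite /r; case: o => [_|]; rewrite invr_gt0 // mulr_gt0.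
  apply: le_trans (gibbs mu _ E r mE _ _ _) _ => //.
  - by move=> o; exact: ltW.
  - rewrite (bigD1 None) //= (reindex_onto Some (fun o => odflt (xi point) o)) /=; last by case.
    rewrite (eq_bigl xpredT); last by move=> i; rewrite /= eqxx.
    rewrite sumr_const -(mulr_natl (2 * K%:R)^-1) invfM mulrCA divff ?gt_eqF // mulr1; lra.
  have ln2 : ln 2 <= 1 :> R.
    by have := @le_ln1Dx R 1; rewrite (_ : 1 + 1 = 2) //; apply; lra.
  have lr o : ln (r o) = - (ln 2 + (o != None)%:R * ln K%:R).
    rewrite /r; case: o => [i|] /=; last by rewrite mul0r addr0 lnV ?posrE.
    by rewrite mul1r lnV ?lnM ?posrE // mulr_gt0.
  have -> : - (\sum_o pr mu E o * ln (r o)) = ln 2 + ln K%:R * \sum_o pr mu E o * (o != None)%:R.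
    have e1 : ln 2 = \sum_o pr mu E o * ln 2 by rewrite -mulr_suml sum_pr // mul1r.
    rewrite [X in _ = X + _]e1 mulr_sumr -sumrN -big_split /=.
    by apply: eq_bigr => o _; rewrite lr; ring.
  rewrite -(Int_mfin mu _ E (fun o => (o != None)%:R)) //.
  have : \int[mu]_x (E x != None)%:R <= (ln K%:R + 1)^-1 :> R.
    by apply: le_trans hg; rewrite le_eqVlt; apply/orP; left; apply/eqP; apply: eq_Rintegral => x _;
      rewrite /E; case: (xi x == _).
  move=> /(ler_wpM2l K1) h; have : ln K%:R * (ln K%:R + 1)^-1 <= 1 :> R by rewrite ler_pdivrMr; lra.
  by move: h; lra.
pose G (z : {ffun 'I_n -> 'I_l.+1 * 'I_l.+1} * {ffun 'I_n -> option I}) : {ffun 'I_n -> I} :=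
  [ffun i => if z.2 i is Some a then a else g (z.1 i)].
have -> : word f xi n = G \o (fun x => (word f (gpart l) n x, word f E n x)).
  by apply/funext => x; apply/ffunP => i; rewrite !ffunE /= /E; case: eqP.
have m1 := mfin_word _ f (gpart l) n mf (gpart_mfin l).
have m2 := mfin_word _ f E n mf mE.
apply: le_trans (ent_comp _ _ _ _ _ _) _; first exact: mfin_pair.
apply: le_trans (ent_pair _ _ _ _ _ _ _) _ => //; rewrite lerD2l.
apply: ent_ffun => i; first exact: mfin_iter.
rewrite (ent_inv mu _ E (iter i f)) // => A mA; exact: iter_inv.
Qed.

End grid_partition.

(** * Exponential moments along unstable segments *)

Section chernoff.
Context {R : realType}.

(** From (1 - x) exp x <= 1. *)
Lemma expR_quad (x : R) : x <= 1 / 2 -> expR x <= 1 + x + 2 * x ^+ 2.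
Proof.
move=> hx; have h := expR_ge1Dx (- x); rewrite expRN in h.
have e0 := expR_gt0 x.
have h1 : (1 - x) * expR x <= 1.
  apply: (@le_trans _ _ ((expR x)^-1 * expR x)); last by rewrite mulVf ?gt_eqF.
  by rewrite ler_pM2r.
have x1 : 0 < 1 - x by lra.
rewrite -(ler_pM2l x1) (le_trans h1) //.
have : (1 - x) * (1 + x + 2 * x ^+ 2) = 1 + x ^+ 2 * (1 - 2 * x) by ring.
by move=> ->; rewrite lerDl mulr_ge0 ?sqr_ge0 //; lra.
Qed.

(** Exponential moment of bounded variables with small mean; s is taken small
    compared with 1 / C. *)
Lemma chernoff_step (q : nat) (X : 'I_q -> R) (C e s : R) : (0 < q)%N -> 0 <= s -> s * C <= 1 / 2 ->
  (forall d, `|X d| <= C) -> q%:R^-1 * \sum_d X d <= e ->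
  \sum_d expR (s * X d) <= q%:R * expR (s * e + 2 * (s * C) ^+ 2).
Proof.
move=> q0 s0 sC hX he; have q0' : 0 < q%:R :> R by rewrite ltr0n.
have C0 : 0 <= C by apply: le_trans (hX (Ordinal q0)).
apply: (@le_trans _ _ (\sum_(d < q) (1 + 2 * (s * C) ^+ 2 + s * X d))).
  apply: ler_sum => d _; have := hX d; rewrite ler_norml => /andP[x1 x2].
  have h : s * X d <= s * C by rewrite ler_wpM2l.
  apply: le_trans (expR_quad _ _) _; first exact: le_trans h sC.
  have : (s * X d) ^+ 2 <= (s * C) ^+ 2.
    have h2 : - (s * C) <= s * X d by rewrite -mulrN ler_wpM2l.
    by rewrite -subr_ge0 subr_sqr mulr_ge0 //; lra.
  lra.
rewrite big_split /= sumr_const card_ord -mulr_sumr -(mulr_natl (1 + _)).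
apply: (@le_trans _ _ (q%:R * (1 + (s * e + 2 * (s * C) ^+ 2)))); last first.
  by rewrite ler_pM2l // expR_ge1Dx.
have hs : s * \sum_d X d <= s * (q%:R * e).
  by rewrite ler_wpM2l // -ler_pdivrMl.
apply: le_trans (lerD (lexx _) hs) _; rewrite le_eqVlt; apply/orP; left; apply/eqP; ring.
Qed.

End chernoff.

Section words.
Context {R : realType}.
Local Notation T2 := (torus R).
Local Notation lam := (lam R).

Fixpoint words (q B : nat) : seq (seq nat) :=
  if B is B'.+1 then [seq d :: w | d <- iota 0 q, w <- words q B'] else [:: [::]].

Lemma words_cons q B d w : (d < q)%N -> w \in words q B -> d :: w \in words q B.+1.
Proof. by move=> dq hw; apply/allpairsP; exists (d, w); split => //; rewrite mem_iota. Qed.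

Lemma words_consP q B v : v \in words q B.+1 -> exists d w, [/\ v = d :: w, (d < q)%N & w \in words q B].
Proof. by case/allpairsP => -[d w] /= [+ hw ->]; rewrite mem_iota => /andP[_ dq]; exists d, w. Qed.

Lemma sum_words (F : seq nat -> R) q B :
  \sum_(w <- words q B.+1) F w = \sum_(d < q) \sum_(w <- words q B) F (nat_of_ord d :: w).
Proof.
rewrite big_allpairs_dep /= -(big_mkord xpredT (fun d => \sum_(w <- words q B) F (d :: w))).
by rewrite /index_iota subn0.
Qed.

(** The real number in base lam^M with digits w. *)
Fixpoint tau (M : nat) (w : seq nat) : R :=
  if w is d :: w' then (d%:R + tau M w') / lam ^+ M else 0.

(** Sum over the blocks of length M of the averages of g along the orbit of
    pt (a + tau M w) b, each one taken at the left end of the corresponding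
    subinterval. It is a function of successive digits, so its exponential
    moments multiply ([sum_words_exp]). *)
Fixpoint Ssum (g : T2 -> R) (M : nat) (a b : R) (w : seq nat) : R :=
  if w is d :: w' then
    blk g M (a + d%:R / lam ^+ M) b + Ssum g M (lam ^+ M * a + d%:R) (lam ^- M * b) w'
  else 0.

Lemma sum_words_exp g M q B (s K a b : R) : 0 <= K ->
  (forall a b, \sum_(d < q) expR (s * blk g M (a + d%:R / lam ^+ M) b) <= q%:R * K) ->
  \sum_(w <- words q B) expR (s * Ssum g M a b w) <= (q%:R * K) ^+ B.
Proof.
move=> K0 h; elim: B a b => [|B IH] a b; first by rewrite big_seq1 /= mulr0 expR0 expr0.
rewrite sum_words exprS /=.
apply: (@le_trans _ _ (\sum_(d < q) expR (s * blk g M (a + d%:R / lam ^+ M) b) * (q%:R * K) ^+ B)).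
  apply: ler_sum => d _; under eq_bigr do rewrite mulrDr expRD.
  by rewrite -mulr_sumr ler_wpM2l ?expR_ge0.
by rewrite -mulr_suml ler_wpM2r // exprn_ge0 // mulr_ge0.
Qed.

Lemma tau_bounds M q B w : 2 <= lam ^+ M -> q%:R <= lam ^+ M + 1 -> w \in words q B -> 0 <= tau M w <= 2.
Proof.
move=> lM hq; elim: B w => [|B IH] w; first by rewrite inE => /eqP -> /=; rewrite lexx ler0n.
move=> /words_consP[d [v [-> dq /IH /andP[h1 h2]]]] /=.
have l0 := @lamX_gt0 R M.
have : d.+1%:R <= q%:R :> R by rewrite ler_nat.
rewrite -natr1 => hd; rewrite divr_ge0 ?addr_ge0 ?(ltW l0) //= ler_pdivrMr //; lra.
Qed.

(** Expansion in the base lam^M. *)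
Lemma tau_cover M q B (al : R) : lam ^+ M < q%:R -> 0 <= al <= 1 ->
  exists2 w, w \in words q B & 0 <= al - tau M w <= (lam ^- M) ^+ B.
Proof.
move=> hq; have l0 := @lamX_gt0 R M; elim: B al => [|B IH] al /andP[a0 a1].
  by exists [::]; rewrite ?inE //= subr0 a0 expr0.
have m0 : 0 <= al * lam ^+ M by rewrite mulr_ge0 // ltW.
have /andP[d1 d2] := truncn_itv m0; set d := Num.truncn _ in d1 d2.
have dq : (d < q)%N.
  rewrite -(ltr_nat R) (le_lt_trans d1) // (le_lt_trans _ hq) // ger_pMl //.
have hal : 0 <= al * lam ^+ M - d%:R <= 1.
  by rewrite subr_ge0 d1 /= lerBlDr addrC natr1 ltW.
have [w hw /andP[w1 w2]] := IH _ hal.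
exists (d :: w); first exact: words_cons.
rewrite /= (_ : al - _ = (al * lam ^+ M - d%:R - tau M w) / lam ^+ M); last by field; rewrite gt_eqF.
by rewrite divr_ge0 ?(ltW l0) //= exprS mulrC ler_wpM2l // invr_ge0 ltW.
Qed.

Definition Bsum (g : T2 -> R) n x := \sum_(i < n) g (iter i (@cat_map R) x).

Lemma BsumD g n k x : Bsum g (n + k) x = Bsum g n x + Bsum g k (iter n (@cat_map R) x).
Proof.
rewrite /Bsum big_split_ord /=; congr (_ + _); apply: eq_bigr => i _.
by rewrite addnC iterD.
Qed.

Lemma blk_Bsum g M a b : blk g M a b = M%:R^-1 * Bsum g M (pt a b).
Proof. by congr (_ * _); apply: eq_bigr => i _; rewrite iter_cat_pt. Qed.

(** Replacing the left ends by the actual orbit costs at most e for each block, by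
    shadowing. *)
Lemma Ssum_shadow (g : T2 -> R) M q (e : R) : (0 < M)%N -> 2 <= lam ^+ M -> q%:R <= lam ^+ M + 1 ->
  (forall a b a' b', `|a - a'| <= 4 / lam ^+ M -> `|b - b'| <= 4 -> `|blk g M a b - blk g M a' b'| <= e) ->
  forall B w, w \in words q B -> forall a b a' b', `|a' - a - tau M w| <= (lam ^- M) ^+ B -> `|b' - b| <= 4 ->
  `|Bsum g (M * B) (pt a' b') - M%:R * Ssum g M a b w| <= (M * B)%:R * e.
Proof.
move=> M0 lM hq h; have l0 := @lamX_gt0 R M; have M0' : 0 < M%:R :> R by rewrite ltr0n.
elim=> [|B IH] w.
  by rewrite inE => /eqP -> a b a' b' _ _ /=; rewrite muln0 /Bsum big_ord0 mulr0 mul0r subrr normr0.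
move=> /words_consP[d [v [-> dq hv]]] a b a' b' /= ha hb.
have /andP[t0 t2] := tau_bounds _ _ _ _ lM hq hv.
rewrite mulnS BsumD iter_cat_pt mulrDr opprD addrACA natrD mulrDl (le_trans (ler_normD _ _)) // lerD //.
  rewrite -[X in `|X - _|](mulVKf (_ : M%:R != 0)) ?gt_eqF // -mulrBr normrM gtr0_norm // ler_pM2l //.
  rewrite -blk_Bsum; apply: h => //.
  rewrite (_ : a' - _ = (a' - a - (d%:R + tau M v) / lam ^+ M) + tau M v / lam ^+ M); last by field; rewrite gt_eqF.
  rewrite (le_trans (ler_normD _ _)) // (_ : 4 / _ = 2 / lam ^+ M + 2 / lam ^+ M); last by rewrite -mulrDl; congr (_ / _); ring.
  rewrite lerD //; last by rewrite ger0_norm ?divr_ge0 ?(ltW l0) // ler_wpM2r // invr_ge0 ltW.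
  rewrite (le_trans ha) // exprS mulrC ler_wpM2r // ?invr_ge0 ?(ltW l0) //.
  by rewrite (le_trans (exprn_ile1 _ _ _)) // ?invr_ge0 ?(ltW l0) // ?ler1n // lamV_le1.
apply: IH => //.
  rewrite (_ : _ - _ - _ = lam ^+ M * (a' - a - (d%:R + tau M v) / lam ^+ M)); last by field; rewrite gt_eqF.
  rewrite normrM gtr0_norm // -ler_pdivlMl // (le_trans ha) // exprS mulrC //.
rewrite -mulrBr lamV_norm (le_trans _ hb) // ler_piMl //; exact: lamV_le1.
Qed.

End words.

(** * Entropy of a grid partition against weighted orbits *)

Section entropy_upper_bound.
Context {R : realType}.
Local Notation T2 := (torus R).
Local Notation lam := (lam R).
Local Notation cat := (@cat_map R).

Lemma real_net (del : R) : 0 < del -> exists K (bb : 'I_K.+1 -> R), forall b, `|b| <= 2 -> exists k, `|b - bb k| < del.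
Proof.
move=> d0; set K := Num.truncn (4 / del).
exists K, (fun k => -2 + k%:R * del) => b; rewrite ler_norml => /andP[b1 b2].
have m0 : 0 <= (b + 2) / del by apply: divr_ge0; [lra|exact: ltW].
have /andP[k1 k2] := truncn_itv m0; set k := Num.truncn _ in k1 k2.
have kK : (k < K.+1)%N.
  rewrite ltnS -(ler_nat R) (le_trans _ (_ : k%:R <= K%:R)) // ler_nat /K truncn_ge_nat ?divr_ge0 ?(ltW d0) //.
  by rewrite (le_trans k1) // ler_wpM2r ?invr_ge0 ?(ltW d0) //; lra.
exists (Ordinal kK) => /=; rewrite ler_pdivlMr // in k1; rewrite ltr_pdivrMr // -(natr1 k) mulrDl mul1r in k2.
by rewrite ltr_norml; move: k1 k2; lra.
Qed.

Lemma bmf_iter (g : T2 -> R) i : continuous g -> bmf (fun x => g (iter i cat x)).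
Proof.
move=> cg; exact: (bmf_comp _ _ _ _ (iter_meas _ i (ctst_meas _ (@cat_cts R))) (cts_bmf _ cg)).
Qed.

Lemma bmf_Bsum (g : T2 -> R) n : continuous g -> bmf (Bsum g n).
Proof. by move=> cg; apply: bmf_sum => i; exact: bmf_iter. Qed.

Lemma Int_Bsum mu (g : T2 -> R) n : continuous g -> Defs.invariant cat mu ->
  \int[mu]_x Bsum g n x = n%:R * \int[mu]_x g x.
Proof.
move=> cg hmu; have mc := ctst_meas _ (@cat_cts R).
rewrite /Bsum Int_sum; last first.
  by move=> i; exact: bmf_iter.
rewrite (eq_bigr (fun=> \int[mu]_x g x)); first by rewrite sumr_const card_ord mulr_natl.
move=> i _; apply: (Int_comp _ _ mu mu (iter i cat) g); [exact: iter_meas|exact: cts_bmf|].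
by move=> A mA; exact: iter_inv.
Qed.

Lemma mem_sum_le (I : eqType) (s : seq I) (F : I -> R) x : x \in s -> (forall i, 0 <= F i) ->
  F x <= \sum_(i <- s) F i.
Proof. by move=> xs F0; rewrite (big_rem x) //= lerDl sumr_ge0. Qed.

(** Gibbs' inequality with the following reference weights on the itineraries of
    the map A^(M L). Finitely many stable coordinates and the words w of B digits
    give orbits that shadow every orbit up to time n M L. The word w has
    probability proportional to exp (s Ssum), and spreads it evenly over the at
    most 16^n itineraries whose cells come near its orbit. An itinerary with a
    large sum of g then has a large weight. *)
Lemma grid_entropy_bound mu (g : T2 -> R) (M L q l : nat) (s Kp e : R) :
  continuous g -> Defs.invariant cat mu -> (0 < M)%N -> 2 <= lam ^+ M ->
  lam ^+ M < q%:R <= lam ^+ M + 1 -> 0 <= s ->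
  (forall a b, \sum_(d < q) expR (s * blk g M (a + d%:R / lam ^+ M) b) <= q%:R * expR Kp) ->
  (forall a b a' b', `|a - a'| <= 4 / lam ^+ M -> `|b - b'| <= 4 -> `|blk g M a b - blk g M a' b'| <= e) ->
  exists c0 B0, forall n, ent mu (word (iter (M * L) cat) (gpart l) n) <=
    n%:R * ln 16 + c0 + (n * L + B0)%:R * (ln q%:R + Kp + s * e - s * \int[mu]_x g x).
Proof.
move=> cg hmu M0 lM /andP[q1 q2] s0 Hexp Hsh.
set del : R := l.+1%:R^-1; have d0 : 0 < del by rewrite invr_gt0.
have d20 : 0 < del / 2 by rewrite divr_gt0.
have [K [bb hbb]] := real_net _ d20.
have [B0 hB0] := lamV_small _ d20.
have [near hnear] := choice (@gpart_near R l).
have q0 : 0 < q%:R :> R by apply: lt_trans q1; exact: lamX_gt0.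
set K2 : R := 2 * K.+1%:R; have K20 : 0 < K2 by rewrite mulr_gt0.
exists (ln K2), B0 => n; set B := (n * L + B0)%N.
pose z (k : 'I_2 * 'I_K.+1) w := pt ((k.1 : nat)%:R + tau M w) (bb k.2).
pose Q : R := (q%:R * expR Kp) ^+ B.
have Q0 : 0 < Q by rewrite exprn_gt0 // mulr_gt0 // expR_gt0.
pose wt k w : R := K2^-1 * (expR (s * Ssum g M (k.1 : 'I_2)%:R (bb k.2) w) / Q).
have wt0 k w : 0 < wt k w by rewrite mulr_gt0 ?invr_gt0 // divr_gt0 // expR_gt0.
pose nr k w (j : 'I_n) := near (iter (j * (M * L)) cat (z k w)).
pose rv (v : {ffun 'I_n -> 'I_l.+1 * 'I_l.+1}) : R :=
  \sum_k \sum_(w <- words q B) wt k w * \prod_j (16^-1 * (v j \in nr k w j)%:R).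
have pr0 k w v : 0 <= \prod_j (16^-1 * (v j \in nr k w j)%:R) :> R.
  by apply: prodr_ge0 => j _; rewrite mulr_ge0 // invr_ge0.
have tm0 v k w : 0 <= wt k w * \prod_j (16^-1 * (v j \in nr k w j)%:R) by rewrite mulr_ge0 // ltW.
have rv0 v : 0 <= rv v by apply: sumr_ge0 => k _; exact: sumr_ge0.
have rv1 : \sum_v rv v <= 1.
  rewrite /rv exchange_big /=.
  apply: (@le_trans _ _ (\sum_(k : 'I_2 * 'I_K.+1) K2^-1)); last first.
    by rewrite sumr_const card_prod !card_ord -(mulr_natl K2^-1) natrM -/K2 divff // gt_eqF.
  apply: ler_sum => k _; rewrite exchange_big /=.
  apply: (@le_trans _ _ (\sum_(w <- words q B) wt k w)).
    apply: ler_sum => w _; rewrite -mulr_sumr ler_piMr ?(ltW (wt0 _ _)) //.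
    rewrite -(bigA_distr_bigA (fun j p => 16^-1 * (p \in nr k w j)%:R)).
    apply: prodr_ile1 => j _; apply/andP; split; first by apply: sumr_ge0 => p _; rewrite mulr_ge0 // invr_ge0.
    rewrite -mulr_sumr -natr_sum ler_pdivrMl // mulr1.
    have -> : (\sum_p (p \in nr k w j : nat))%N = #|nr k w j|.
      by rewrite -sum1_card [RHS]big_mkcond /=; apply: eq_bigr => p _; case: ifP.
    by rewrite ler_nat; have [] := hnear (iter (j * (M * L)) cat (z k w)).
  rewrite -mulr_sumr -mulr_suml ler_piMr ?invr_ge0 ?(ltW K20) // ler_pdivrMr // mul1r.
  by apply: sum_words_exp => //; exact: expR_ge0.
have mc := ctst_meas _ (@cat_cts R).
have mf := iter_meas _ (M * L) mc.
have mW := mfin_word _ (iter (M * L) cat) (gpart l) n mf (gpart_mfin l).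
have key x : exists k w, [/\ w \in words q B, (forall j, word (iter (M * L) cat) (gpart l) n x j \in nr k w j) &
    M%:R^-1 * Bsum g (M * B) x - B%:R * e <= Ssum g M (k.1 : 'I_2)%:R (bb k.2) w].
  have [a [b [-> ha hb]]] := pt_bounded x.
  have [k2 hk2] := hbb b hb.
  have [k1 hk1] : exists k1 : 'I_2, 0 <= a - (k1 : nat)%:R <= 1.
    have /andP[a0 a2] := ha.
    have [a1|a1] := leP a 1; [exists 0; rewrite subr0 a0 //|].
    by exists 1; rewrite /= subr_ge0 (ltW a1) /= lerBlDr.
  have [w hw /andP[w0 w1]] := tau_cover M q B _ q1 hk1.
  exists (k1, k2), w; split => //.
    move=> j; rewrite ffunE -iterM; have [_] := hnear (iter (j * (M * L)) cat (z (k1, k2) w)); apply.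
    rewrite /z /= !iter_cat_pt; apply: le_lt_trans (td_pt _ _ _ _) _.
    rewrite -!mulrBr lamX_norm lamV_norm.
    have h1 : lam ^+ (j * (M * L)) * `|k1%:R + tau M w - a| < del / 2.
      rewrite distrC opprD addrA ger0_norm //.
      apply: le_lt_trans (hB0 (M * B0)%N _); last by rewrite leq_pmull.
      rewrite -ler_pdivlMl ?lamX_gt0 //; apply: le_trans w1 _.
      rewrite exprVn -exprM -invfM -exprD lef_pV2 ?posrE ?lamX_gt0 // ler_eXn2l ?lam_gt1 //.
      by rewrite /B mulnDr leq_add2r mulnCA leq_mul2l leq_mul2r ltnW ?orbT // ltn_ord.
    have h2 : lam ^- (j * (M * L)) * `|bb k2 - b| < del / 2.
      by rewrite distrC (le_lt_trans _ hk2) // ler_piMl // lamV_le1.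
    by rewrite -/del; lra.
  have := Ssum_shadow g M q e M0 lM q2 Hsh B w hw k1%:R (bb k2) a b _ _.
  rewrite (ger0_norm w0) => /(_ w1); rewrite (le_trans (ltW hk2)); last first.
    have : del <= 1 by rewrite invf_le1 ?ler1n.
    lra.
  move=> /(_ isT); rewrite ler_norml => /andP[h1 h2] /=.
  have M0' : 0 < M%:R :> R by rewrite ltr0n.
  rewrite lerBlDr ler_pdivrMl // mulrDr; move: h2; rewrite natrM -mulrA; lra.
have rvlb x : ln (rv (word (iter (M * L) cat) (gpart l) n x)) >=
     - (n%:R * ln 16 + ln K2 + B%:R * (ln q%:R + Kp + s * e)) + s / M%:R * Bsum g (M * B) x.
  have [k [w [hw hj hS]]] := key x.
  set v := word _ _ _ _ in hj *.
  have e1 : \prod_j (16^-1 * (v j \in nr k w j)%:R) = 16^-1 ^+ n :> R.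
    by rewrite (eq_bigr (fun=> 16^-1)) ?prodr_const ?card_ord // => j _; rewrite hj mulr1.
  have h1 : wt k w * 16^-1 ^+ n <= rv v.
    rewrite -e1; apply: (@le_trans _ _ (\sum_(w <- words q B) wt k w * \prod_j (16^-1 * (v j \in nr k w j)%:R))).
      exact: (mem_sum_le _ _ (fun w => wt k w * \prod_j (16^-1 * (v j \in nr k w j)%:R))).
    by rewrite /rv (bigD1 k) //= lerDl sumr_ge0 // => k' _; exact: sumr_ge0.
  have p0 : 0 < wt k w * 16^-1 ^+ n by rewrite mulr_gt0 // exprn_gt0 // invr_gt0.
  apply: le_trans (_ : ln (wt k w * 16^-1 ^+ n) <= _); last by rewrite ler_ln ?posrE // (lt_le_trans p0).
  have i16 : 0 < 16^-1 :> R by rewrite invr_gt0.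
  have l16 : ln (16^-1 ^+ n) = - (n%:R * ln 16) :> R.
    by rewrite lnXn // (lnV (x := 16)) ?posrE // -(mulr_natl (- ln 16)) mulrN.
  have lQ : ln Q = B%:R * (ln q%:R + Kp).
    have qK : 0 < q%:R * expR Kp by rewrite mulr_gt0 // expR_gt0.
    by rewrite /Q lnXn // lnM ?posrE ?expR_gt0 // expRK -(mulr_natl (_ + Kp)).
  have lW : ln (wt k w) = - ln K2 + (s * Ssum g M (k.1 : 'I_2)%:R (bb k.2) w - B%:R * (ln q%:R + Kp)).
    by rewrite /wt lnM ?posrE ?invr_gt0 ?divr_gt0 ?expR_gt0 // (lnV (x := K2)) ?posrE // ln_div ?posrE ?expR_gt0 // expRK lQ.
  rewrite lnM ?posrE ?exprn_gt0 // lW l16.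
  have := ler_wpM2l s0 hS; rewrite mulrBr mulrA.
  by lra.
have hp v : pr mu (word (iter (M * L) cat) (gpart l) n) v != 0 -> 0 < rv v.
  move=> pv; have [x <-] : exists x, word (iter (M * L) cat) (gpart l) n x = v.
    apply: contrapT => h; move: pv; rewrite /pr (_ : _ @^-1` _ = set0) ?measure0 ?eqxx //.
    by apply/seteqP; split=> // x /= ex; apply: h; exists x.
  have [k [w [hw hj _]]] := key x.
  apply: (@lt_le_trans _ _ (wt k w * 16^-1 ^+ n)); first by rewrite mulr_gt0 // exprn_gt0 // invr_gt0.
  have <- : \prod_j (16^-1 * (word (iter (M * L) cat) (gpart l) n x j \in nr k w j)%:R) = 16^-1 ^+ n :> R.
    by rewrite (eq_bigr (fun=> 16^-1)) ?prodr_const ?card_ord // => j _; rewrite hj mulr1.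
  set v' := word _ _ _ _.
  apply: (@le_trans _ _ (\sum_(w <- words q B) wt k w * \prod_j (16^-1 * (v' j \in nr k w j)%:R))).
    exact: (mem_sum_le _ _ (fun w => wt k w * \prod_j (16^-1 * (v' j \in nr k w j)%:R))).
  by rewrite /rv (bigD1 k) //= lerDl sumr_ge0 // => k' _; exact: sumr_ge0.
apply: le_trans (gibbs mu _ _ rv mW rv0 hp rv1) _.
rewrite -(Int_mfin mu _ _ (fun v => ln (rv v)) mW).
have bB := bmf_Bsum g (M * B) cg.
have : - (n%:R * ln 16 + ln K2 + B%:R * (ln q%:R + Kp + s * e)) + s / M%:R * ((M * B)%:R * \int[mu]_x g x) <=
   \int[mu]_x ln (rv (word (iter (M * L) cat) (gpart l) n x)).
  rewrite -(Int_Bsum mu g _ cg hmu) -IntZ // -(Int_cst mu (- _)) -IntD; [|exact: bmf_cst|exact: bmfZ].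
  apply: Int_le => //; first by apply: bmfD; [exact: bmf_cst|exact: bmfZ].
  exact: (mfin_bmf _ _ (fun v => ln (rv v)) mW).
rewrite natrM !mulrA divfK ?gt_eqF ?ltr0n // => h.
by move: h; rewrite mulrBr !mulrA; lra.
Qed.

End entropy_upper_bound.

(** * The measure of maximal entropy *)

Section maximal_entropy.
Context {R : realType}.
Local Notation T2 := (torus R).
Local Notation lam := (lam R).
Local Notation cat := (@cat_map R).
Local Notation mcat := (ctst_meas _ (@cat_cts R)).
Implicit Types mu : probability T2 R.

(** The itinerary is a function of its blocks. *)
Lemma ent_word_block mu (I : finType) (xi : T2 -> I) n N : (0 < N)%N -> mfin xi ->
  ent mu (word cat xi (n * N)) <= ent mu (word (iter N cat) (word cat xi N) n).
Proof.
move=> N0 mx.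
have hd (i : 'I_(n * N)) : (i %/ N < n)%N by rewrite ltn_divLR.
have hm (i : 'I_(n * N)) : (i %% N < N)%N by rewrite ltn_mod.
pose G (z : {ffun 'I_n -> {ffun 'I_N -> I}}) : {ffun 'I_(n * N) -> I} :=
  [ffun i => z (Ordinal (hd i)) (Ordinal (hm i))].
have -> : word cat xi (n * N) = G \o word (iter N cat) (word cat xi N) n.
  apply/funext => x; apply/ffunP => i; rewrite !ffunE /= -iterM -iterD.
  by rewrite [in LHS](divn_eq i N) addnC.
apply: ent_comp; apply: mfin_word; first exact: (iter_meas _ N mcat).
exact: (mfin_word _ _ _ _ mcat).
Qed.

Lemma inv_iter (mu : probability T2 R) N : Defs.invariant cat mu -> Defs.invariant (iter N cat) mu.
Proof. by move=> h A mA; apply: iter_inv => //; exact: mcat. Qed.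

(** The constants of [grid_entropy_bound] disappear in two steps: a large L makes
    the factor 16^n and the error of [ent_word_grid] negligible compared with
    the n M L steps, then n tends to infinity. *)
Lemma entropy_upper (m mu : probability T2 R) (g : T2 -> R) (D e s : R) :
  transl_inv m -> Defs.invariant cat mu -> continuous g -> \int[m]_x g x = 0 -> (forall x, `|g x| <= D) ->
  0 < e -> 0 <= s -> s * D <= 1 / 2 ->
  exists M0, forall M, (M0 <= M)%N ->
  (metric_entropy cat mu <= (ln lam + M%:R^-1 * (2 * s * e + 2 * (s * D) ^+ 2 - s * \int[mu]_x g x + lam ^- M))%:E)%E.
Proof.
move=> hm hmu cg cg0 hD e0 s0 sD.
have [M1 hM1] := blk_equi g e cg e0; have [M2 hM2] := blk_shadow g e cg e0.
exists (maxn 1 (maxn M1 M2)) => M; rewrite !geq_max => /and3P[M0 /hM1{hM1}Heq /hM2{hM2}Hsh].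
have M0' : 0 < M%:R :> R by rewrite ltr0n.
have l0 := @lamX_gt0 R M.
have lM : 2 <= lam ^+ M.
  have : lam ^+ 1 <= lam ^+ M by rewrite ler_eXn2l ?lam_gt1.
  by rewrite expr1; have := @lam_gt52 R; lra.
set q := (Num.truncn (lam ^+ M)).+1.
have /andP[q1 q2] := truncn_itv (ltW l0).
have hq1 : lam ^+ M < q%:R by [].
have hq2 : q%:R <= lam ^+ M + 1 by rewrite -natr1 lerD2r.
pose Kp := s * e + 2 * (s * D) ^+ 2.
have Hexp a b : \sum_(d < q) expR (s * blk g M (a + d%:R / lam ^+ M) b) <= q%:R * expR Kp.
  apply: chernoff_step => //.
    move=> d; rewrite /blk normrM gtr0_norm ?invr_gt0 // ler_pdivrMl // (le_trans (ler_norm_sum _ _ _)) //.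
    rewrite (mulr_natl D) -[X in _ <= _ *+ X](card_ord M) -sumr_const; apply: ler_sum => i _; exact: hD.
  have := Heq q _ m hm a b; rewrite cg0 subr0 ler_norml => /(_ _)/andP[]//.
  by rewrite (ltW (lt_trans _ hq1)) ?hq2 // gtrBl.
set Q := ln q%:R + Kp + s * e - s * \int[mu]_x g x.
apply: metric_entropy_le => //; first exact: mcat.
move=> k xi e' mx e'0.
set c16 : R := ln 16 + 2.
have c16p : 0 <= c16 by rewrite addr_ge0 // ln_ge0 // ler1n.
pose L := (Num.truncn (c16 / M%:R / (e' / 2))).+1.
have L0 : 0 < L%:R :> R by [].
have hL : c16 / (M%:R * L%:R) <= e' / 2.
  rewrite invfM mulrA ler_pdivrMr // [e' / 2 * _]mulrC -ler_pdivrMr ?divr_gt0 //.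
  by apply: ltW; exact: truncnS_gt.
have N0 : (0 < M * L)%N by rewrite muln_gt0 M0.
have mN := iter_meas _ (M * L) mcat; have hN := inv_iter mu (M * L) hmu.
have mxi := mfin_word _ _ xi (M * L) mcat mx.
have [l hl] := ent_word_grid _ mu _ _ mN hN mxi.
have [c0 [B0 hB]] := grid_entropy_bound mu g M L q l s Kp e cg hmu M0 lM (introT andP (conj hq1 hq2)) s0 Hexp Hsh.
pose n := (Num.truncn (`|c0 + B0%:R * Q| / (M%:R * L%:R) / (e' / 2))).+1.
have n0 : 0 < n%:R :> R by [].
have ML0 : 0 < M%:R * L%:R :> R by rewrite mulr_gt0.
have hn : (c0 + B0%:R * Q) / (M%:R * L%:R) / n%:R <= e' / 2.
  rewrite ler_pdivrMr // [e' / 2 * _]mulrC -ler_pdivrMr ?divr_gt0 //.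
  apply/ltW; apply: le_lt_trans (truncnS_gt _); rewrite ler_pM2r ?invr_gt0 ?divr_gt0 // ler_pM2r ?invr_gt0 //.
  exact: ler_norm.
exists (n * (M * L))%N; first by rewrite muln_gt0 N0.
have h1 := le_trans (ent_word_block mu _ xi n _ N0 mx) (hl n).
have {h1}h1 := le_trans h1 (lerD (hB n) (lexx _)).
have lnq : ln q%:R <= M%:R * ln lam + lam ^- M.
  apply: (@le_trans _ _ (ln (lam ^+ M * (1 + lam ^- M)))).
    rewrite ler_ln ?posrE ?mulr_gt0 ?addr_gt0 ?lamV_gt0 // ?(lt_trans _ hq1) // mulrDr mulr1 lamXV //.
  rewrite lnM ?posrE ?addr_gt0 ?lamV_gt0 // lnXn ?lam_gt0 // -(mulr_natl (ln lam)) lerD2l le_ln1Dx //.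
  by rewrite (lt_trans _ (@lamV_gt0 R M)) // oppr_lt0.
have hQ : M%:R^-1 * Q <= ln lam + M%:R^-1 * (2 * s * e + 2 * (s * D) ^+ 2 - s * \int[mu]_x g x + lam ^- M).
  rewrite -[X in _ <= X + _](mulKf (_ : M%:R != 0)) ?gt_eqF // -mulrDr ler_pM2l ?invr_gt0 // /Q /Kp; lra.
apply: (@le_trans _ _ (M%:R^-1 * Q + (c16 / (M%:R * L%:R) + (c0 + B0%:R * Q) / (M%:R * L%:R) / n%:R))); last by move: hQ hL hn; lra.
have nN0 : 0 < (n * (M * L))%:R :> R by rewrite ltr0n muln_gt0 N0.
rewrite ler_pdivrMl //; apply: le_trans h1 _; rewrite -/Q le_eqVlt; apply/orP; left; apply/eqP.
rewrite /c16 !natrM natrD natrM; field; by rewrite !gt_eqF.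
Qed.

(** [entropy_upper] for the zero function. *)
Lemma entropy_le_ln_lam (m mu : probability T2 R) : transl_inv m -> Defs.invariant cat mu ->
  (metric_entropy cat mu <= (ln lam)%:E)%E.
Proof.
move=> hm hmu; apply/lee_addgt0Pr => e' e'0.
pose z0 : T2 -> R := fun=> 0.
have c0 : continuous z0 by apply: cts_td => x e he; exists 1 => // y _; rewrite subrr normr0.
have h0 : \int[m]_x z0 x = 0 by exact: Int_cst.
have hb x : `|z0 x| <= 0 by rewrite normr0.
have s0 : (0 : R) * 0 <= 1 / 2 by rewrite mul0r; lra.
have [M0 hM0] := entropy_upper m mu _ 0 1 0 hm hmu c0 h0 hb ltr01 (lexx 0) s0.
have [n hn] := lamV_small _ e'0.
pose M := (maxn M0 n).+1.
have := hM0 M (ltac:(rewrite /M; lia)); have := hn M (ltac:(rewrite /M; lia)) => hl h.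
apply: le_trans h _; rewrite -EFinD lee_fin lerD2l.
rewrite (_ : 2 * 0 * 1 + 2 * (0 * 0) ^+ 2 - 0 * _ + lam ^- M = lam ^- M); last by ring.
have M1 : 0 < M%:R :> R by [].
rewrite ler_pdivrMl //; apply: le_trans (ltW hl) _.
by rewrite ler_peMl ?(ltW e'0) // ler1n.
Qed.

(** For a small s the linear gain s (int g dmu) beats the quadratic cost of the
    exponential moments. *)
Lemma entropy_lt_ln_lam (m mu : probability T2 R) (phi : T2 -> R) : transl_inv m -> Defs.invariant cat mu ->
  continuous phi -> \int[mu]_x phi x != \int[m]_x phi x -> (metric_entropy cat mu < (ln lam)%:E)%E.
Proof.
move=> hm hmu cphi; set c := \int[m]_x phi x.
wlog hb : phi cphi @c / c < \int[mu]_x phi x.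
  move=> H ne; have [lt|] := ltP c (\int[mu]_x phi x); first exact: (H phi).
  rewrite le_eqVlt => /orP[/eqP e|lt]; first by rewrite e eqxx in ne.
  have cN : continuous (fun x => - phi x) by move=> x; apply: continuousN; exact: cphi.
  have IN (nu : probability T2 R) : \int[nu]_x (- phi x) = - \int[nu]_x phi x.
    transitivity (\int[nu]_x (-1 * phi x)); first by apply: eq_Rintegral => x _; rewrite mulN1r.
    by rewrite IntZ ?mulN1r //; exact: cts_bmf.
  by apply: (H (fun x => - phi x)) => //; rewrite !IN ?ltrN2 // eqr_opp.
move=> _; pose g x := phi x + (- c).
have cg : continuous g.
  apply: cts_td => x e e0; have [d d0 hd] := cts_unif _ cphi _ e0.
  by exists d => // y /hd; rewrite /g (_ : phi x + - c - (phi y + - c) = phi x - phi y) //; ring.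
have bphi := cts_bmf _ cphi.
have g0 : \int[m]_x g x = 0 by rewrite IntD ?(Int_cst m (- c)) ?subrr //; exact: bmf_cst.
have gb : \int[mu]_x g x = \int[mu]_x phi x - c by rewrite IntD ?(Int_cst mu (- c)) //; exact: bmf_cst.
set be := \int[mu]_x g x in gb.
have be0 : 0 < be by rewrite gb subr_gt0.
have [D D0 hD] := cts_bounded _ cg.
pose s := Num.min (1 / (2 * D)) (be / (8 * D ^+ 2)).
have s0 : 0 < s by rewrite lt_min !divr_gt0 ?mulr_gt0 ?exprn_gt0.
have sD : s * D <= 1 / 2.
  rewrite -ler_pdivlMr // ge_min; apply/orP; left; rewrite le_eqVlt; apply/orP; left; apply/eqP; field.
  by rewrite gt_eqF.
have sD2 : (s * D) ^+ 2 <= s * be / 8.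
  rewrite exprMn expr2 -!mulrA ler_pM2l // -ler_pdivlMr ?exprn_gt0 // ge_min; apply/orP; right.
  by rewrite invfM mulrA.
have e0 : 0 < be / 8 by rewrite divr_gt0.
have [M0 hM0] := entropy_upper m mu g D (be / 8) s hm hmu cg g0 hD e0 (ltW s0) sD.
have [n hn] := lamV_small _ (mulr_gt0 s0 (divr_gt0 be0 (ltr0n _ 4))).
pose M := (maxn M0 n).+1.
have := hM0 M (ltac:(rewrite /M; lia)); have := hn M (ltac:(rewrite /M; lia)) => hl h.
apply: le_lt_trans h _; rewrite lte_fin gtrDl pmulr_rlt0 ?invr_gt0 //.
by rewrite -/be; have := mulr_gt0 s0 be0; move: sD2 hl; lra.
Qed.

(** Expansiveness: the lifts that are close at time 0 stay close, since a jump by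
    a nonzero lattice vector would need a distance of 1/2. *)
Lemma expansive (del : R) n a b y : del <= 1 / 16 ->
  (forall i, (i <= n)%N -> td (iter i cat (pt a b)) (iter i cat y) < del) ->
  exists a' b', [/\ y = pt a' b', lam ^+ n * `|a - a'| < del & `|b - b'| < del].
Proof.
move=> hdel h.
have /td_lt_lift[a' [b' [ey hy]]] := h 0%N isT; rewrite /= in hy.
have hb : `|b - b'| < del by rewrite (le_lt_trans _ hy) // lerDr.
have ha0 : `|a - a'| < del by rewrite (le_lt_trans _ hy) // lerDl.
exists a', b'; split=> //; have ey' : y = pt a' b' by []; clear ey; subst y.
suff H i : (i <= n)%N -> lam ^+ i * `|a - a'| < del by exact: H.
elim: i => [|i IH] hi; first by rewrite expr0 mul1r.
have {}IH := IH (ltnW hi); have := h i.+1 hi.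
rewrite !iter_cat_pt => /td_lt_lift[p [r [/pt_eq hl hp]]].
have hp1 : `|lam ^+ i.+1 * a - p| < del by rewrite (le_lt_trans _ hp) // lerDl.
have hr1 : `|lam ^- i.+1 * b - r| < del by rewrite (le_lt_trans _ hp) // lerDr.
have h1 : lam ^+ i.+1 * `|a - a'| < 3 * del.
  rewrite exprS -mulrA; have : lam * (lam ^+ i * `|a - a'|) <= 3 * (lam ^+ i * `|a - a'|).
    by rewrite ler_wpM2r ?mulr_ge0 ?(ltW (lamX_gt0 _)) // ltW // lam_lt3.
  by move=> /le_lt_trans; apply; rewrite ltr_pM2l.
have h2 : lam ^- i.+1 * `|b - b'| < del by rewrite (le_lt_trans _ hb) // ler_piMl // lamV_le1.
have [e1 e2] := lat0 _ _ hl
  (ltac:(rewrite (_ : lam ^+ i.+1 * a' - p = (lam ^+ i.+1 * a - p) - lam ^+ i.+1 * (a - a')); [|ring];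
     apply: (le_lt_trans (ler_normB _ _)); rewrite lamX_norm; move: hp1 h1; lra))
  (ltac:(rewrite (_ : lam ^- i.+1 * b' - r = (lam ^- i.+1 * b - r) - lam ^- i.+1 * (b - b')); [|ring];
     apply: (le_lt_trans (ler_normB _ _)); rewrite lamV_norm; move: hr1 h2; lra)).
rewrite -lamX_norm; move/eqP : e1; rewrite subr_eq0 => /eqP e1.
by rewrite mulrBr e1.
Qed.

(** Translates of B by multiples of lam^-n / 4 along the unstable direction, about
    lam^n of them, are disjoint by expansiveness and have equal measure. *)
Lemma haar_small (m : probability T2 R) n (B : set T2) : transl_inv m -> measurable B ->
  (forall x y, B x -> B y -> forall i, (i <= n)%N -> td (iter i cat x) (iter i cat y) < 1 / 16) ->
  fine (m B) <= 2 * lam ^- n.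
Proof.
move=> hm mB hB; have l0 := @lamX_gt0 R n.
pose del := lam ^- n / 4; have d0 : 0 < del by rewrite divr_gt0 // lamV_gt0.
pose J := Num.truncn (lam ^+ n).
have /andP[J1 J2] := truncn_itv (ltW l0); rewrite -/J in J1 J2.
have J0 : (0 < J)%N by rewrite truncn_gt0 lamX_ge1.
have Jd : J%:R * del <= 1 / 4.
  rewrite /del mulrA ler_pdivrMr // (_ : 1 / 4 * 4 = 1); last by field.
  by rewrite ler_pdivrMr // mul1r.
pose Bj (j : 'I_J) := tshift (j%:R * del) 0 @^-1` B.
have mBj j : measurable (Bj j).
  by rewrite -[X in measurable X]setTI; exact: (ctst_meas _ (tshift_cts _ _) measurableT).
have disj x (i j : 'I_J) : Bj i x -> Bj j x -> (j <= i)%N.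
  move=> hi hj; rewrite leqNgt; apply/negP => ij.
  have [a [b [ex _ _]]] := pt_bounded x; move: hi hj; rewrite /Bj /= ex !tshift_pt !addr0 => hi hj.
  have [a' [b' [e ha hb]]] := expansive (1 / 16) n _ _ _ (lexx _) (hB _ _ hi hj).
  move/pt_eq : e => hl.
  have hx : 1 <= (j - i)%:R :> R by rewrite ler1n subn_gt0.
  have hx2 : (j - i)%:R <= J%:R :> R by rewrite ler_nat (leq_trans (leq_subr _ _)) // ltnW.
  have hji : (j : nat)%:R = (i : nat)%:R + (j - i)%:R :> R by rewrite -natrD subnKC // ltnW.
  have ha2 : `|a + i%:R * del - a'| < del / 4.
    rewrite -(ltr_pM2l l0) (lt_le_trans ha) // /del mulrA mulrA lamXV; lra.
  have hjd : (j - i)%:R * del <= 1 / 4 by apply: le_trans Jd; rewrite ler_pM2r.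
  have hjd1 : del <= (j - i)%:R * del by rewrite ler_peMl // ltW.
  have d1 : del <= 1 / 4 by lra.
  have ee : a + j%:R * del - a' = (a + i%:R * del - a') + (j - i)%:R * del by rewrite hji; ring.
  have [e1 _] := lat0 _ _ hl
    (ltac:(rewrite ee; apply: (le_lt_trans (ler_normD _ _)); rewrite (ger0_norm (_ : 0 <= (j - i)%:R * del)); [|lra]; move: ha2; lra))
    (ltac:(apply: lt_trans hb _; lra)).
  by move: ha2; rewrite ee in e1; rewrite ltr_norml; lra.
have h1 : \sum_(j < J) fine (m (Bj j)) <= 1.
  rewrite -(eq_bigr _ (fun j _ => Int_indic m (Bj j) (mBj j))) -Int_sum; last by move=> j; exact: bmf_indic.
  apply: Int_le_cst; first by apply: bmf_sum => j; exact: bmf_indic.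
  move=> x; have [[j hj]|h] := pselect (exists j, Bj j x); last first.
    rewrite big1 // => j _; rewrite indicE memNset // => hj; apply: h; by exists j.
  rewrite (bigD1 j) //= big1 ?addr0 ?indicE ?mem_set // => i ij; rewrite indicE memNset // => hi.
  by move/eqP : ij; apply; apply/val_inj/eqP; rewrite eqn_leq (disj x j i hj hi) (disj x i j hi hj).
rewrite (eq_bigr (fun=> fine (m B))) in h1; last by move=> j _; rewrite /Bj hm.
rewrite sumr_const card_ord -(mulr_natl (fine (m B))) in h1.
have J3 : lam ^+ n <= 2 * J%:R.
  have : 1 <= J%:R :> R by rewrite ler1n.
  by move: J2; rewrite -natr1; lra.
have f0 : 0 <= fine (m B) by rewrite fine_ge0.
rewrite ler_pdivlMr // mulrC (le_trans (ler_wpM2r f0 J3)) // -mulrA; lra.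
Qed.

(** The cells for l = 127 have diameter less than 1 / 16, so by [haar_small] each
    itinerary of length n has measure at most C lam^-n. *)
Lemma entropy_ge_ln_lam (m mu : probability T2 R) (K : R) : transl_inv m -> Defs.invariant cat mu -> 0 < K ->
  (forall A, measurable A -> fine (mu A) <= K * fine (m A)) ->
  ((ln lam)%:E <= metric_entropy cat mu)%E.
Proof.
move=> hm hmu K0 hK; pose l := 127%N.
pose xi (x : T2) := enum_rank (gpart l x).
have mxi : mfin xi by exact: (mfin_comp _ _ (gpart l) enum_rank (gpart_mfin l)).
pose C : R := 2 * lam * K + 1.
have C0 : 0 < C by rewrite addr_gt0 // !mulr_gt0 // lam_gt0.
apply: (metric_entropy_ge cat mu _ xi (ln lam) (ln C)) => //; first exact: mcat.
move=> n; have mw := mfin_word _ _ xi n mcat mxi.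
have hp w : pr mu (word cat xi n) w <= C * lam ^- n.
  case: n mw w => [|n] mw w.
    by rewrite expr0 invr1 mulr1 (le_trans (pr_le1 _ _ _ _ mw)) // lerDr !mulr_ge0 // ?(ltW lam_gt0) ?ltW.
  apply: (@le_trans _ _ (K * (2 * lam ^- n))).
    apply: le_trans (hK _ (mw w)) _; rewrite ler_pM2l //; apply: haar_small => // x y hx hy i hi.
    have e : xi (iter i cat x) = xi (iter i cat y).
      by have := congr1 (fun f : {ffun 'I_n.+1 -> _} => f (Ordinal (hi : (i < n.+1)%N))) (etrans hx (esym hy)); rewrite !ffunE.
    have {}e : gpart l (iter i cat x) = gpart l (iter i cat y) by exact: enum_rank_inj e.
    have := gcell_diam l _ _ _ (gpartP l (iter i cat x)) (ltac:(rewrite e; exact: gpartP)) => hd.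
    by apply: lt_le_trans hd _; rewrite /l; lra.
  have lp := @lam_gt0 R; have vp := @lamV_gt0 R n.
  have e : K * (2 * lam ^- n) = 2 * lam * K * (lam^-1 * lam ^- n).
    by field; rewrite !gt_eqF // lamX_gt0.
  have vp1 : 0 < lam^-1 * lam ^- n by rewrite mulr_gt0 // invr_gt0.
  have e2 : lam ^- n.+1 = lam^-1 * lam ^- n by rewrite exprS; exact: invfM.
  by rewrite e e2 /C ler_pM2r // lerDl.
rewrite /ent -sumrN -[leLHS]mul1r -[X in X * _ <= _](sum_pr mu _ _ mw) mulr_suml; apply: ler_sum => w _.
have [->|p0] := eqVneq (pr mu (word cat xi n) w) 0; first by rewrite !mul0r oppr0.
have pp : 0 < pr mu (word cat xi n) w by rewrite lt_def p0 pr_ge0.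
rewrite -mulrN ler_pM2l // lerNr opprB.
have cl : 0 < C * lam ^- n by rewrite mulr_gt0 // lamV_gt0.
apply: (@le_trans _ _ (ln (C * lam ^- n))); first by rewrite ler_ln ?posrE.
have -> : ln (C * lam ^- n) = ln C - n%:R * ln lam.
  rewrite lnM ?posrE ?lamV_gt0 // (lnV (x := lam ^+ n)) ?posrE ?lamX_gt0 // (lnXn n lam_gt0).
  by rewrite -(mulr_natl (ln lam)).
by [].
Qed.

Lemma transl_inv_invariant (m : probability T2 R) : transl_inv m -> Defs.invariant cat m.
Proof. by move=> hm A mA; exact: transl_inv_cat. Qed.

Lemma haar_entropy (m : probability T2 R) : transl_inv m -> metric_entropy cat m = (ln lam)%:E.
Proof.
move=> hm; apply/eqP; rewrite eq_le (entropy_le_ln_lam m m) //=; last exact: transl_inv_invariant.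
apply: (entropy_ge_ln_lam m m 1) => //; first exact: transl_inv_invariant.
by move=> A mA; rewrite mul1r.
Qed.

(** A measure of entropy ln lam gives each continuous function its Haar integral,
    by [entropy_lt_ln_lam]. *)
Lemma mme_unique (m mu : probability T2 R) : transl_inv m -> Defs.invariant cat mu ->
  ((ln lam)%:E <= metric_entropy cat mu)%E -> forall A, measurable A -> mu A = m A.
Proof.
move=> hm hmu h; apply: prob_eq_of_int => phi cphi; apply/eqP; apply: contraT => ne.
by have := entropy_lt_ln_lam m mu phi hm hmu cphi ne; rewrite ltNge h.
Qed.

Section conditional.
Variables (m : probability T2 R) (A : set T2).
Hypotheses (mA : measurable A) (A0 : 0 < fine (m A)).

Let iA : {nonneg R} := NngNum (ltW (eq_ind_r is_true A0 (invr_gt0 (fine (m A))))).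

(** The conditional probability given A. *)
Definition condp : set T2 -> \bar R := mscale iA (mrestr m mA).

HB.instance Definition _ := Measure.on condp.

Lemma condpE B : condp B = ((fine (m A))^-1%:E * m (B `&` A))%E.
Proof. by []. Qed.

Let condp_setT : condp setT = 1%E.
Proof.
rewrite condpE setTI (prob_fin m A mA) /= -EFinM mulVf //.
by rewrite gt_eqF.
Qed.

HB.instance Definition _ := Measure_isProbability.Build _ _ _ condp condp_setT.

End conditional.

(** The conditional measure given an invariant set A is at most a multiple of m,
    so it has entropy ln lam, hence equals m and the complement of A is null. *)
Lemma haar_ergodic (m : probability T2 R) : transl_inv m -> Defs.ergodic cat m.
Proof.
move=> hm; split; first exact: transl_inv_invariant.
move=> A mA hA; have hinv := transl_inv_invariant m hm.
have [A0|A0] := eqVneq (fine (m A)) 0; first by left; rewrite (prob_fin m A mA) A0.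
have A1 : 0 < fine (m A) by rewrite lt_def A0 fine_ge0.
right; pose nu : probability T2 R := condp m A mA A1.
have nuE B : nu B = ((fine (m A))^-1%:E * m (B `&` A))%E by [].
have nui : Defs.invariant cat nu.
  move=> B mB; rewrite !nuE; congr (_ * _)%E.
  by rewrite -{1}hA -preimage_setI hinv //; exact: measurableI.
have h : ((ln lam)%:E <= metric_entropy cat nu)%E.
  apply: (entropy_ge_ln_lam m nu (fine (m A))^-1) => //; first by rewrite invr_gt0.
  move=> B mB; have mBA : measurable (B `&` A) by exact: measurableI.
  rewrite nuE (prob_fin m _ mBA) -EFinM /= ler_pM2l ?invr_gt0 //.
  apply: fine_le; rewrite ?fin_num_measure //.
  by apply: le_measure; rewrite ?inE //; exact: subIsetl.
have mCA : measurable (~` A) by exact: measurableC.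
have := mme_unique m nu hm nui h _ mCA; rewrite nuE setICl measure0 mule0 => /esym e.
have := probability_setC m mA; rewrite e (prob_fin m A mA) => /esym /eqP.
by rewrite -EFinB eqe subr_eq0 => /eqP <-.
Qed.

End maximal_entropy.

(** * The weight of the balls meeting a cell *)

Lemma adjacent_le2 (q : nat) (P : nat -> bool) :
  (forall d d', P d -> P d' -> (d' <= d.+1)%N) -> (\sum_(d < q) P d <= 2)%N.
Proof.
move=> h; have [[d0 Pd0]|no] := pselect (exists d, P d); last first.
  by rewrite big1 // => d _; case Pd: (P d) => //; case: no; exists d.
have ex : exists d, P d by exists d0.
case: (ex_minnP ex) => m Pm hm.
have h1 k : (\sum_(d < q) (d == k :> nat) <= 1)%N.
  have [lt|ge] := ltnP k q; last first.
    by rewrite big1 // => d _; rewrite (_ : (_ == _) = false) //; apply/eqP; have := ltn_ord d; lia.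
  rewrite (bigD1 (Ordinal lt)) //= eqxx big1 // => d /eqP hd.
  by rewrite (_ : (_ == _) = false) //; apply/eqP => e; apply: hd; exact: val_inj.
apply: (@leq_trans (\sum_(d < q) ((d == m :> nat) + (d == m.+1 :> nat)))).
  apply: leq_sum => d _; case Pd: (P d) => //.
  have := hm d Pd; have := h m d Pm Pd => h2 h3.
  have [->|->] : (d : nat) = m \/ (d : nat) = m.+1 by lia.
    by rewrite eqxx.
  by rewrite eqxx addn1.
by rewrite big_split /= (leq_add (h1 m) (h1 m.+1)).
Qed.

Section potential.
Context {R : realType}.
Local Notation lam := (lam R).
Variables (K : choiceType) (C : set K) (len : K -> nat) (D : K -> set R) (s : R).
Local Notation w k := (expR (- ((len k)%:R * s))).

Hypothesis s0 : 0 < s.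
Hypothesis narrow : forall k, C k -> forall u v, D k u -> D k v -> `|u - v| < lam ^- (len k) / 2.
Hypothesis fin : (\esum_(k in C) (w k)%:E < +oo)%E.

(** D k is the trace of the k-th ball on the unstable line. *)
Definition meets (t : R) n : set K := [set k | exists2 u, D k u & t <= u <= t + lam ^- n].

Definition ePhi t n : \bar R := (\esum_(k in C `&` meets t n) (w k)%:E)%E.

Definition Phi t n : R := fine (ePhi t n).

Let w0 k : (0 <= (w k)%:E)%E. Proof. by rewrite lee_fin expR_ge0. Qed.

Lemma ePhi_mkcond t n : ePhi t n = (\esum_(k in C) if k \in meets t n then (w k)%:E else 0)%E.
Proof. exact: esum_mkcondr. Qed.

Lemma ePhi_le t n : (ePhi t n <= \esum_(k in C) (w k)%:E)%E.
Proof. by rewrite ePhi_mkcond; apply: le_esum => k _; case: ifP => // _; exact: w0. Qed.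

Lemma ePhi_fin t n : ePhi t n = (Phi t n)%:E.
Proof.
rewrite /Phi fineK // fin_real // (lt_le_trans (ltNyr 0)) /=; last by apply: esum_ge0 => k _; exact: w0.
exact: le_lt_trans (ePhi_le t n) fin.
Qed.

Lemma Phi_total t n (kap : R) : (\esum_(k in C) (w k)%:E < kap%:E)%E -> Phi t n < kap.
Proof. by move=> h; rewrite -lte_fin -ePhi_fin; exact: le_lt_trans (ePhi_le t n) h. Qed.

Lemma Phi_ge0 t n : 0 <= Phi t n.
Proof. by rewrite -lee_fin -ePhi_fin; apply: esum_ge0 => k _; exact: w0. Qed.

Lemma Phi_ge t n k : C k -> meets t n k -> w k <= Phi t n.
Proof.
move=> Ck mk; rewrite -lee_fin -ePhi_fin; apply: esum_ge; exists [set k]; last by rewrite fsbig_set1.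
by split; [exact: finite_set1|move=> ? ->].
Qed.

Lemma Phi_mono t n t' n' : t <= t' -> t' + lam ^- n' <= t + lam ^- n -> Phi t' n' <= Phi t n.
Proof.
move=> h1 h2; rewrite -lee_fin -!ePhi_fin !ePhi_mkcond; apply: le_esum => k _.
case: ifPn => [/set_mem[u Du /andP[u1 u2]]|_]; last by case: ifP.
rewrite ifT //; apply/mem_set; exists u => //; apply/andP; split; lra.
Qed.

(** Every ball that meets the cell is lighter than exp (- (n + M) s), hence longer
    than n + M. Its trace is then shorter than half a child, so that it meets at
    most two children, which are adjacent. *)
Lemma Phi_split t n M q : q%:R <= lam ^+ M -> Phi t n < expR (- ((n + M)%:R * s)) ->
  \sum_(d < q) Phi (t + d%:R * lam ^- (n + M)) (n + M) <= 2 * Phi t n.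
Proof.
move=> hq hPhi; rewrite -lee_fin -sumEFin.
under eq_bigr do rewrite -ePhi_fin ePhi_mkcond.
rewrite -esum_sum; last by move=> k d _ _; case: ifP => // _; exact: w0.
rewrite mulr_natl mulr2n EFinD -ePhi_fin ePhi_mkcond -esumD; try by move=> k _; case: ifP => // _; exact: w0.
apply: le_esum => k Ck.
have l0 := @lamV_gt0 R (n + M).
have hm d : (d < q)%N -> meets (t + d%:R * lam ^- (n + M)) (n + M) k -> meets t n k.
  move=> dq [u Du /andP[u1 u2]]; exists u => //; apply/andP; split.
    by apply: le_trans u1; rewrite lerDl mulr_ge0 // ltW.
  apply: (le_trans u2); rewrite -addrA lerD2l -[X in _ + X]mul1r -mulrDl natr1.
  rewrite exprD invfM mulrCA ger_pMr ?lamV_gt0 // ler_pdivrMr ?lamX_gt0 // mul1r.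
  by rewrite (le_trans _ hq) // ler_nat.
pose P d := k \in meets (t + d%:R * lam ^- (n + M)) (n + M).
rewrite (eq_bigr (fun d : 'I_q => ((w k) *+ P d)%:E)); last by move=> d _; rewrite /P; case: ifP.
rewrite sumEFin sumrMnr.
have [in0|nin] := boolP (k \in meets t n); last first.
  rewrite big1 ?mulr0n ?adde0 // => d _; rewrite /P; case: (boolP (_ \in _)) => // /set_mem h.
  by move: nin; rewrite mem_set //; exact: hm (ltn_ord d) h.
rewrite -EFinD lee_fin -mulr2n ler_wpMn2l ?expR_ge0 //; apply: adjacent_le2 => d d' /set_mem[u Du /andP[u1 u2]] /set_mem[v Dv /andP[v1 v2]].
have hw : w k < expR (- ((n + M)%:R * s)).
  by apply: le_lt_trans hPhi; apply: Phi_ge => //; exact/set_mem.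
move: hw; rewrite ltr_expR ltrN2 ltr_pM2r // ltr_nat => hlen.
have := narrow k Ck v u Dv Du.
have : lam ^- len k <= lam ^- (n + M).
  by rewrite lef_pV2 ?posrE ?lamX_gt0 // ler_eXn2l ?lam_gt1 // ltnW.
move=> h1 h2; have {h1 h2} h : v - u < lam ^- (n + M) / 2 by move: (ler_norm (v - u)); lra.
have h3 : (d'%:R - d.+1%:R) * lam ^- (n + M) < 1 * lam ^- (n + M).
  by rewrite -natr1; move: h u1 u2 v1 v2 l0; set z := lam ^- _; nra.
by move: h3; rewrite ltr_pM2r // ltrBlDl natr1 ltr_nat ltnS.
Qed.

End potential.

(** * Free choice of children *)

Lemma exists_le_avg {R : realType} (q : nat) (F : 'I_q -> R) (c : R) : (0 < q)%N ->
  \sum_d F d <= q%:R * c -> exists d, F d <= c.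
Proof.
move=> q0 h; apply: contrapT => /forallNP no.
have : \sum_(d < q) c < \sum_d F d.
  apply: ltr_sum; first by apply/hasP; exists (Ordinal q0) => //; rewrite mem_index_enum.
  by move=> d _; have /negP := no d; rewrite -ltNge.
by rewrite sumr_const card_ord -(mulr_natl c) ltNge h.
Qed.

(** The properties of the weight of the balls meeting a cell on which the choice of
    a point depends; this makes the thresholds theta below uniform over all
    families of balls. *)
Definition potential {R : realType} (s : R) (Phi : R -> nat -> R) : Prop :=
  [/\ forall t n, 0 <= Phi t n,
      forall t n t' n', t <= t' -> t' + lam R ^- n' <= t + lam R ^- n -> Phi t' n' <= Phi t n &
      forall t n M q, q%:R <= lam R ^+ M -> Phi t n < expR (- ((n + M)%:R * s)) ->
        \sum_(d < q) Phi (t + d%:R * lam R ^- (n + M)) (n + M) <= 2 * Phi t n].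

Section free_phase.
Context {R : realType}.
Local Notation T2 := (torus R).
Local Notation lam := (lam R).

Variables (Phi : R -> nat -> R) (s s2 : R).
Hypothesis s0 : 0 < s.
Hypothesis ss2 : s < s2.
Hypothesis hPhi : potential s Phi.
Let Phi_ge0 t n : 0 <= Phi t n. Proof. by case: hPhi. Qed.
Let Phi_split t n M q : q%:R <= lam ^+ M -> Phi t n < expR (- ((n + M)%:R * s)) ->
  \sum_(d < q) Phi (t + d%:R * lam ^- (n + M)) (n + M) <= 2 * Phi t n.
Proof. by case: hPhi => _ _; apply. Qed.

Variables (I : finType) (g : I -> T2 -> R) (mean : I -> R).
Variables (M q : nat) (sig kap e theta eta : R).
Hypothesis M0 : (0 < M)%N.
Hypothesis q0 : (0 < q)%N.
Hypothesis qM : q%:R <= lam ^+ M.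
Hypothesis q2 : 2 <= q%:R * expR (- (M%:R * s2)).
Hypothesis theta0 : 0 < theta.
Hypothesis thetaM : 2 * theta < expR (- (M%:R * s)).
Hypothesis eta0 : 0 < eta.
Hypothesis etaI : eta * (2 * #|I|%:R) <= 1 / 2.
Hypothesis tilt : forall f (b : bool) a c,
  \sum_(d < q) expR ((-1) ^+ b * sig * (blk (g f) M (a + d%:R / lam ^+ M) c - mean f)) <= q%:R * expR kap.
Hypothesis shadow : forall f a b a' b', `|a - a'| <= 4 / lam ^+ M -> `|b - b'| <= 4 ->
  `|blk (g f) M a b - blk (g f) M a' b'| <= e.

(* T n B bounds the potential after B blocks. Psi is the potential in this unit,
   plus the exponential moments of the sums S of deviations from the means. *)
Local Notation T n B := (2 * theta * expR (- (n%:R * s)) * expR (- ((M * B)%:R * s2))).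
Local Notation Psi n B t S := (Phi t (n + M * B) / T n B +
  eta * \sum_(f : I) \sum_(b : bool) expR ((-1) ^+ b * sig * S f - B%:R * kap)).

Let T0 n B : 0 < T n B.
Proof. by rewrite !mulr_gt0 ?expR_gt0. Qed.

Let tail0 (B : nat) (S : I -> R) : 0 <= eta * \sum_(f : I) \sum_(b : bool) expR ((-1) ^+ b * sig * S f - B%:R * kap).
Proof. by rewrite mulr_ge0 ?(ltW eta0) //; apply: sumr_ge0 => f _; apply: sumr_ge0 => b _; exact: expR_ge0. Qed.

Let PhiT n B t S : Psi n B t S <= 1 -> Phi t (n + M * B) <= T n B.
Proof.
move=> h; rewrite -[leRHS]mul1r -ler_pdivrMr //.
by apply: le_trans h; rewrite lerDl.
Qed.

Let T_lt n B : T n B < expR (- ((n + M * B + M)%:R * s)).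
Proof.
have -> : - ((n + M * B + M)%:R * s) = - (M%:R * s) + (- (n%:R * s) + - ((M * B)%:R * s)).
  by rewrite !natrD; ring.
rewrite !expRD mulrA; apply: (@lt_le_trans _ _ (expR (- (M%:R * s)) * expR (- (n%:R * s)) * expR (- ((M * B)%:R * s2)))).
  by rewrite ltr_pM2r ?expR_gt0 // ltr_pM2r ?expR_gt0.
rewrite ler_pM2l ?mulr_gt0 ?expR_gt0 // ler_expR lerN2 ler_wpM2l //; exact: ltW.
Qed.

Let lam_mid k x : lam ^+ k * (x * lam ^- (k + M)) = x / lam ^+ M.
Proof. by rewrite exprD invfM mulrCA (mulrA (lam ^+ k)) lamXV mul1r. Qed.

(** On average over the q children, the potential is divided by at least exp (M s2)
    and each exponential moment is multiplied by at most exp kap; so the mean of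
    Psi does not increase. *)
Lemma free_step n B t S : Psi n B t S <= 1 -> exists d : 'I_q,
  Psi n B.+1 (t + d%:R * lam ^- (n + M * B + M))
    (fun f => S f + (blk (g f) M (lam ^+ (n + M * B) * t + d%:R / lam ^+ M) 0 - mean f)) <= 1.
Proof.
move=> hPsi; apply: exists_le_avg => //; rewrite big_split /= mulr1.
apply: (@le_trans _ _ (q%:R * Psi n B t S)); last by rewrite ger_pMr ?ltr0n.
rewrite mulrDr; apply: lerD.
  rewrite -mulr_suml ler_pdivrMr // mulnSr addnA.
  apply: le_trans (Phi_split _ _ _ _ qM _) _.
    by apply: le_lt_trans (T_lt n B); exact: PhiT hPsi.
  have -> : - ((M * B + M)%:R * s2) = - ((M * B)%:R * s2) + - (M%:R * s2) by rewrite natrD; ring.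
  rewrite expRD.
  have : 2 * Phi t (n + M * B) <= q%:R * expR (- (M%:R * s2)) * Phi t (n + M * B) by rewrite ler_wpM2r.
  move=> /le_trans; apply; rewrite le_eqVlt; apply/orP; left; apply/eqP.
  by field; rewrite !gt_eqF ?expR_gt0.
rewrite -mulr_sumr mulrCA ler_pM2l // exchange_big /= mulr_sumr; apply: ler_sum => f _.
rewrite exchange_big /= mulr_sumr; apply: ler_sum => b _.
rewrite (eq_bigr (fun d : 'I_q => expR ((-1) ^+ b * sig * S f - B%:R * kap) * expR (- kap) *
   expR ((-1) ^+ b * sig * (blk (g f) M (lam ^+ (n + M * B) * t + d%:R / lam ^+ M) 0 - mean f)))); last first.
  by move=> d _; rewrite -!expRD -(natr1 B); congr expR; ring.
rewrite -mulr_sumr mulrC.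
apply: (@le_trans _ _ (q%:R * expR kap * (expR ((-1) ^+ b * sig * S f - B%:R * kap) * expR (- kap)))).
  by rewrite ler_pM2r ?mulr_gt0 ?expR_gt0 //; exact: tilt.
rewrite le_eqVlt; apply/orP; left; apply/eqP; rewrite expRN; field; by rewrite gt_eqF ?expR_gt0.
Qed.

(** Psi starts at most 1/2 + 1/2, from the potential and from the 2 #|I| moments
    weighted by eta. *)
Lemma free_blocks n t B : Phi t n <= theta * expR (- (n%:R * s)) -> exists t' S,
  [/\ t <= t', t' + lam ^- (n + M * B) <= t + lam ^- n, Psi n B t' S <= 1 &
   forall u f, t' <= u <= t' + lam ^- (n + M * B) ->
     `|Bsum (g f) (M * B) (pt (lam ^+ n * u) 0) - (M * B)%:R * mean f - M%:R * S f| <= (M * B)%:R * e].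
Proof.
move=> h; elim: B => [|B [t' [S [h1 h2 h3 h4]]]].
  exists t, (fun=> 0); rewrite muln0 addn0; split=> //.
    rewrite (mul0r s2) oppr0 expR0 (mulr1 (_ * _)) [leRHS](_ : 1 = 1 / 2 + 1 / 2); last by field.
    apply: lerD; last first.
      apply: le_trans etaI; rewrite ler_pM2l // (eq_bigr (fun=> 2)); first by rewrite sumr_const mulr_natr.
      by move=> f _; rewrite big_bool /= !mulr0 mul0r subrr expR0.
    rewrite ler_pdivrMr ?mulr_gt0 ?expR_gt0 //; apply: (le_trans h).
    by rewrite le_eqVlt; apply/orP; left; apply/eqP; field.
  by move=> u f _; rewrite /Bsum big_ord0 !mul0r mulr0 !subr0 normr0.
have [d hd] := free_step _ _ _ _ h3.
have l0 := @lamV_gt0 R (n + M * B + M).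
have dM : d.+1%:R <= lam ^+ M by apply: le_trans qM; rewrite ler_nat.
have ltd : d%:R * lam ^- (n + M * B + M) + lam ^- (n + M * B + M) <= lam ^- (n + M * B).
  rewrite -[X in _ + X]mul1r -mulrDl natr1 [X in _ / X]exprD invfM mulrCA ger_pMr ?lamV_gt0 //.
  by rewrite ler_pdivrMr ?lamX_gt0 // mul1r.
have d0 : 0 <= d%:R * lam ^- (n + M * B + M) by rewrite mulr_ge0 // ltW.
exists (t' + d%:R * lam ^- (n + M * B + M)),
  (fun f => S f + (blk (g f) M (lam ^+ (n + M * B) * t' + d%:R / lam ^+ M) 0 - mean f)).
rewrite mulnSr addnA; split; last 1 first.
- move=> u f hu; rewrite BsumD iter_cat_pt mulr0.
  have hu' : t' <= u <= t' + lam ^- (n + M * B).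
    move/andP: hu => [u1 u2]; apply/andP; split.
      by apply: le_trans u1; rewrite lerDl.
    by apply: (le_trans u2); rewrite -addrA lerD2l.
  have := h4 u f hu'; set b1 := Bsum _ _ _ => hb1.
  set p := lam ^+ (M * B) * _.
  have hp : `|p - (lam ^+ (n + M * B) * t' + d%:R / lam ^+ M)| <= 4 / lam ^+ M.
    have -> : p = lam ^+ (n + M * B) * u by rewrite /p mulrA -exprD addnC.
    have -> : d%:R / lam ^+ M = lam ^+ (n + M * B) * (d%:R * lam ^- (n + M * B + M)).
      by rewrite lam_mid.
    rewrite -mulrDr -mulrBr lamX_norm.
    have -> : 4 / lam ^+ M = lam ^+ (n + M * B) * (4 * lam ^- (n + M * B + M)).
      by rewrite lam_mid.
    rewrite ler_pM2l ?lamX_gt0 // ger0_norm ?subr_ge0; last by case/andP: hu.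
    rewrite lerBlDl (le_trans (proj2 (andP hu))) // lerD2l ler_peMl ?(ltW l0) //; exact: (ler_nat R 1 4).
  have hz : `|(0 : R) - 0| <= 4 by rewrite subrr normr0.
  have := shadow f p 0 _ 0 hp hz.
  set b2 := blk (g f) M (_ + _) 0 => hb2.
  have -> : Bsum (g f) M (pt p 0) = M%:R * blk (g f) M p 0.
    by rewrite blk_Bsum mulVKf // gt_eqF // ltr0n.
  rewrite natrD [leRHS]mulrDl.
  have -> : b1 + M%:R * blk (g f) M p 0 - ((M * B)%:R + M%:R) * mean f - M%:R * (S f + (b2 - mean f)) =
    (b1 - (M * B)%:R * mean f - M%:R * S f) + M%:R * (blk (g f) M p 0 - b2) by ring.
  by rewrite (le_trans (ler_normD _ _)) // lerD // normrM normr_nat ler_wpM2l.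
- by rewrite (le_trans h1) // lerDl.
- by rewrite (le_trans _ h2) // -addrA lerD2l.
- by have := hd; rewrite mulnSr addnA; exact.
Qed.

End free_phase.

(** * Large deviations during a free phase *)

Section stage_constants.
Context {R : realType}.
Local Notation T2 := (torus R).
Local Notation lam := (lam R).

Lemma common_bound (I : finType) (P : I -> nat -> Prop) :
  (forall i, exists m0, forall m, (m0 <= m)%N -> P i m) ->
  exists m0, forall m, (m0 <= m)%N -> forall i, P i m.
Proof.
move=> /choice[m hm]; exists (\max_i m i) => k hk i; apply: hm.
by apply: leq_trans hk; exact: leq_bigmax.
Qed.

Lemma cts_bounded_family (I : finType) (g : I -> T2 -> R) : (forall i, continuous (g i)) ->
  exists2 C : R, 0 < C & forall i x, `|g i x| <= C.
Proof.
move=> cg; have h i : exists C : R, 0 < C /\ forall x, `|g i x| <= C.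
  by have [C C0 hC] := cts_bounded _ (cg i); exists C.
have [C hC] := choice h; exists (1 + \sum_i C i) => [|i x].
  by rewrite ltr_pwDl // sumr_ge0 // => i _; rewrite ltW // (hC i).1.
apply: (le_trans ((hC i).2 x)); rewrite (bigD1 i) //= addrCA lerDl.
by rewrite addr_ge0 // sumr_ge0 // => j _; rewrite ltW // (hC j).1.
Qed.

Lemma Bsum_bound (g : T2 -> R) (C : R) n x : (forall x, `|g x| <= C) -> `|Bsum g n x| <= n%:R * C.
Proof.
move=> hC; rewrite /Bsum (le_trans (ler_norm_sum _ _ _)) // mulr_natl.
by rewrite -[X in _ *+ X](card_ord n) -sumr_const; apply: ler_sum.
Qed.

Lemma blk_bound (g : T2 -> R) (C : R) M a b : (0 < M)%N -> (forall x, `|g x| <= C) -> `|blk g M a b| <= C.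
Proof.
move=> M0 hC; rewrite blk_Bsum normrM gtr0_norm ?invr_gt0 ?ltr0n // ler_pdivrMl ?ltr0n //.
exact: Bsum_bound.
Qed.

Lemma Int_bound (m : probability T2 R) (g : T2 -> R) (C : R) : continuous g -> (forall x, `|g x| <= C) ->
  `|\int[m]_x g x| <= C.
Proof.
move=> cg hC; rewrite ler_norml; apply/andP; split.
  by apply: Int_ge_cst; [exact: cts_bmf|move=> x; have := hC x; rewrite ler_norml => /andP[]].
by apply: Int_le_cst; [exact: cts_bmf|move=> x; have := hC x; rewrite ler_norml => /andP[]].
Qed.

(** lam^M exceeds exp (M s2) by the factor exp (M (ln lam - s2)), which is eventually
    more than 3. *)
Lemma truncn_lam (s2 : R) : 0 < s2 -> s2 < ln lam -> exists M0, forall M, (M0 <= M)%N ->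
  2 <= (Num.truncn (lam ^+ M))%:R * expR (- (M%:R * s2)).
Proof.
move=> s0 hs; have d0 : 0 < ln lam - s2 by rewrite subr_gt0.
exists (Num.truncn (3 / (ln lam - s2))).+1 => M hM.
rewrite expRN ler_pdivlMr ?expR_gt0 //.
have /andP[q1 q2] := truncn_itv (ltW (@lamX_gt0 R M)).
have hM' : 3 <= M%:R * (ln lam - s2).
  by rewrite -ler_pdivrMr //; apply/ltW/(lt_le_trans (truncnS_gt _)); rewrite ler_nat.
have h3 : 3 <= expR (M%:R * (ln lam - s2)) by apply: le_trans (expR_ge1Dx _); lra.
have el : lam ^+ M = expR (M%:R * (ln lam - s2)) * expR (M%:R * s2).
  rewrite -expRD -mulrDr subrK expRM_natl lnK // posrE; exact: lam_gt0.
have h1 : 1 <= expR (M%:R * s2) by apply: le_trans (expR_ge1Dx _); rewrite lerDl mulr_ge0 // ltW.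
have h4 : 3 * expR (M%:R * s2) <= lam ^+ M by rewrite el ler_pM2r // expR_gt0.
move: q2; rewrite -natr1; lra.
Qed.

Lemma tilt_both (I : finType) (g : I -> T2 -> R) (mean : I -> R) M q (C sig e : R) :
  (0 < M)%N -> (0 < q)%N -> 0 <= sig -> sig * (2 * C) <= 1 / 2 ->
  (forall i x, `|g i x| <= C) -> (forall i, `|mean i| <= C) ->
  (forall i a b, `|q%:R^-1 * (\sum_(d < q) blk (g i) M (a + d%:R / lam ^+ M) b) - mean i| <= e) ->
  forall i (b : bool) a c,
   \sum_(d < q) expR ((-1) ^+ b * sig * (blk (g i) M (a + d%:R / lam ^+ M) c - mean i))
    <= q%:R * expR (sig * e + 2 * (sig * (2 * C)) ^+ 2).
Proof.
move=> M0 q0 s0 sC hC hm he i b a c.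
under eq_bigr do rewrite -mulrA mulrCA.
apply: chernoff_step => // [d|].
  rewrite normrM normrX normrN1 expr1n mul1r (le_trans (ler_normB _ _)) // (_ : 2 * C = C + C); last by ring.
  by rewrite lerD // blk_bound.
rewrite -mulr_sumr sumrB sumr_const card_ord mulrCA mulrBr avg_const ?gt_eqF ?ltr0n //.
apply: le_trans (he i a c); apply: le_trans (ler_norm _) _.
by rewrite normrM normrX normrN1 expr1n mul1r.
Qed.

End stage_constants.

Section free_conclusion.
Context {R : realType}.
Local Notation T2 := (torus R).
Local Notation lam := (lam R).

Variables (s s2 : R).
Hypothesis s0 : 0 < s.
Hypothesis ss2 : s < s2.
Hypothesis s2ll : s2 < ln lam.
(** Both signs of the tilt being controlled, so is the absolute value of S. *)
Lemma tilted_sum_bound (I : finType) (S : I -> R) (P eta sig K : R) : 0 <= P -> 0 < eta ->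
  P + eta * \sum_(f : I) \sum_(b : bool) expR ((-1) ^+ b * sig * S f - K) <= 1 ->
  0 < sig -> forall f, sig * `|S f| <= K + eta^-1.
Proof.
move=> P0 eta0 h sig0 f.
have hb (b : bool) : (-1) ^+ b * sig * S f - K <= eta^-1.
  have h1 : eta * expR ((-1) ^+ b * sig * S f - K) <= 1.
    apply: le_trans h; rewrite -[leLHS]add0r lerD // ler_pM2l //.
    rewrite (bigD1 f) //= -[leLHS]addr0 lerD //.
      by rewrite (bigD1 b) //= lerDl sumr_ge0 // => *; exact: expR_ge0.
    by apply: sumr_ge0 => j _; apply: sumr_ge0 => *; exact: expR_ge0.
  move: h1; rewrite -ler_pdivlMl // mulr1; apply: le_trans; apply: le_trans (expR_ge1Dx _); lra.
have := hb true; have := hb false; rewrite expr0 expr1.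
by case: (ger0P (S f)) => _; lra.
Qed.

Lemma enough_blocks (M N0 n k1 k2 : nat) : (0 < M)%N -> exists B,
  [/\ (n < n + M * B)%N, (N0 <= n + M * B)%N, (n + k1 <= B)%N, (k2 <= B)%N & (B <= M * B)%N].
Proof.
move=> M0; exists (N0 + n + k1 + k2 + 1)%N.
have : (N0 + n + k1 + k2 + 1 <= M * (N0 + n + k1 + k2 + 1))%N by rewrite leq_pmull.
by move=> h; split; lia.
Qed.

(** As many blocks as wanted make the averages of the functions g i over the whole
    past close to their integrals, and let the potential fall below
    exp (- n s) by a factor that is exponential in n. *)
Lemma free_phase (I : finType) (g : I -> T2 -> R) (m : probability T2 R) (eps : R) :
  (forall i, continuous (g i)) -> transl_inv m -> 0 < eps ->
  exists2 theta : R, 0 < theta & forall Phi, potential s Phi -> forall (kap' : R), 0 < kap' -> forall n t N0,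
  Phi t n <= theta * expR (- (n%:R * s)) ->
  exists t' n', [/\ t <= t' /\ t' + lam ^- n' <= t + lam ^- n, (n < n')%N /\ (N0 <= n')%N,
    Phi t' n' <= kap' * expR (- (n'%:R * s)) * expR (- (n'%:R * ((s2 - s) / 2))) &
    forall u i, t' <= u <= t' + lam ^- n' ->
      `|Bsum (g i) n' (pt u 0) - n'%:R * \int[m]_x g i x| <= n'%:R * eps].
Proof.
move=> cg hm eps0.
have [C C0 hC] := cts_bounded_family _ _ cg.
pose mean i := \int[m]_x g i x.
have hmean i : `|mean i| <= C by apply: Int_bound.
pose e := eps / 8; have e0 : 0 < e by rewrite divr_gt0.
have [M1 hM1] := common_bound _ _ (fun i => blk_equi (g i) e (cg i) e0).
have [M2 hM2] := common_bound _ _ (fun i => blk_shadow (g i) e (cg i) e0).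
have [M3 hM3] := truncn_lam s2 (lt_trans s0 ss2) s2ll.
pose M := (maxn 1 (maxn M1 (maxn M2 M3))).
have M0 : (0 < M)%N by rewrite /M leq_max.
have {}hM1 := hM1 M (ltac:(rewrite /M; lia)).
have {}hM2 := hM2 M (ltac:(rewrite /M; lia)).
have {}hM3 := hM3 M (ltac:(rewrite /M; lia)).
pose q := Num.truncn (lam ^+ M); rewrite -/q in hM3.
have /andP[q1 q2] := truncn_itv (ltW (@lamX_gt0 R M)); rewrite -/q in q1 q2.
have q0 : (0 < q)%N by rewrite truncn_gt0 lamX_ge1.
have hq : lam ^+ M - 1 <= q%:R <= lam ^+ M + 1.
  by rewrite -natr1 in q2; apply/andP; split; lra.
(* the first bound makes [chernoff_step] available, the second one absorbs its
   quadratic term in the linear one *)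
pose sig := Num.min (1 / (4 * C)) (e / (8 * C ^+ 2)).
have sig0 : 0 < sig by rewrite lt_min !divr_gt0 // mulr_gt0 // exprn_gt0.
have sC : sig * (2 * C) <= 1 / 2.
  apply: (@le_trans _ _ (1 / (4 * C) * (2 * C))).
    by rewrite ler_pM2r ?mulr_gt0 // ge_min lexx.
  by rewrite le_eqVlt; apply/orP; left; apply/eqP; field; rewrite gt_eqF.
have sC2 : 2 * (sig * (2 * C)) ^+ 2 <= sig * e.
  have h : sig * (8 * C ^+ 2) <= e.
    by rewrite -ler_pdivlMr ?mulr_gt0 ?exprn_gt0 // ge_min lexx orbT.
  have -> : 2 * (sig * (2 * C)) ^+ 2 = sig * (sig * (8 * C ^+ 2)) by ring.
  by rewrite ler_pM2l.
pose kap := 2 * (sig * e).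
have tilt : forall f (b : bool) a c,
  \sum_(d < q) expR ((-1) ^+ b * sig * (blk (g f) M (a + d%:R / lam ^+ M) c - mean f)) <= q%:R * expR kap.
  move=> f b a c; apply: le_trans (tilt_both _ _ mean M q C sig e M0 q0 (ltW sig0) sC hC hmean _ f b a c) _.
    by move=> i a' b'; exact: (hM1 i q hq m hm a' b').
  by rewrite ler_pM2l ?ltr0n // ler_expR /kap; lra.
pose eta : R := (4 * (#|I|%:R + 1))^-1.
have I1 : 0 < #|I|%:R + 1 :> R by rewrite ltr_pwDr.
have eta0 : 0 < eta by rewrite invr_gt0 mulr_gt0.
have etaI : eta * (2 * #|I|%:R) <= 1 / 2.
  rewrite /eta ler_pdivrMl ?mulr_gt0 //; lra.
pose theta := expR (- (M%:R * s)) / 4.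
have theta0 : 0 < theta by rewrite divr_gt0 // expR_gt0.
have thetaM : 2 * theta < expR (- (M%:R * s)).
  by rewrite /theta; have := expR_gt0 (- (M%:R * s)); lra.
have theta1 : 2 * theta < 1.
  by apply: (lt_le_trans thetaM); rewrite -expR0 ler_expR oppr_le0 mulr_ge0 // ltW.
have etas0 : 0 < eta * sig by rewrite mulr_gt0.
have s2s : 0 < s2 - s by rewrite subr_gt0.
exists theta => // Phi hPhi kap' kap'0 n t N0 h.
have natub (x : R) : exists k : nat, x <= k%:R by exists (Num.truncn x).+1; exact/ltW/truncnS_gt.
have [k1 hk1] := natub (2 / (kap' * (s2 - s))).
have [k2 hk2] := natub ((2 * (n%:R * C) + M%:R / (eta * sig)) / (5 * e)).
have [B [B1 B2 B3 B4 B5]] := enough_blocks M N0 n k1 k2 M0.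
have [t' [S [h1 h2 h3 h4]]] := free_blocks Phi s s2 ss2 hPhi I g mean M q sig kap e theta eta
  M0 q0 q1 hM3 theta0 thetaM eta0 etaI tilt hM2 n t B h.
exists t', (n + M * B)%N; split => //.
- have hP : Phi t' (n + M * B) <= 2 * theta * expR (- (n%:R * s)) * expR (- ((M * B)%:R * s2)).
    rewrite -[leRHS]mul1r -ler_pdivrMr ?mulr_gt0 ?expR_gt0 //.
    apply: le_trans h3; rewrite lerDl mulr_ge0 ?(ltW eta0) //.
    by apply: sumr_ge0 => f _; apply: sumr_ge0 => b _; exact: expR_ge0.
  apply: (le_trans hP).
  (* exp (- x) is the part of the gain that remains once the factor
     exp (- n' (s2 - s) / 2) of the conclusion has been taken out *)
  pose x := ((M * B)%:R - n%:R) * ((s2 - s) / 2).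
  have xk : kap'^-1 <= x.
    have hB : 2 / (kap' * (s2 - s)) <= (M * B)%:R - n%:R.
      rewrite lerBrDl; apply: (@le_trans _ _ B%:R); last by rewrite ler_nat.
      apply: (@le_trans _ _ (n + k1)%:R); first by rewrite natrD lerD2l.
      by rewrite ler_nat.
    apply: (@le_trans _ _ (2 / (kap' * (s2 - s)) * ((s2 - s) / 2))); last by rewrite ler_pM2r // divr_gt0.
    by rewrite le_eqVlt; apply/orP; left; apply/eqP; field; rewrite !gt_eqF.
  rewrite -(mulrA (2 * theta)).
  have -> : expR (- (n%:R * s)) * expR (- ((M * B)%:R * s2)) =
     expR (- ((n + M * B)%:R * s)) * expR (- ((n + M * B)%:R * ((s2 - s) / 2))) * expR (- x).
    by rewrite -!expRD; congr expR; rewrite /x !natrD; field.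
  have ex : expR (- x) <= kap'.
    rewrite expRN -[leRHS]invrK lef_pV2 ?posrE ?invr_gt0 ?expR_gt0 //.
    by apply: (le_trans xk); apply: le_trans (expR_ge1Dx _); rewrite lerDr.
  rewrite -[leRHS]mulrA [leRHS]mulrC mulrCA ler_pM2l ?mulr_gt0 ?expR_gt0 //.
  by rewrite (le_trans _ ex) // ler_piMl ?expR_ge0 // ltW.
move=> u i hu; have {}h4 := h4 u i hu.
have PT : 0 <= Phi t' (n + M * B) / (2 * theta * expR (- (n%:R * s)) * expR (- ((M * B)%:R * s2))).
  by case: hPhi => hPhi0 _ _; rewrite divr_ge0 // !mulr_ge0 ?expR_ge0 // ltW.
have hS := tilted_sum_bound _ S _ eta sig (B%:R * kap) PT eta0 h3 sig0 i.
have {}hS : `|S i| <= B%:R * (2 * e) + (eta * sig)^-1.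
  rewrite -(ler_pM2l sig0); apply: (le_trans hS); rewrite le_eqVlt; apply/orP; left; apply/eqP.
  by rewrite /kap; field; rewrite !gt_eqF.
have hB : 2 * (n%:R * C) + M%:R / (eta * sig) <= B%:R * (5 * e).
  rewrite -ler_pdivrMr ?mulr_gt0 //.
  by apply: (le_trans hk2); rewrite ler_nat.
rewrite BsumD iter_cat_pt mulr0.
have hn := Bsum_bound _ _ n (pt u 0) (hC i).
have hmn : `|n%:R * mean i| <= n%:R * C by rewrite normrM normr_nat ler_wpM2l.
set b1 := Bsum _ n _ in hn *; set b2 := Bsum _ (M * B) _ in h4 *.
have hMS : `|M%:R * S i| <= (M * B)%:R * (2 * e) + M%:R / (eta * sig).
  rewrite normrM normr_nat natrM -(mulrA M%:R B%:R) -mulrDr ler_pM2l ?ltr0n //.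
have -> : b1 + b2 - (n + M * B)%:R * \int[m]_x g i x = 
   (b1 - n%:R * mean i) + ((b2 - (M * B)%:R * mean i - M%:R * S i) + M%:R * S i).
  by rewrite natrD /mean; ring.
have hMB : B%:R * (5 * e) <= (M * B)%:R * (5 * e).
  by rewrite ler_pM2r ?mulr_gt0 // ler_nat.
apply: (le_trans (ler_normD _ _)); apply: (le_trans (lerD (ler_normB _ _) (ler_normD _ _))).
have hne : 0 <= n%:R * eps by rewrite mulr_ge0 // ltW.
have ee : eps = 8 * e by rewrite /e; field.
rewrite natrD [leRHS]mulrDl; move: hne hn hmn h4 hMS hB hS hMB; rewrite ee; set x := (M * B)%:R.
set y := M%:R / _; set z := n%:R * C; move=> hne hn hmn h4 hMS hB _ hMB.
apply: (le_trans (lerD (lerD hn hmn) (lerD h4 hMS))); lra.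
Qed.

End free_conclusion.

(** * Forced phases and stages *)

Section stage.
Context {R : realType}.
Local Notation T2 := (torus R).
Local Notation lam := (lam R).

(** Two steps stretch a cell to an unstable segment of length lam^2 > 3, and every
    point y lies within stable distance 2 of such a segment; the points of the
    segment near that place follow the orbit of y for l steps, and fill a cell. *)
Lemma forced_phase (psi : T2 -> R) (delta : R) : continuous psi -> 0 < delta ->
  exists M0, forall l, (M0 <= l)%N -> forall n t y, exists t',
   [/\ t <= t', t' + lam ^- (n + 2 + l) <= t + lam ^- n & forall u, t' <= u <= t' + lam ^- (n + 2 + l) ->
     `|Bsum psi l (pt (lam ^+ (n + 2) * u) 0) - Bsum psi l y| <= l%:R * delta].
Proof.
move=> cpsi d0; have [M0 hM0] := blk_shadow psi delta cpsi d0.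
exists (maxn 1 M0) => l; rewrite geq_max => /andP[l0 /hM0 {hM0}hl] n t y.
have [a [b [ey /andP[a0 a2] b2]]] := pt_bounded (tshift (- (lam ^+ (n + 2) * t)) 0 y).
have {}ey : y = pt (a + lam ^+ (n + 2) * t) b.
  have [a' [b' [ey' _ _]]] := pt_bounded y; rewrite ey' tshift_pt addr0 in ey.
  have := ptD _ _ _ _ (lam ^+ (n + 2) * t) 0 ey; rewrite !addr0 subrK => <-; exact: ey'.
have p0 := @lamV_gt0 R (n + 2); have p1 := @lamV_gt0 R (n + 2 + l).
have pl : lam ^- (n + 2 + l) = lam ^- (n + 2) * lam ^- l by rewrite exprD; exact: invfM.
have pn : 3 * lam ^- (n + 2) <= lam ^- n.
  rewrite exprD invfM mulrCA ger_pMr ?lamV_gt0 // ler_pdivrMr ?lamX_gt0 // mul1r.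
  by have := @lam_gt52 R; rewrite expr2; nra.
exists (t + a * lam ^- (n + 2)); split.
- by rewrite lerDl mulr_ge0 // ltW.
- rewrite -addrA lerD2l; apply: le_trans pn; rewrite pl -[X in _ + X]mulrC -mulrDl ler_pM2r //.
  by have := @lamV_le1 R l; lra.
move=> u /andP[u1 u2].
have h (x : R) c : Bsum psi l (pt x c) = l%:R * blk psi l x c.
  by rewrite blk_Bsum mulVKf // gt_eqF // ltr0n.
rewrite ey !h -mulrBr normrM normr_nat ler_pM2l ?ltr0n //; apply: hl; last first.
  by rewrite sub0r normrN (le_trans b2) //; lra.
have -> : lam ^+ (n + 2) * u - (a + lam ^+ (n + 2) * t) = lam ^+ (n + 2) * (u - (t + a * lam ^- (n + 2))).
  by rewrite mulrBr mulrDr mulrCA lamXV mulr1 (addrC a).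
rewrite lamX_norm ger0_norm ?subr_ge0 //.
apply: (@le_trans _ _ (lam ^+ (n + 2) * lam ^- (n + 2 + l))).
  by rewrite ler_pM2l ?lamX_gt0 // lerBlDl.
by rewrite pl mulrA lamXV mul1r ler_peMl ?(ltW (@lamV_gt0 R l)) // (ler_nat R 1 4).
Qed.

Lemma forced_gain (x1 x2 x3 y N L c C delta r eps : R) : 0 < delta -> 0 < r -> r <= 1 -> eps <= delta * r ->
  0 <= N -> 0 <= L -> L <= r * N -> r * N < L + 1 -> 2 * delta + 4 * C <= L * delta ->
  `|c| <= C -> `|x1 - N * c| <= N * eps -> `|x2| <= 2 * C -> `|x3 - y| <= L * delta ->
  L * (c + 4 * delta) <= y -> (N + 2 + L) * (c + delta * r / 4) <= x1 + x2 + x3.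
Proof.
move=> d0 r0 r1 he N0 L0 l1 l2 hL; rewrite !ler_norml => /andP[c1 c2] /andP[h1 _] /andP[h2 _] /andP[h3 _] hy.
have e1 : N * eps <= delta * (L + 1).
  apply: (@le_trans _ _ (N * (delta * r))); first by rewrite ler_wpM2l.
  by rewrite mulrCA ler_pM2l // mulrC ltW.
have e2 : delta * r * (N + 2 + L) <= delta * (2 * L + 3).
  rewrite -mulrA ler_pM2l //; have : r * L <= L by rewrite ler_piMl.
  lra.
lra.
Qed.

Variables (s s2 : R).
Hypothesis s0 : 0 < s.
Hypothesis ss2 : s < s2.
Hypothesis s2ll : s2 < ln lam.
Variables (psi : T2 -> R) (m : probability T2 R) (delta r : R).
Hypothesis cpsi : continuous psi.
Hypothesis hm : transl_inv m.
Hypothesis delta0 : 0 < delta.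
Hypothesis high : forall l, exists y, l%:R * (\int[m]_x psi x + 4 * delta) <= Bsum psi l y.
Hypothesis r0 : 0 < r.
Hypothesis r1 : r <= 1.
Hypothesis rs : r * s <= (s2 - s) / 2.

(** A free phase up to time n1, then a forced phase of length about r n1 along an
    orbit with a high average of psi. The condition on r says that the
    potential gained in the first covers the loss in the second. *)
Lemma stage (I : finType) (g : I -> T2 -> R) (i0 : I) (eps : R) :
  (forall i, continuous (g i)) -> g i0 = psi -> 0 < eps -> eps <= delta * r ->
  exists2 theta : R, 0 < theta & forall Phi, potential s Phi -> forall kap' : R, 0 < kap' -> forall n t N0,
  Phi t n <= theta * expR (- (n%:R * s)) ->
  exists t' n1 n2, [/\ t <= t' /\ t' + lam ^- n2 <= t + lam ^- n, [/\ (n < n1)%N, (n1 < n2)%N & (N0 <= n1)%N],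
    Phi t' n2 <= kap' * expR (- (n2%:R * s)) & forall u, t' <= u <= t' + lam ^- n2 ->
      (forall i, `|Bsum (g i) n1 (pt u 0) - n1%:R * \int[m]_x g i x| <= n1%:R * eps) /\
      n2%:R * (\int[m]_x psi x + delta * r / 4) <= Bsum psi n2 (pt u 0)].
Proof.
move=> cg gi0 eps0 epsle.
have [C C0 hC] := cts_bounded _ cpsi; set c := \int[m]_x psi x.
have hc : `|c| <= C by exact: Int_bound.
have [theta theta0 hfree] := free_phase s s2 s0 ss2 s2ll I g m eps cg hm eps0.
have [M0 hforce] := forced_phase psi delta cpsi delta0.
exists theta => // Phi [Phi_ge0 Phi_mono Phi_split] kap' kap'0 n t N0 hPhi.
have natub (x : R) : exists k : nat, x <= k%:R by exists (Num.truncn x).+1; exact/ltW/truncnS_gt.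
have [k1 hk1] := natub ((2 * delta + 4 * C) / delta).
have [k2 hk2] := natub ((M0 + k1)%:R / r).
have kap0 : 0 < kap' * expR (- (2 * s)) by rewrite mulr_gt0 // expR_gt0.
have [t1 [n1 [[t11 t12] [n11 n12] hP h1]]] := hfree Phi (And3 Phi_ge0 Phi_mono Phi_split) _ kap0 n t (maxn N0 k2) hPhi.
move: n12; rewrite geq_max => /andP[n12 n13].
have rn0 : 0 <= r * n1%:R by rewrite mulr_ge0 // ltW.
pose l := Num.truncn (r * n1%:R).
have /andP[l1 l2] : l%:R <= r * n1%:R < l.+1%:R by exact: truncn_itv.
have Ml : (M0 + k1 <= l)%N.
  by rewrite /l truncn_ge_nat // mulrC -ler_pdivrMr // (le_trans hk2) // ler_nat.
have [y hy] := high l.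
have [t' [t1' t2' h2]] := hforce l (leq_trans (leq_addr _ _) Ml) n1 t1 y.
exists t', n1, (n1 + 2 + l)%N; split.
- by split; [exact: le_trans t1'|exact: le_trans t12].
- by split=> //; rewrite -addnA -[X in (X < _)%N]addn0 ltn_add2l.
- apply: (le_trans (Phi_mono _ _ _ _ t1' t2')); apply: (le_trans hP).
  rewrite -!mulrA ler_pM2l // -!expRD ler_expR !natrD.
  have : l%:R * s <= n1%:R * (r * s) by rewrite mulrA ler_pM2r // mulrC.
  have : n1%:R * (r * s) <= n1%:R * ((s2 - s) / 2) by rewrite ler_wpM2l.
  lra.
move=> u hu.
have hu1 : t1 <= u <= t1 + lam ^- n1.
  by case/andP: hu => u1 u2; rewrite (le_trans t1' u1) (le_trans u2).
have {}h1 i := h1 u i hu1; split=> //.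
have {}h2 := h2 u hu; have := h1 i0; rewrite gi0 -/c => h3.
rewrite !BsumD !iter_cat_pt mulr0.
have h4 := Bsum_bound psi C 2 (pt (lam ^+ n1 * u) 0) hC.
rewrite !natrD; apply: (forced_gain _ _ _ (Bsum psi l y) _ _ c C delta r eps) => //.
  by rewrite natr1.
  rewrite -ler_pdivrMr // (le_trans hk1) // ler_nat; exact: leq_trans (leq_addl _ _) Ml.
by rewrite mulr0.
Qed.

End stage.

(** * Iterating the stages *)

Section nested_cells.
Context {R : realType}.
Local Notation lam := (lam R).

(** The supremum of the left ends. *)
Lemma nested_point (t : nat -> R) (n : nat -> nat) :
  (forall l, t l <= t l.+1 /\ t l.+1 + lam ^- (n l.+1) <= t l + lam ^- (n l)) ->
  exists u, forall l, t l <= u <= t l + lam ^- (n l).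
Proof.
move=> h.
have h1 l j : t l <= t (l + j)%N.
  elim: j => [|j IH]; first by rewrite addn0.
  by rewrite addnS (le_trans IH) // (h _).1.
have h2 l j : t (l + j)%N + lam ^- (n (l + j)%N) <= t l + lam ^- (n l).
  elim: j => [|j IH]; first by rewrite addn0.
  by rewrite addnS (le_trans _ IH) // (h _).2.
have ub l j : t j <= t l + lam ^- (n l).
  have hl k : t k <= t k + lam ^- (n k) by rewrite lerDl ltW // lamV_gt0.
  have [le|/ltnW le] := leqP l j.
    by rewrite -(subnKC le) (le_trans (hl _)).
  by apply: le_trans (hl l); have := h1 j (l - j)%N; rewrite subnKC.
exists (sup (range t)) => l; apply/andP; split.
  apply: ub_le_sup; last by exists l.
  by exists (t l + lam ^- (n l)) => _ [j _ <-].
apply: ge_sup; first by exists (t 0%N), 0%N.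
by move=> _ [j _ <-].
Qed.

(** A stage ends below the threshold of the next one, so that dependent choice
    chains them; u is the common point of the cells. *)
Lemma iterate_stages (Phi : R -> nat -> R) (s : R) (theta : nat -> R) (P : nat -> R -> nat -> nat -> Prop) t0 n0 :
  (forall l n t, Phi t n <= theta l * expR (- (n%:R * s)) ->
     exists t' n1 n2, [/\ t <= t' /\ t' + lam ^- n2 <= t + lam ^- n, (n < n1)%N /\ (n1 < n2)%N,
       Phi t' n2 <= theta l.+1 * expR (- (n2%:R * s)) & forall u, t' <= u <= t' + lam ^- n2 -> P l u n1 n2]) ->
  Phi t0 n0 <= theta 0%N * expR (- (n0%:R * s)) ->
  exists u (N1 N2 : nat -> nat), [/\ t0 <= u <= t0 + lam ^- n0, (forall l, [/\ l < N1 l, N1 l < N2 l & N2 l < N1 l.+1])%N,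
    forall l, P l u (N1 l) (N2 l) &
    forall l, exists t n, [/\ (l <= n)%N, t <= u <= t + lam ^- n & Phi t n <= theta l * expR (- (n%:R * s))]].
Proof.
move=> step h0.
have {}step (x : nat * (nat * R)) : exists z : R * (nat * nat),
   Phi x.2.2 x.2.1 <= theta x.1 * expR (- (x.2.1%:R * s)) ->
   [/\ x.2.2 <= z.1 /\ z.1 + lam ^- z.2.2 <= x.2.2 + lam ^- x.2.1, (x.2.1 < z.2.1)%N /\ (z.2.1 < z.2.2)%N,
       Phi z.1 z.2.2 <= theta x.1.+1 * expR (- (z.2.2%:R * s)) &
       forall u, z.1 <= u <= z.1 + lam ^- z.2.2 -> P x.1 u z.2.1 z.2.2].
  have [h|nh] := pselect (Phi x.2.2 x.2.1 <= theta x.1 * expR (- (x.2.1%:R * s))); last by exists (0 : R, (0%N, 0%N)).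
  by have [t' [n1 [n2 hz]]] := step x.1 x.2.1 x.2.2 h; exists (t', (n1, n2)).
have [F hF] := choice step.
pose st := fix st l : R * (nat * nat) := if l is l'.+1 then F (l', ((st l').2.2, (st l').1)) else (t0, (n0, n0)).
have inv l : Phi (st l).1 (st l).2.2 <= theta l * expR (- ((st l).2.2%:R * s)).
  by elim: l => [//|l IH]; have [_ _ + _] := hF (l, ((st l).2.2, (st l).1)) IH.
have hst l := hF (l, ((st l).2.2, (st l).1)) (inv l).
have [u hu] := nested_point (fun l => (st l).1) (fun l => (st l).2.2) (fun l => let: And4 h _ _ _ := hst l in h).
have ln l : (l <= (st l).2.2)%N.
  by elim: l => [//|l IH]; have [_ [/= h1 h2] _ _] := hst l; apply: leq_ltn_trans IH (ltn_trans h1 h2).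
exists u, (fun l => (st l.+1).2.1), (fun l => (st l.+1).2.2); split.
- exact: hu 0%N.
- move=> l; have [_ [h1 h2] _ _] := hst l; have [_ [h3 _] _ _] := hst l.+1; split=> //.
  exact: leq_ltn_trans (ln l) h1.
- by move=> l; have [_ _ _ h] := hst l; apply: h; exact: hu l.+1.
by move=> l; exists (st l).1, (st l).2.2; split.
Qed.

End nested_cells.

(** * Weak convergence and partitions of unity *)

Section weak_convergence.
Context {R : realType}.
Local Notation T2 := (torus R).
Local Notation lam := (lam R).

(** The weak topology is induced by the product topology on the integrals. *)
Lemma Mweak_cvg (nu_ : nat -> probability T2 R) (nu : probability T2 R) :
  (forall chi : T2 -> R, continuous chi -> (fun j => \int[nu_ j]_x chi x) @ \oo --> \int[nu]_x chi x) ->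
  (fun j => nu_ j : Mweak R) @ \oo --> (nu : Mweak R).
Proof.
move=> h.
have hc : (@integration R \o nu_) @ \oo --> (integration nu : {ptws (continuousType T2 R) -> R}).
  apply/cvg_sup => chi U [V] [[W] oW <-] Wchi WU.
  have /(h chi (@cts_fun _ _ chi)) hW : nbhs (\int[nu]_x chi x) W by apply: open_nbhs_nbhs; split.
  by apply: (filterS WU); apply: filterS hW.
move=> W; rewrite /= nbhsE => -[V [[B oB <-] BV] VW].
have : nbhs (integration nu : {ptws (continuousType T2 R) -> R}) B by apply: open_nbhs_nbhs; split.
move=> /hc hB; have {hB} : \forall j \near \oo, B (integration (nu_ j)) by exact: hB.
by move=> [N _ hN]; exists N => // j /hN hj; exact: VW.
Qed.

(** Adding a constant reduces to nonnegative functions. *)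
Lemma empirical_int (f : T2 -> T2) x n (chi : T2 -> R) : continuous chi ->
  \int[(empirical f x n : probability T2 R)]_y chi y = birkhoff_avg f chi x n.+1.
Proof.
move=> cchi; have [C C0 hC] := cts_bounded _ cchi.
have b0 : bmf chi by exact: cts_bmf.
have b1 : bmf (fun y => chi y + C) by apply: bmfD => //; exact: bmf_cst.
suff h : \int[(empirical f x n : probability T2 R)]_y (chi y + C) = birkhoff_avg f (fun y => chi y + C) x n.+1.
  rewrite IntD // in h; last exact: bmf_cst.
  apply: (addIr C); rewrite -{1}(Int_cst (empirical f x n) C) h /birkhoff_avg big_split /= mulrDr.
  by rewrite sumr_const card_ord avg_const.
have p0 y : 0 <= chi y + C by have := hC y; rewrite ler_norml; lra.
rewrite /Rintegral ge0_integral_mscale //=; last 2 first.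
- by apply/measurable_EFinP; exact: b1.1.
- by move=> y _; rewrite lee_fin.
rewrite ge0_integral_measure_sum //=; last 2 first.
- by move=> y _; rewrite lee_fin.
- by apply/measurable_EFinP; exact: b1.1.
rewrite (eq_bigr (fun i : 'I_n.+1 => (chi (iter i f x) + C)%:E)); last first.
  move=> i _; rewrite integral_dirac //; last by apply/measurable_EFinP; exact: b1.1.
  by rewrite diracT mul1e.
by rewrite sumEFin -EFinM.
Qed.

End weak_convergence.

Lemma cts_sum {R : realType} (I : Type) (s : seq I) (F : I -> torus R -> R) :
  (forall i, continuous (F i)) -> continuous (fun x => \sum_(i <- s) F i x).
Proof.
move=> h; elim: s => [|i s IH].
  by apply: cts_td => x e e0; exists 1 => // y _; rewrite !big_nil subrr normr0.
rewrite (_ : (fun x => _) = (fun x => F i x + \sum_(j <- s) F j x)); last by apply/funext => x; rewrite big_cons.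
by move=> x; apply: continuousD; [exact: h|exact: IH].
Qed.

Section partition_of_unity.
Context {R : realType}.
Local Notation T2 := (torus R).
Local Notation lam := (lam R).
Variable l : nat.

Definition hat_sum (x : T2) : R := \sum_p compl_dist (gcell l p) x.
(** A partition of unity subordinate to the cover by the squares gcell. *)
Definition hat (p : 'I_l.+1 * 'I_l.+1) (x : T2) : R := compl_dist (gcell l p) x / hat_sum x.

Lemma hat_sum_gt0 x : 0 < hat_sum x.
Proof.
have [p hp] := gcell_cover l x.
rewrite /hat_sum (bigD1 p) //= ltr_pwDl ?compl_dist_gt0 //; first exact: gcell_open.
by apply: sumr_ge0 => q _; exact: compl_dist_ge0.
Qed.

Lemma hat_sum_cts : continuous hat_sum.
Proof. by apply: cts_sum => p; exact: compl_dist_cts. Qed.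

Lemma hat_cts p : continuous (hat p).
Proof.
move=> x; apply: continuousM; first exact: compl_dist_cts.
by apply: continuousV; [rewrite gt_eqF // hat_sum_gt0|exact: hat_sum_cts].
Qed.

Lemma hat_ge0 p x : 0 <= hat p x.
Proof. by rewrite divr_ge0 ?compl_dist_ge0 // ltW // hat_sum_gt0. Qed.

Lemma hat_sum1 x : \sum_p hat p x = 1.
Proof. by rewrite -mulr_suml divff // gt_eqF // hat_sum_gt0. Qed.

Lemma hat_out p x : ~ gcell l p x -> hat p x = 0.
Proof. by move=> h; rewrite /hat compl_dist_out // mul0r. Qed.

Lemma hat_approx (chi : T2 -> R) (e : R) (c : 'I_l.+1 * 'I_l.+1 -> T2) : (forall p, gcell l p (c p)) ->
  (forall x y, td x y < 8 * l.+1%:R^-1 -> `|chi x - chi y| < e) ->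
  forall x, `|chi x - \sum_p chi (c p) * hat p x| <= e.
Proof.
move=> hc he x; rewrite -[X in `|X - _|]mulr1 -(hat_sum1 x) mulr_sumr -sumrB.
apply: (le_trans (ler_norm_sum _ _ _)).
rewrite -[e]mulr1 -(hat_sum1 x) mulr_sumr; apply: ler_sum => p _.
rewrite -mulrBl normrM (ger0_norm (hat_ge0 p x)).
have [hx|nhx] := pselect (gcell l p x); last by rewrite hat_out // !mulr0.
by rewrite ler_wpM2r ?hat_ge0 // ltW // he //; exact: gcell_diam hx (hc p).
Qed.

End partition_of_unity.

(** * Genericity from finitely many tests at each scale *)

Section generic_point.
Context {R : realType}.
Local Notation T2 := (torus R).
Local Notation lam := (lam R).
Local Notation cat := (@cat_map R).
Variables (m : probability T2 R) (x0 : T2).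

Lemma gcell_inh l (p : 'I_l.+1 * 'I_l.+1) : exists x : T2, gcell l p x.
Proof.
pose z : 'rV[R]_2 := \row_j (if j == 0 then p.1%:R / l.+1%:R else p.2%:R / l.+1%:R).
by exists (tproj z), z; rewrite !mxE /= !subrr normr0 invr_gt0 ltr0n.
Qed.

(** A continuous chi is within e / 4 of a combination of the (l + 1)^2 functions
    hat l p with bounded coefficients, so an error (l + 1)^-3 for each of them is
    small enough. *)
Lemma tests_weak (N : nat -> nat) : (forall l, l < N l)%N ->
  (forall l p, `|Bsum (hat l p) (N l) x0 - (N l)%:R * \int[m]_x hat l p x| <= (N l)%:R * l.+1%:R ^- 3) ->
  forall chi : T2 -> R, continuous chi ->
   (fun l => (N l)%:R^-1 * Bsum chi (N l) x0) @ \oo --> \int[m]_x chi x.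
Proof.
move=> hN ht chi cchi; have [C C0 hC] := cts_bounded _ cchi.
apply/cvgrPdist_le => e e0.
have e4 : 0 < e / 4 by rewrite divr_gt0.
have [d d0 hd] := cts_unif _ cchi _ e4.
exists (Num.truncn (8 / d) + Num.truncn (2 * C / e))%N => // l /= hl.
have l0 : 0 < l.+1%:R :> R by [].
have dl : 8 * l.+1%:R^-1 <= d.
  rewrite ler_pdivrMr // mulrC -ler_pdivrMr //; apply/ltW/(lt_le_trans (truncnS_gt _)).
  by rewrite ler_nat ltnS (leq_trans _ hl) // leq_addr.
have cl : C * l.+1%:R^-1 <= e / 2.
  rewrite ler_pdivrMr // mulrC -ler_pdivrMr ?divr_gt0 //.
  have -> : C / (e / 2) = 2 * C / e by field; rewrite gt_eqF.
  by apply/ltW/(lt_le_trans (truncnS_gt _)); rewrite ler_nat ltnS (leq_trans _ hl) // leq_addl.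
have Nl : 0 < (N l)%:R :> R by rewrite ltr0n (leq_trans _ (hN l)).
have [c hc] := choice (gcell_inh l).
have happ := hat_approx l chi (e / 4) c hc (fun x y h => hd x y (lt_le_trans h dl)).
pose app x := \sum_p chi (c p) * hat l p x.
have capp : continuous app.
  apply: cts_sum => p x; apply: continuousM; last exact: hat_cts.
  by move: x; apply: cts_td => x e' e'0; exists 1 => // y _; rewrite subrr normr0.
have Iapp : \int[m]_x app x = \sum_p chi (c p) * \int[m]_x hat l p x.
  rewrite /app Int_sum; last by move=> p; apply: bmfZ; apply: cts_bmf; exact: hat_cts.
  by apply: eq_bigr => p _; rewrite IntZ //; apply: cts_bmf; exact: hat_cts.
have Bapp : Bsum app (N l) x0 = \sum_p chi (c p) * Bsum (hat l p) (N l) x0.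
  by rewrite /Bsum /app exchange_big /=; apply: eq_bigr => p _; rewrite mulr_sumr.
have h1 : `|\int[m]_x chi x - \int[m]_x app x| <= e / 4.
  have -> : \int[m]_x chi x - \int[m]_x app x = \int[m]_x (chi x + -1 * app x).
    rewrite IntD; [|exact: cts_bmf|by apply: bmfZ; exact: cts_bmf].
    by rewrite IntZ ?mulN1r //; exact: cts_bmf.
  have cd : bmf (fun x => chi x + -1 * app x).
    by apply: bmfD; [exact: cts_bmf|apply: bmfZ; exact: cts_bmf].
  rewrite ler_norml; apply/andP; split.
    by apply: Int_ge_cst => // x; have := happ x; rewrite mulN1r ler_norml => /andP[].
  by apply: Int_le_cst => // x; have := happ x; rewrite mulN1r ler_norml => /andP[].
have h2 : `|(N l)%:R^-1 * Bsum app (N l) x0 - (N l)%:R^-1 * Bsum chi (N l) x0| <= e / 4.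
  rewrite -mulrBr -sumrB normrM gtr0_norm ?invr_gt0 // ler_pdivrMl // (le_trans (ler_norm_sum _ _ _)) //.
  rewrite mulr_natl -[X in _ <= _ *+ X](card_ord (N l)) -sumr_const; apply: ler_sum => i _.
  by rewrite distrC; exact: happ.
have h3 : `|\int[m]_x app x - (N l)%:R^-1 * Bsum app (N l) x0| <= e / 2.
  rewrite Iapp Bapp mulr_sumr -sumrB (le_trans (ler_norm_sum _ _ _)) //.
  apply: (@le_trans _ _ (\sum_(p : 'I_l.+1 * 'I_l.+1) C * l.+1%:R ^- 3)).
    apply: ler_sum => p _; rewrite mulrCA -mulrBr normrM; apply: ler_pM => //.
    rewrite distrC -(ler_pM2l Nl) -[X in X * `|_|](gtr0_norm Nl) -normrM mulrBr mulrA divff ?gt_eqF // mul1r.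
    exact: ht.
  rewrite sumr_const card_prod !card_ord; apply: le_trans cl.
  rewrite -(mulr_natl (C * _)) natrM le_eqVlt; apply/orP; left; apply/eqP; field; by rewrite gt_eqF.
move: h1 h2 h3; rewrite !ler_norml; lra.
Qed.

End generic_point.

(** * A historic point avoiding light families of balls *)

Lemma oscillation {R : realType} (a : nat -> R) (c d : R) (N1 N2 : nat -> nat) : 0 < d ->
  (forall l, l <= N1 l)%N -> (forall l, l <= N2 l)%N ->
  (forall l, `|a (N1 l) - c| <= l.+1%:R^-1) -> (forall l, c + d <= a (N2 l)) -> ~ cvg (a @ \oo).
Proof.
move=> d0 n1 n2 h1 h2 /cvgrPdist_lt hc.
have d4 : 0 < d / 4 by rewrite divr_gt0.
have [N _ hN] := hc _ d4; set L := lim _ in hN.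
pose l := (N + Num.truncn (4 / d))%N.
have hl : l.+1%:R^-1 <= d / 4.
  rewrite -[leRHS]invrK lef_pV2 ?posrE ?invr_gt0 // invf_div; apply/ltW/(lt_le_trans (truncnS_gt _)).
  by rewrite ler_nat ltnS leq_addl.
have := hN _ (leq_trans (leq_addr _ _) (n1 l)); have := hN _ (leq_trans (leq_addr _ _) (n2 l)).
move: (h1 l) (h2 l) hl; rewrite /= !ltr_norml ler_norml; set x := l.+1%:R^-1; lra.
Qed.

Section conjugate.
Context {R : realType}.
Local Notation T2 := (torus R).
Local Notation lam := (lam R).
Local Notation cat := (@cat_map R).
Variables (f h hi : T2 -> T2).
Hypothesis ch : continuous h.
Hypothesis chi : continuous hi.
Hypothesis hK : cancel h hi.
Hypothesis hiK : cancel hi h.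
Hypothesis hf : forall x, h (cat x) = f (h x).

Lemma iter_conj n x : iter n f (h x) = h (iter n cat x).
Proof. by elim: n => //= n ->; rewrite hf. Qed.

Lemma birkhoff_conj (phi : T2 -> R) x n : birkhoff_avg f phi (h x) n = n%:R^-1 * Bsum (phi \o h) n x.
Proof. by congr (_ * _); apply: eq_bigr => i _; rewrite iter_conj. Qed.

(** Two points of a piece of unstable line that share a Bowen ball of length L stay
    close for L steps after the conjugacy is undone, so expansiveness bounds
    their distance by a multiple of lam^-L. *)
Lemma ball_narrow : exists2 e0 : R, 0 < e0 & forall y L (u v : R), (0 < L)%N ->
  0 <= u <= 1 / 4 -> 0 <= v <= 1 / 4 ->
  bowen_ball f L y e0 (h (pt u 0)) -> bowen_ball f L y e0 (h (pt v 0)) -> `|u - v| < lam ^- L / 2.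
Proof.
have d0 : 0 < 1 / 16 :> R by rewrite divr_gt0.
have [d dd hd] := ctst_unif _ chi _ d0.
exists (d / 4) => [|y [//|n] u v _ hu hv bu bv]; first by rewrite divr_gt0.
have hlt i : (i <= n)%N -> td (iter i cat (pt u 0)) (iter i cat (pt v 0)) < 1 / 16.
  move=> hi'; rewrite -[X in td X _]hK -[X in td _ X]hK; apply: hd.
  apply: le_lt_trans (td_triangle (iter i f y) _ _) _.
  have := tdist_td _ _ _ (bu i hi'); have := tdist_td _ _ _ (bv i hi').
  by rewrite !iter_conj (td_sym _ (h (iter i cat (pt u 0)))); lra.
have [a' [b' [ev ha hb]]] := expansive _ n u 0 (pt v 0) (lexx _) hlt.
have /pt_eq hl := ev.
have ha' : `|u - a'| < 1 / 16.
  by apply: le_lt_trans ha; rewrite ler_peMl // lamX_ge1.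
have hva : `|v - a'| < 1 / 2.
  by move: ha' hu hv; rewrite !ltr_norml => ? /andP[? ?] /andP[? ?]; lra.
have hvb : `|0 - b'| < 1 / 2 by apply: (lt_trans hb); lra.
have [/eqP + _] := lat0 _ _ hl hva hvb; rewrite subr_eq0 => /eqP ->.
have l3 := @lam_lt3 R; have l0 := @lam_gt0 R.
rewrite mulrC ltr_pdivlMr ?lamX_gt0 // mulrC exprS -mulrA.
have : lam * (lam ^+ n * `|u - a'|) <= 3 * (lam ^+ n * `|u - a'|).
  by rewrite ler_wpM2r ?mulr_ge0 ?(ltW l3) // ltW // lamX_gt0.
move: ha; set z := lam ^+ n * _; lra.
Qed.

Section avoiding_point.
Variables (m nu0 : probability T2 R) (phi : T2 -> R) (delta e0 : R).
Hypothesis hm : transl_inv m.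
Hypothesis nu0E : forall A, measurable A -> m (h @^-1` A) = nu0 A.
Hypothesis cphi : continuous phi.
Hypothesis delta0 : 0 < delta.
Let psi := phi \o h.
Hypothesis high : forall l, exists y, l%:R * (\int[m]_x psi x + 4 * delta) <= Bsum psi l y.
Hypothesis narrow : forall y L (u v : R), (0 < L)%N ->
  0 <= u <= 1 / 4 -> 0 <= v <= 1 / 4 ->
  bowen_ball f L y e0 (h (pt u 0)) -> bowen_ball f L y e0 (h (pt v 0)) -> `|u - v| < lam ^- L / 2.

Lemma generic_limit x0 (N1 N2 : nat -> nat) :
  (forall l, [/\ l < N1 l, N1 l < N2 l & N2 l < N1 l.+1])%N ->
  (forall l p, `|Bsum (hat l p) (N1 l) x0 - (N1 l)%:R * \int[m]_x hat l p x| <= (N1 l)%:R * l.+1%:R ^- 3) ->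
  empirical_limits f (h x0) nu0.
Proof.
move=> hN ht; exists (fun j => (N1 j).-1).
  apply: homo_ltn => [j i k|i]; first exact: ltn_trans.
  have [h1 h2 h3] := hN i; have := ltn_trans h2 h3; lia.
apply: Mweak_cvg => chi0 cchi0.
have cc : continuous (chi0 \o h) by move=> x; apply: continuous_comp; [exact: ch|exact: cchi0].
have -> : \int[nu0]_x chi0 x = \int[m]_x (chi0 \o h) x.
  by rewrite -(Int_comp _ _ m nu0 h chi0) //; [exact: ctst_meas|exact: cts_bmf].
rewrite (_ : (fun j => _) = (fun l => (N1 l)%:R^-1 * Bsum (chi0 \o h) (N1 l) x0)).
  by apply: tests_weak => // l; have [a _ _] := hN l.
apply/funext => l; rewrite empirical_int // birkhoff_conj prednK //.
by have [a _ _] := hN l; apply: leq_ltn_trans a.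
Qed.

(** The l-th stage tests phi and the functions hat l p, with an error tending to 0
    and thresholds theta l. The threshold kappa is that of the first stage, taken
    on the cell [0, lam^-n0], so it is the same for all families C. Along the
    stages the potential tends to 0, hence falls below the weight of each ball:
    the limit point is in none of them. *)
Lemma avoiding_point (s : R) : 0 < s -> s < ln lam -> exists2 kappa : R, 0 < kappa &
  forall C : set (T2 * nat), (\esum_(k in C) (expR (- (k.2%:R * s)))%:E < kappa%:E)%E ->
  exists x, [/\ historic f phi x, empirical_limits f x nu0 & forall k, C k -> ~ bowen_ball f k.2 k.1 e0 x].
Proof.
move=> s0 sll.
pose s2 := (s + ln lam) / 2.
have ss2 : s < s2 by rewrite /s2; lra.
have s2ll : s2 < ln lam by rewrite /s2; lra.
(* during the forced phase exp (- n s) loses a factor exp (- r s n), which is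
   no more than what the free phase gains *)
pose r := Num.min 1 ((s2 - s) / (2 * s)).
have r0 : 0 < r by rewrite lt_min ltr01 divr_gt0 ?mulr_gt0 // subr_gt0.
have r1 : r <= 1 by rewrite ge_min lexx.
have rs : r * s <= (s2 - s) / 2.
  apply: (@le_trans _ _ ((s2 - s) / (2 * s) * s)); first by rewrite ler_pM2r // ge_min lexx orbT.
  by rewrite le_eqVlt; apply/orP; left; apply/eqP; field; rewrite gt_eqF.
have cpsi : continuous psi by move=> x; apply: continuous_comp; [exact: ch|exact: cphi].
pose I l : finType := option ('I_l.+1 * 'I_l.+1).
pose g l (i : I l) : T2 -> R := if i is Some p then hat l p else psi.
pose eps l : R := Num.min (delta * r) (l.+1%:R ^- 3).
have eps0 l : 0 < eps l by rewrite lt_min mulr_gt0 //= invr_gt0 exprn_gt0.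
have cg l (i : I l) : continuous (g l i) by case: i => [p|] //=; exact: hat_cts.
have hst l := stage s s2 s0 ss2 s2ll psi m delta r cpsi hm delta0 high r0 r1 rs (I l) (g l) None (eps l)
  (cg l) erefl (eps0 l) (ltac:(by rewrite ge_min lexx)).
have {}hst l : exists theta : R, [/\ 0 < theta, theta <= 1 & forall Phi, potential s Phi ->
   forall kap' : R, 0 < kap' -> forall n t, Phi t n <= theta * expR (- (n%:R * s)) ->
   exists t' n1 n2, [/\ t <= t' /\ t' + lam ^- n2 <= t + lam ^- n, (n < n1)%N /\ (n1 < n2)%N,
    Phi t' n2 <= kap' * expR (- (n2%:R * s)) & forall u, t' <= u <= t' + lam ^- n2 ->
      (forall i, `|Bsum (g l i) n1 (pt u 0) - n1%:R * \int[m]_x g l i x| <= n1%:R * eps l) /\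
      n2%:R * (\int[m]_x psi x + delta * r / 4) <= Bsum psi n2 (pt u 0)]].
  have [th th0 hth] := hst l; exists (Num.min th 1); split.
  - by rewrite lt_min th0 ltr01.
  - by rewrite ge_min lexx orbT.
  move=> Phi hPhi kap' k0 n t hle.
  have {}hle : Phi t n <= th * expR (- (n%:R * s)).
    by apply: (le_trans hle); rewrite ler_pM2r ?expR_gt0 // ge_min lexx.
  have [t' [n1 [n2 [a [b c _] d e]]]] := hth Phi hPhi kap' k0 n t 0%N hle.
  by exists t', n1, n2; split.
have [theta hth] := choice hst.
have [n0 hn0] := lamV_small (1 / 4 : R) (ltac:(by rewrite divr_gt0)).
have {hn0} hn0 := hn0 n0 (leqnn _).
pose kappa := theta 0%N * expR (- (n0%:R * s)).
have [th0 th1 _] := hth 0%N.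
have kap0 : 0 < kappa by rewrite mulr_gt0 // expR_gt0.
have kap1 : kappa <= 1.
  by rewrite mulr_ile1 ?expR_ge0 ?(ltW th0) // -expR0 ler_expR oppr_le0 mulr_ge0 // ltW.
exists kappa => // C hC.
pose D (k : T2 * nat) : set R := [set u | 0 <= u <= 1 / 4 /\ bowen_ball f k.2 k.1 e0 (h (pt u 0))].
(* a ball of length 0, which is the whole torus, would have weight 1 *)
have len0 k : C k -> (0 < k.2)%N.
  move=> Ck; rewrite lt0n; apply/eqP => k0.
  have : (1%:E <= \esum_(k in C) (expR (- (k.2%:R * s)))%:E)%E.
    apply: esum_ge; exists [set k]; first by split; [exact: finite_set1|move=> ? ->].
    by rewrite fsbig_set1 k0 mul0r oppr0 expR0.
  by move=> /le_lt_trans/(_ hC); rewrite lte_fin ltNge kap1.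
have hnar k : C k -> forall u v, D k u -> D k v -> `|u - v| < lam ^- k.2 / 2.
  by move=> Ck u v [u1 u2] [v1 v2]; exact: narrow k.1 _ _ _ (len0 k Ck) u1 v1 u2 v2.
have fin := lt_trans hC (ltry kappa).
pose Ph := Phi _ C (fun k : T2 * nat => k.2) D s.
have hPh : potential s Ph.
  split.
  - exact: Phi_ge0.
  - move=> t n t' n'; exact: Phi_mono.
  - move=> t n M q; exact: Phi_split.
have start : Ph 0 n0 <= theta 0%N * expR (- (n0%:R * s)).
  by apply: ltW; exact: Phi_total.
have [u [N1 [N2 [hu hN htest hcell]]]] := iterate_stages Ph s theta
  (fun l u n1 n2 => (forall i : I l, `|Bsum (g l i) n1 (pt u 0) - n1%:R * \int[m]_x g l i x| <= n1%:R * eps l) /\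
      n2%:R * (\int[m]_x psi x + delta * r / 4) <= Bsum psi n2 (pt u 0)) 0 n0
  (fun l n t hle => let: And3 _ _ H := hth l in H Ph hPh (theta l.+1) (let: And3 H' _ _ := hth l.+1 in H') n t hle) start.
exists (h (pt u 0)); split.
- rewrite /historic /=.
  apply: (oscillation _ (\int[m]_x psi x) (delta * r / 4) N1 N2).
  + by rewrite divr_gt0 // mulr_gt0.
  + by move=> l; have [/ltnW] := hN l.
  + by move=> l; have [h1 h2 _] := hN l; exact: ltnW (ltn_trans h1 h2).
  + move=> l; have [h1 _ _] := hN l; have [+ _] := htest l => /(_ None) /= h2.
    have Nl : 0 < (N1 l)%:R :> R by rewrite ltr0n (leq_ltn_trans _ h1).
    rewrite birkhoff_conj -(ler_pM2l Nl) -[X in X * `|_|](gtr0_norm Nl) -normrM mulrBr mulrA divff ?gt_eqF // mul1r.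
    apply: (le_trans h2); rewrite ler_pM2l // ge_min; apply/orP; right.
    rewrite lef_pV2 ?posrE ?exprn_gt0 // ler_eXnr // ler1n //.
  + move=> l; have [h1 h2 _] := hN l; have [_ h3] := htest l.
    have Nl : 0 < (N2 l)%:R :> R by rewrite ltr0n (leq_ltn_trans _ h2).
    by rewrite birkhoff_conj -(ler_pM2l Nl) mulrA divff ?gt_eqF // mul1r.
- apply: (generic_limit _ N1 N2 hN) => l p; have [+ _] := htest l => /(_ (Some p)) /= h2.
  by apply: (le_trans h2); rewrite ler_wpM2l // ge_min lexx orbT.
move=> k Ck bk.
have [t [n [ln hc hP]]] := hcell k.2.+1.
have Dk : D k u.
  split=> //; case/andP: hu => u1 u2; rewrite u1 (le_trans u2) // add0r ltW //.
have := Phi_ge _ C (fun k : T2 * nat => k.2) D s fin t n k Ck (ex_intro2 _ _ u Dk hc).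
move=> /le_trans/(_ hP) /=; apply/negP; rewrite -ltNge.
have [th0' th1' _] := hth k.2.+1.
apply: (@le_lt_trans _ _ (expR (- (n%:R * s)))); first by rewrite ger_pMl ?expR_gt0.
by rewrite ltr_expR ltrN2 ltr_pM2r // ltr_nat.
Qed.

End avoiding_point.

End conjugate.

(** * Topological entropy of subsets *)

(** Repetitions in the enumeration g only decrease the left-hand side. *)
Lemma esum_image_le {R : realType} (K : choiceType) (F : K -> \bar R) (g : nat -> K) (B : R) n :
  (forall k, 0 <= F k)%E -> (forall i, F (g i) <= B%:E)%E ->
  (\esum_(k in g @` `I_n) F k <= (n%:R * B)%:E)%E.
Proof.
move=> F0 FB; elim: n => [|n IH].
  by rewrite II0 image_set0 esum_set0 mul0r.
rewrite -natr1 mulrDl mul1r EFinD.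
apply: (@le_trans _ _ (\esum_(k in g @` `I_n) F k + \esum_(k in [set g n]) F k)%E); last first.
  by rewrite leeD // esum_set1.
rewrite !(esum_mkcond _ F) -esumD; try by move=> k _; case: ifP.
apply: le_esum => k _; case: ifPn => [/set_mem[i /= hi <-]|_]; last first.
  by rewrite adde_ge0 //; case: ifP.
move: hi; rewrite ltnS leq_eqVlt => /orP[/eqP->|hi].
  by rewrite (@mem_set _ [set g n] (g n)) // leeDr //; case: ifP.
have -> : g i \in g @` `I_n by apply/mem_set; exists i.
by rewrite leeDl //; case: ifP.
Qed.

Section entropy_of_sets.
Context {R : realType}.
Local Notation T2 := (torus R).
Local Notation lam := (lam R).
Local Notation cat := (@cat_map R).
Variables (f h hi : T2 -> T2).
Hypothesis ch : continuous h.
Hypothesis chi : continuous hi.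
Hypothesis hK : cancel h hi.
Hypothesis hiK : cancel hi h.
Hypothesis hf : forall x, h (cat x) = f (h x).

(** Points spaced by lam^-n in the unstable and by a constant in the stable
    direction. *)
Lemma spanning (e : R) : 0 < e -> exists2 D : R, 0 < D & forall n, exists K (c : nat -> T2),
  K%:R <= D * lam ^+ n /\ forall y, exists2 k, (k < K)%N & bowen_ball f n (c k) e y.
Proof.
move=> e0; have [d dd hd] := ctst_unif _ ch _ (divr_gt0 e0 (ltr0n _ 2)).
(* at every time both coordinates of the difference will be at most del *)
pose del := d / 3; have del0 : 0 < del by rewrite divr_gt0.
pose K2 := (Num.truncn (4 / del)).+1.
exists ((2 / del + 1) * K2%:R) => [|n].
  by rewrite mulr_gt0 ?ltr0n // addr_gt0 // divr_gt0.
pose K1 := (Num.truncn (2 * lam ^+ n / del)).+1.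
have ln := @lamX_gt0 R n.
exists (K1 * K2)%N, (fun k => h (pt ((k %/ K2)%:R * (del * lam ^- n)) (-2 + (k %% K2)%:R * del))); split.
  rewrite natrM [leRHS]mulrAC ler_pM2r ?ltr0n // [leRHS]mulrDl mul1r /K1 -(natr1 (Num.truncn _)).
  apply: lerD; last exact: lamX_ge1.
  by rewrite [leRHS]mulrAC truncn_le // !mulr_ge0 ?invr_ge0 ?(ltW ln) ?(ltW del0).
move=> y; have [a [b [ey /andP[a0 a2] hb]]] := pt_bounded (hi y).
have {}ey : y = h (pt a b) by rewrite -ey hiK.
have b0 : 0 <= (b + 2) / del by rewrite divr_ge0 ?(ltW del0) //; move: hb; rewrite ler_norml; lra.
have b4 : (b + 2) / del <= 4 / del by rewrite ler_pM2r ?invr_gt0 //; move: hb; rewrite ler_norml; lra.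
have aa0 : 0 <= a * lam ^+ n / del by rewrite !mulr_ge0 ?invr_ge0 ?(ltW ln) ?(ltW del0).
have aa2 : a * lam ^+ n / del <= 2 * lam ^+ n / del by rewrite ler_pM2r ?invr_gt0 // ler_pM2r.
have /andP[i1 i2] := truncn_itv aa0; have /andP[j1 j2] := truncn_itv b0.
set i := Num.truncn (a * lam ^+ n / del) in i1 i2.
set j := Num.truncn ((b + 2) / del) in j1 j2.
have iK : (i < K1)%N by rewrite ltnS le_truncn.
have jK : (j < K2)%N by rewrite ltnS le_truncn.
exists (i * K2 + j)%N; first by rewrite -ltn_divLR // divnMDl // divn_small // addn0.
rewrite divnMDl // divn_small // addn0 modnMDl modn_small // ey => k kn.
rewrite !(iter_conj f h hf) !iter_cat_pt.
rewrite (_ : e = 2 * (e / 2)); last by field.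
apply: td_tdist; apply: hd; apply: le_lt_trans (td_pt _ _ _ _) _.
rewrite -!mulrBr lamX_norm lamV_norm.
have hA : `|i%:R * (del * lam ^- n) - a| <= del * lam ^- n.
  have hdl : 0 < del * lam ^- n by rewrite mulr_gt0 // lamV_gt0.
  have ea : a = a * lam ^+ n / del * (del * lam ^- n).
    by rewrite mulrA divfK ?gt_eqF // -mulrA lamXV mulr1.
  rewrite distrC [in X in `|X|]ea -mulrBl normrM (gtr0_norm hdl) ler_piMl ?(ltW hdl) //.
  by rewrite ger0_norm ?subr_ge0 // lerBlDl natr1 ltW.
have hB : `|-2 + j%:R * del - b| <= del.
  have -> : -2 + j%:R * del - b = (j%:R - (b + 2) / del) * del by field; rewrite gt_eqF.
  rewrite normrM (gtr0_norm del0) ler_piMl ?(ltW del0) //.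
  by rewrite distrC ger0_norm ?subr_ge0 // lerBlDl natr1 ltW.
have h1 : lam ^+ k * `|i%:R * (del * lam ^- n) - a| <= del.
  apply: (@le_trans _ _ (lam ^+ n * (del * lam ^- n))); last by rewrite mulrCA lamXV mulr1.
  apply: ler_pM => //; first exact: ltW (lamX_gt0 _).
  by rewrite ler_eXn2l ?lam_gt1 // ltnW.
have h2 : lam ^- k * `|-2 + j%:R * del - b| <= del.
  by rewrite (le_trans _ hB) // ler_piMl // lamV_le1.
apply: (le_lt_trans (lerD h1 h2)); rewrite /del; lra.
Qed.

(** At most D lam^n balls of weight exp (- n s), with s > ln lam. *)
Lemma bowen_m_zero Z s e : 0 < e -> ln lam < s -> bowen_m f Z s e = 0%E.
Proof.
move=> e0 hs; rewrite /bowen_m (_ : (fun N => _) = fun=> 0%E); first exact: lim_cst.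
apply/funext => N; apply/eqP; rewrite eq_le; apply/andP; split; last first.
  by apply: le_ereal_inf_tmp => _ [C _ <-]; apply: esum_ge0 => c _; rewrite lee_fin expR_ge0.
have [D D0 hD] := spanning e e0.
apply/lee_addgt0Pr => eta eta0; rewrite add0e.
have d0 : 0 < s - ln lam by rewrite subr_gt0.
pose n := maxn N (Num.truncn (D / eta / (s - ln lam))).+1.
have [K [c [hK' hc]]] := hD n.
pose g k := (c k, n).
apply: ge_ereal_inf; exists (\esum_(x in g @` `I_K) (expR (- (x.2%:R * s)))%:E).
  exists (g @` `I_K) => //; split.
  - by apply: finite_set_countable; apply: finite_image; exact: finite_II.
  - by move=> _ [k _ <-]; rewrite /= leq_maxl.
  - by move=> y _; have [k kK hk] := hc y; exists (g k) => //; exists k.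
apply: le_trans (esum_image_le _ _ g (expR (- (n%:R * s))) K _ _) _.
- by move=> k; rewrite lee_fin expR_ge0.
- by move=> i; rewrite lee_fin.
rewrite lee_fin; apply: (@le_trans _ _ (D * lam ^+ n * expR (- (n%:R * s)))).
  by rewrite ler_pM2r ?expR_gt0.
have -> : D * lam ^+ n * expR (- (n%:R * s)) = D / expR (n%:R * (s - ln lam)).
  rewrite -expRN -mulrA; congr (_ * _); rewrite -{1}(lnK (_ : lam \is Num.pos)) ?posrE ?lam_gt0 //.
  by rewrite -expRM_natl -expRD; congr expR; ring.
rewrite ler_pdivrMr ?expR_gt0 // -ler_pdivrMl // mulrC.
apply: le_trans (expR_ge1Dx _); apply: (@le_trans _ _ (n%:R * (s - ln lam))); last by rewrite lerDr.
rewrite -ler_pdivrMr //; apply/ltW/(lt_le_trans (truncnS_gt _)); rewrite ler_nat /n; exact: leq_maxr.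
Qed.

Variables (Z : set T2) (e0 : R).
Hypothesis avoid : forall s, 0 < s -> s < ln lam -> exists2 kappa : R, 0 < kappa &
  forall C : set (T2 * nat), (\esum_(k in C) (expR (- (k.2%:R * s)))%:E < kappa%:E)%E ->
  exists x, Z x /\ forall k, C k -> ~ bowen_ball f k.2 k.1 e0 x.

(** The weight decreases with s, so s may be taken positive; and balls of a smaller
    radius are smaller. *)
Lemma bowen_m_pos s e : e <= e0 -> s < ln lam -> bowen_m f Z s e <> 0%E.
Proof.
move=> ee0 hs.
have ll0 : 0 < ln lam by apply: ln_gt0; exact: lam_gt1.
pose s1 := Num.max s (ln lam / 2).
have s1l : s1 < ln lam by rewrite gt_max hs; lra.
have s10 : 0 < s1 by rewrite lt_max divr_gt0 // orbT.
have [kap kap0 hav] := avoid s1 s10 s1l.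
have hN N : (kap%:E <= bowen_mN f Z s N e)%E.
  apply: le_ereal_inf_tmp => _ [C [_ _ hC] <-]; rewrite leNgt; apply/negP => lt.
  have lt1 : (\esum_(k in C) (expR (- (k.2%:R * s1)))%:E < kap%:E)%E.
    apply: le_lt_trans lt; apply: le_esum => k _; rewrite lee_fin ler_expR lerN2 ler_wpM2l //.
    by rewrite le_max lexx.
  have [x [Zx hx]] := hav C lt1; have [k Ck bk] := hC x Zx.
  by apply: (hx k Ck) => i hi'; apply: lt_le_trans (bk i hi') ee0.
have hlim : (kap%:E <= bowen_m f Z s e)%E.
  apply: lime_ge; last by apply: nearW => N; exact: hN.
  apply: ereal_nondecreasing_is_cvgn => N N' NN'; apply: ereal_inf_le_tmp => _ [C [c1 c2 c3] <-].
  by exists C => //; split=> // c /c2; exact: leq_trans.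
by move=> h0; move: hlim; rewrite h0 lee_fin leNgt kap0.
Qed.

(** The entropy at scale e is ln lam as soon as e <= e0. *)
Lemma htop_eq : 0 < e0 -> htop f Z = (ln lam)%:E.
Proof.
move=> e00; have hsc e : 0 < e -> e <= e0 -> htop_scale f Z e = (ln lam)%:E.
  move=> e1 e2; apply/eqP; rewrite eq_le; apply/andP; split.
    apply/lee_addgt0Pr => d d0; apply: ge_ereal_inf; exists (ln lam + d)%:E => //.
    by exists (ln lam + d) => //; apply: bowen_m_zero => //; rewrite ltrDl.
  apply: le_ereal_inf_tmp => _ [s hs <-]; rewrite lee_fin leNgt; apply/negP => lt.
  exact: bowen_m_pos e2 lt hs.
apply: lim_near_cst => //; near=> e; apply: hsc.
  by near: e; exact: nbhs_right_gt.
by near: e; exact: nbhs_right_ltW.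
Unshelve. all: by end_near. Qed.

End entropy_of_sets.

(** * Transfer to the Katok map *)

Section transfer.
Context {R : realType}.
Local Notation T2 := (torus R).
Local Notation lam := (lam R).
Local Notation cat := (@cat_map R).
Variables (f h hi : T2 -> T2).
Hypothesis ch : continuous h.
Hypothesis chi : continuous hi.
Hypothesis hK : cancel h hi.
Hypothesis hiK : cancel hi h.
Hypothesis hf : forall x, h (cat x) = f (h x).
Variables (m nu0 : probability T2 R).
Hypothesis hm : transl_inv m.
Hypothesis nu0E : forall A, measurable A -> nu0 A = m (h @^-1` A).

Let mpre (g : T2 -> T2) A : continuous g -> measurable A -> measurable (g @^-1` A).
Proof. by move=> cg mA; rewrite -[X in measurable X]setTI; exact: (ctst_meas _ cg). Qed.

Let fE x : f x = h (cat (hi x)). Proof. by rewrite hf hiK. Qed.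

Lemma f_cts : continuous f.
Proof.
rewrite (_ : f = h \o (cat \o hi)); last by apply/funext.
move=> x; apply: continuous_comp; last exact: ch.
by apply: continuous_comp; [exact: chi|exact: cat_cts].
Qed.

Let pre_f A : h @^-1` (f @^-1` A) = cat @^-1` (h @^-1` A).
Proof. by apply/seteqP; split=> x /=; rewrite hf. Qed.

Lemma nu0_ergodic : Defs.ergodic f nu0.
Proof.
have [minv merg] := haar_ergodic m hm; split=> [A mA|A mA fA].
  by rewrite !nu0E ?pre_f ?minv //; apply: mpre => //; exact: f_cts.
rewrite nu0E //; apply: merg; first exact: mpre.
by rewrite -pre_f fA.
Qed.

(** The measure of the cat map corresponding to an f-invariant measure. *)
Definition pull (mu : probability T2 R) : probability T2 R :=
  distribution mu (mfun_Sub (mem_set (ctst_meas _ chi))).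

Lemma pullE mu A : pull mu A = mu (hi @^-1` A). Proof. by []. Qed.

Lemma pull_invariant mu : Defs.invariant f mu -> Defs.invariant cat (pull mu).
Proof.
move=> hmu A mA; rewrite !pullE -[RHS]hmu; last exact: mpre.
by congr (mu _); apply/seteqP; split=> x /=; rewrite fE hK.
Qed.

Lemma pull_int mu (phi : T2 -> R) : continuous phi -> \int[pull mu]_x phi (h x) = \int[mu]_x phi x.
Proof.
move=> cphi; have cc : continuous (phi \o h).
  by move=> x; apply: continuous_comp; [exact: ch|exact: cphi].
rewrite -(Int_comp _ _ mu (pull mu) hi (phi \o h)); first by apply: eq_Rintegral => x _; rewrite /= hiK.
- exact: ctst_meas.
- exact: cts_bmf.
by move=> A mA; rewrite pullE.
Qed.

(** [metric_entropy_conj] for the conjugacy and for its inverse. *)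
Lemma entropy_sup (M : set (probability T2 R)) : M `<=` Minv f -> M nu0 ->
  ereal_sup [set metric_entropy f mu | mu in M] = (ln lam)%:E.
Proof.
move=> Minv Mnu0; apply/eqP; rewrite eq_le; apply/andP; split.
  apply: ge_ereal_sup => _ [mu /Minv hmu <-].
  apply: le_trans (entropy_le_ln_lam m (pull mu) hm (pull_invariant mu hmu)).
  apply: (metric_entropy_conj f cat (pull mu) mu h) => //; try exact: ctst_meas.
    by apply: ctst_meas; exact: f_cts.
  move=> A mA; rewrite pullE; congr (mu _); by apply/seteqP; split=> x /=; rewrite hiK.
apply: (@le_trans _ _ (metric_entropy f nu0)); last by apply: ereal_sup_ubound; exists nu0.
rewrite -(haar_entropy m hm).
apply: (metric_entropy_conj cat f nu0 m hi) => //; try exact: ctst_meas.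
- by apply: ctst_meas; exact: cat_cts.
- by move=> x; rewrite fE hK.
move=> A mA; rewrite nu0E; last exact: mpre.
by congr (m _); apply/seteqP; split=> x /=; rewrite hK.
Qed.

(** A sum that is everywhere less than l a would have a mean of at most l a. *)
Lemma high_orbits (mu : probability T2 R) (psi : T2 -> R) (a : R) : continuous psi -> Defs.invariant cat mu ->
  a < \int[mu]_x psi x -> forall l, exists y, l%:R * a <= Bsum psi l y.
Proof.
move=> cpsi hmu ha [|l]; first by exists (pt 0 0); rewrite mul0r /Bsum big_ord0.
apply: contrapT => /forallNP no.
have : \int[mu]_x Bsum psi l.+1 x <= l.+1%:R * a.
  by apply: Int_le_cst => [|y]; [exact: bmf_Bsum|apply: ltW; rewrite ltNge; apply/negP; exact: no].
by rewrite Int_Bsum // ler_pM2l ?ltr0n // leNgt ha.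
Qed.

Lemma historicN phi : historic f (fun x => - phi x) = historic f phi.
Proof.
have sub (p : T2 -> R) : historic f p `<=` historic f (fun x => - p x).
  move=> x /= hx hc; apply: hx.
  have -> : birkhoff_avg f p x = - birkhoff_avg f (fun x => - p x) x.
    by apply/funext => n; rewrite /GRing.opp /= /birkhoff_avg sumrN mulrN opprK.
  exact: is_cvgN.
apply/seteqP; split; last exact: sub.
by apply: subset_trans (sub _) _; rewrite (_ : (fun x => - - phi x) = phi) //; apply/funext => x; rewrite opprK.
Qed.

(** phi or - phi has a larger integral for mu than for nu0, and both have the same
    historic set. *)
Lemma historic_large (L : set T2) phi mu : continuous phi -> Minv_on L f nu0 -> Defs.invariant f mu ->
  \int[mu]_x phi x <> \int[nu0]_x phi x ->
  historic f phi `&` Nset f L !=set0 /\ htop f (historic f phi `&` Nset f L) = (ln lam)%:E.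
Proof.
move=> cphi hnu0 hmu ne.
wlog lt : phi cphi ne / \int[nu0]_x phi x < \int[mu]_x phi x.
  move=> H; have [lt|] := ltP (\int[nu0]_x phi x) (\int[mu]_x phi x); first exact: H.
  rewrite le_eqVlt => /orP[/eqP//|lt].
  have cN : continuous (fun x => - phi x) by move=> x; apply: continuousN; exact: cphi.
  have IN (nu : probability T2 R) : \int[nu]_x (- phi x) = - \int[nu]_x phi x.
    transitivity (\int[nu]_x (-1 * phi x)); first by apply: eq_Rintegral => x _; rewrite mulN1r.
    by rewrite IntZ ?mulN1r //; exact: cts_bmf.
  rewrite -historicN; apply: H => //; rewrite !IN; first by move=> /oppr_inj.
  by rewrite ltrN2.
have cpsi : continuous (phi \o h).
  by move=> x; apply: continuous_comp; [exact: ch|exact: cphi].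
pose delta := (\int[mu]_x phi x - \int[nu0]_x phi x) / 8.
have delta0 : 0 < delta by rewrite divr_gt0 // subr_gt0.
have Im : \int[m]_x (phi \o h) x = \int[nu0]_x phi x.
  apply: (Int_comp _ _ m nu0 h phi); [exact: ctst_meas|exact: cts_bmf|].
  by move=> A mA; rewrite nu0E.
have high : forall l, exists y, l%:R * (\int[m]_x (phi \o h) x + 4 * delta) <= Bsum (phi \o h) l y.
  apply: (high_orbits (pull mu)) => //; first exact: pull_invariant.
  by rewrite Im pull_int // /delta; lra.
have [e0 e00 narrow] := ball_narrow f h hi chi hK hf.
have nuE A : measurable A -> m (h @^-1` A) = nu0 A by move=> mA; rewrite nu0E.
have avoid s : 0 < s -> s < ln lam -> exists2 kappa : R, 0 < kappa &
  forall C : set (T2 * nat), (\esum_(k in C) (expR (- (k.2%:R * s)))%:E < kappa%:E)%E ->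
  exists x, (historic f phi `&` Nset f L) x /\ forall k, C k -> ~ bowen_ball f k.2 k.1 e0 x.
  move=> s0 sl.
  have [kap kap0 hav] := avoiding_point f h ch hf m nu0 phi delta e0 hm nuE cphi delta0 high narrow s s0 sl.
  exists kap => // C hC; have [x [h1 h2 h3]] := hav C hC; exists x; split=> //.
  by split=> //; exists nu0; split.
split; last exact: (htop_eq f h hi ch hiK hf _ e0 avoid e00).
have ll0 : 0 < ln lam by apply: ln_gt0; exact: lam_gt1.
have [kap kap0 hav] := avoid (ln lam / 2) (ltac:(lra)) (ltac:(lra)).
have [|x [Zx _]] := hav set0; last by exists x.
by rewrite esum_set0 lte_fin.
Qed.

End transfer.
Theorem corollary4p1 (R : realType)
    (* the Katok map f, with inverse fi, a C^(1+alpha) diffeomorphism *)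
    (r0 r1 : R) (psi : R -> R) (f fi : torus R -> torus R)
    (f_katok : katok_map r0 r1 psi f)
    (f_diffeo : C1alpha_diffeo f fi)
    (beta : R) (beta_gt0 : 0 < beta) :
  (* 0 < eps << beta *)
  exists2 eps0 : R, 0 < eps0 & forall eps : R, 0 < eps < eps0 ->
  forall (mu1 nu0 : probability (torus R) R)
    (conj conji : torus R -> torus R),
    max_entropy_measure (@cat_map R) mu1 ->
    continuous conj -> continuous conji ->
    cancel conj conji -> cancel conji conj ->
    (forall x, conj (cat_map x) = f (conj x)) ->
    (forall A, measurable A -> nu0 A = pushforward mu1 conj A) ->
  let L := pesin_set nu0 f fi beta beta eps in
  forall U : set (probability (torus R) R),
    Minv_nbhs f nu0 U ->
    (forall nu, U nu -> ergodic f nu -> Minv_on L f nu) ->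
  forall phi : torus R -> R, continuous phi ->
    (forall mu mu', Minv_on L f mu -> Minv_on L f mu' ->
       \int[mu]_x phi x = \int[mu']_x phi x)
    \/
    (historic f phi `&` Nset f L !=set0 /\
     htop f (historic f phi `&` Nset f L)
       = ereal_sup [set metric_entropy f mu | mu in Minv_on L f]).
Proof.
exists 1 => // eps _ mu1 nu0 conj conji mme cc cci K Ki hconj nu0E L U [_ hU] hL phi cphi.
have [m hm] := @exists_haar R.
have mu1E : forall A, measurable A -> mu1 A = m A.
  have [inv1 max1] := mme; apply: mme_unique => //.
  by rewrite -(haar_entropy m hm); apply: max1; exact: transl_inv_invariant.
have {}nu0E A : measurable A -> nu0 A = m (conj @^-1` A).
  move=> mA; rewrite nu0E // -mu1E //.
  by rewrite -[X in measurable X]setTI; exact: (ctst_meas _ cc).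
have nuerg := nu0_ergodic f conj conji cc cci Ki hconj m nu0 hm nu0E.
have Unu0 : U nu0 by apply: (nbhs_singleton hU); exact: nuerg.1.
have hnu0 := hL nu0 Unu0 nuerg.
have [all|] := pselect (forall mu, Minv_on L f mu -> \int[mu]_x phi x = \int[nu0]_x phi x).
  by left => mu mu' hmu hmu'; rewrite all // [RHS]all.
move=> /existsNP[mu /not_implyP[hmu ne]]; right.
have [ne0 ht] := historic_large f conj conji cc cci K Ki hconj m nu0 hm nu0E L phi mu cphi hnu0 hmu.1 ne.
split=> //; rewrite ht; apply/esym.
by apply: (entropy_sup f conj conji cc cci K Ki hconj m nu0 hm nu0E) => // nu [].
Qed.
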